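(* Let $k$ be an algebraically closed field of characteristic $p>2$, $G=SL_2$ over $k$, and let $\mathcal{P}_2(0)$ be the principal block of the category of finite dimensional projective $G_2T$-modules. Let $u_i:P_i\to P_{i+1}$ (for $-p\leq i\leq p-2$, $i\neq-1$) and $u'_i$ (for $-p+1\leq i\leq p-1$, $i\neq0$), with $u'_i:P_i\to P_{2p-i}$ for $i>0$ and $u'_i:P_i\to P_{-i}$ for $i<0$, be the homomorphisms defined in the context. Then the homomorphisms $$\{u_i\mid-p\leq i\leq p-2,\ i\neq-1\}\cup\{u'_i\mid-p+1\leq i\leq p-1,\ i\neq0\}$$ generate by taking direct sums, compositions (and linear combinations), duals, and by tensoring with $\pm2p^2$ all morphisms in $\mathcal{P}_2(0)$.
   Context: For $G=SL_2$ with maximal torus $T$, $X(T)=\mathbb{Z}$, the positive root is $2$, $\rho=1$. $F$ is the Frobenius endomorphism, $G_2=\ker F^2$, $G_2T=(F^2)^{-1}(T)$; $\Delta_2(n)=\mathrm{Ind}_{B_2^+T}^{G_2T}(n-2(p^2-1))$, where $B^+\supset T$ is the Borel subgroup with root $2$ and $B_2^+$ its second Frobenius kernel. $T_2(m)$ is the indecomposable projective (equivalently tilting) $G_2T$-module with highest weight $m$. The principal block $\mathcal{P}_2(0)$ has as indecomposable objects the $T_2(m)$ with $m\in W_p\cdot0=2p\mathbb{Z}\cup(-2+2p\mathbb{Z})$. Set $\lambda_i=ip$ if $i$ is even, $\lambda_i=(i+1)p-2$ if $i$ is odd, and $P_i=T_2(\lambda_i)$, $i\in\mathbb{Z}$;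 then $P_{i+2ap}=P_i\otimes2ap^2$ for $a\in\mathbb{Z}$, where $2ap^2\in X(T)$ is viewed as a one-dimensional $G_2T$-module. All multiplicities $(P_j:\Delta_2(n))=\dim\mathrm{Hom}_{G_2T}(\Delta_2(n),P_j)$ are $0$ or $1$. When $(P_j:\Delta_2(\lambda_i))=1$, $\bar g^{\lambda_i}(P_j)\in\mathrm{Hom}_{G_2T}(P_i,P_j)$ denotes an extension along $\Delta_2(\lambda_i)\subset T_2(\lambda_i)=P_i$ of a nonzero element of $\mathrm{Hom}_{G_2T}(\Delta_2(\lambda_i),P_j)$. Then $u_i=\bar g^{\lambda_i}(P_{i+1})$, and $u'_i=\bar g^{\lambda_i}(P_{2p-i})$ for $0<i\leq p-1$, $u'_i=\bar g^{\lambda_i}(P_{-i})$ for $-p+1\leq i<0$. Duals: ${}^\tau M$ is $M^*$ with action twisted by the involutive anti-automorphism $\tau$ which is the identity on $T$ and interchanges the two root subgroups. With symmetric isomorphisms $\phi_Q:Q\to{}^\tau Q$ for $Q\in\mathcal{P}_2(0)$ (chosen on indecomposables and extended additively), the dual of $f:Q\to P$ is $f^\dagger=\phi_Q^{-1}\circ f^*\circ\phi_P:P\to Q$. *)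

(* Defs.v *)
From HB Require Import structures.
From mathcomp Require Import all_boot all_order all_algebra.

Set Implicit Arguments.
Unset Strict Implicit.
Unset Printing Implicit Defensive.

Import Order.TTheory GRing.Theory Num.Theory.
Local Open Scope ring_scope.

(* Group schemes are treated as functors on commutative k-algebras. Since F is
   the p-th power map on matrix entries, it is defined over the prime field. *)

Section FrobeniusKernels.
Variables (k : fieldType) (p : nat).

Definition frob (A : comAlgType k) (g : 'M[A]_2) : 'M[A]_2 :=
  map_mx (fun x => x ^+ p) g.

Definition is_torus (A : comAlgType k) (t : 'M[A]_2) : bool :=
  is_diag_mx t && (\det t == 1).

(* With T the diagonal torus and n : int identified with diag(t, t^-1) |-> t^n,
   the root 2 belongs to the upper unitriangular root subgroup. *)
Definition is_borel (A : comAlgType k) (b : 'M[A]_2) : bool :=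
  (b 1 0 == 0) && (\det b == 1).

(* The value at b of the character n of T, inflated to the upper triangular
   matrices of determinant 1; there b 1 1 is the inverse of b 0 0. *)
Definition tchar (A : comAlgType k) (n : int) (b : 'M[A]_2) : A :=
  match n with
  | Posz m => b 0 0 ^+ m
  | Negz m => b 1 1 ^+ m.+1
  end.

(* The A-points of (F^2)^-1(T). *)
Definition in_G2T (A : comAlgType k) (g : 'M[A]_2) : bool :=
  (\det g == 1) && is_torus (frob (frob g)).

Record G2T (A : comAlgType k) := MkG2T { g2mx :> 'M[A]_2; g2mxP : in_G2T g2mx }.

HB.instance Definition _ (A : comAlgType k) := [isSub for @g2mx A].

Definition in_B2T (A : comAlgType k) (b : 'M[A]_2) : Prop :=
  exists t u : 'M[A]_2,
    [/\ is_torus t, is_borel u, frob (frob u) = 1%:M & b = t *m u].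

Lemma frob_map (A B : comAlgType k) (h : {lrmorphism A -> B}) (g : 'M[A]_2) :
  frob (map_mx h g) = map_mx h (frob g).
Proof. by apply/matrixP => i j; rewrite !mxE rmorphXn. Qed.

Lemma frob_tr (A : comAlgType k) (g : 'M[A]_2) : frob g^T = (frob g)^T.
Proof. by apply/matrixP => i j; rewrite !mxE. Qed.

Lemma G2T_map_subproof (A B : comAlgType k) (h : {lrmorphism A -> B})
  (g : G2T A) : in_G2T (map_mx h g).
Proof.
case: g => g /= /and3P[/eqP dg /is_diag_mxP Fg /eqP dFg].
rewrite /in_G2T /is_torus !frob_map !det_map_mx dg dFg rmorph1 eqxx andbT /=.
by apply/is_diag_mxP => i j ij; rewrite mxE Fg // rmorph0.
Qed.
Definition G2T_map (A B : comAlgType k) (h : {lrmorphism A -> B}) (g : G2T A) :=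
  MkG2T (G2T_map_subproof h g).

Lemma G2T_tr_subproof (A : comAlgType k) (g : G2T A) : in_G2T (g : 'M[A]_2)^T.
Proof.
by case: g => g /= gP; rewrite /in_G2T /is_torus !frob_tr is_diag_trmx !det_tr.
Qed.
Definition G2T_tr (A : comAlgType k) (g : G2T A) := MkG2T (G2T_tr_subproof g).

Hypothesis charp : p \in [pchar k].

Lemma pchar_alg (A : comAlgType k) : p \in [pchar A].
Proof. exact: (rmorph_pchar (in_alg A) charp). Qed.

Lemma frobE (A : comAlgType k) (g : 'M[A]_2) :
  frob g = map_mx (pFrobenius_aut (pchar_alg A)) g.
Proof. by apply/matrixP => i j; rewrite !mxE. Qed.

Lemma frobM (A : comAlgType k) (g h : 'M[A]_2) :
  frob (g *m h) = frob g *m frob h.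
Proof. by rewrite !frobE map_mxM. Qed.

Lemma frob1 (A : comAlgType k) : frob (1%:M : 'M[A]_2) = 1%:M.
Proof. by rewrite frobE map_mx1. Qed.

Lemma det_frob (A : comAlgType k) (g : 'M[A]_2) : \det g = 1 -> \det (frob g) = 1.
Proof. by move=> dg; rewrite frobE det_map_mx dg rmorph1. Qed.

Lemma is_torus1 (A : comAlgType k) : is_torus (1%:M : 'M[A]_2).
Proof. by rewrite /is_torus scalar_mx_is_diag det1 eqxx. Qed.

Lemma G2T_diag (A : comAlgType k) (g : G2T A) : is_diag_mx (frob (frob g)).
Proof. by case: g => g /= /and3P[]. Qed.

Lemma G2T_det (A : comAlgType k) (g : G2T A) : \det g = 1.
Proof. by case: g => g /= /and3P[/eqP]. Qed.

Lemma in_G2TP (A : comAlgType k) (g : 'M[A]_2) :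
  \det g = 1 -> is_diag_mx (frob (frob g)) -> in_G2T g.
Proof.
by move=> dg Fg; rewrite /in_G2T /is_torus Fg dg !det_frob ?eqxx.
Qed.

Lemma G2T_one_subproof (A : comAlgType k) : in_G2T (1%:M : 'M[A]_2).
Proof. by rewrite /in_G2T !frob1 is_torus1 det1 eqxx. Qed.
Definition G2T_one (A : comAlgType k) := MkG2T (G2T_one_subproof A).

Lemma is_diag_mulmx (A : comAlgType k) (g h : 'M[A]_2) :
  is_diag_mx g -> is_diag_mx h -> is_diag_mx (g *m h).
Proof.
by move=> /diag_mxP[d ->] /diag_mxP[e ->]; rewrite mulmx_diag diag_mx_is_diag.
Qed.

Lemma G2T_mul_subproof (A : comAlgType k) (g h : G2T A) :
  in_G2T ((g : 'M[A]_2) *m h).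
Proof.
apply: in_G2TP; first by rewrite det_mulmx !G2T_det mulr1.
by rewrite !frobM is_diag_mulmx ?G2T_diag.
Qed.
Definition G2T_mul (A : comAlgType k) (g h : G2T A) :=
  MkG2T (G2T_mul_subproof g h).

Lemma G2T_inv_subproof (A : comAlgType k) (g : G2T A) :
  in_G2T (\adj (g : 'M[A]_2)).
Proof.
have dg := G2T_det g; apply: in_G2TP.
  by have := det_mulmx g (\adj g); rewrite mul_mx_adj dg det1 mul1r => <-.
have /is_diag_mxP Fg := G2T_diag g.
have ->: frob (frob (\adj g)) = \adj (frob (frob g)) by rewrite !frobE !map_mx_adj.
apply/is_diag_mxP => i j neq_ij.
rewrite mxE /cofactor det_mx11 [X in _ * X]mxE [X in _ * X]mxE Fg ?mulr0 //.
by case: i j neq_ij => -[|[|//]] ? [[|[|//]] ?].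
Qed.
Definition G2T_inv (A : comAlgType k) (g : G2T A) :=
  MkG2T (G2T_inv_subproof g).

Lemma tcharM (A : comAlgType k) n (s t : 'M[A]_2) : is_diag_mx s ->
  is_diag_mx t -> tchar n (s *m t) = tchar n s * tchar n t.
Proof.
move=> /diag_mxP[d ->] /diag_mxP[e ->]; rewrite mulmx_diag.
by case: n => n; rewrite /tchar !mxE eqxx !mulr1n exprMn.
Qed.

Lemma tchar1 (A : comAlgType k) n : tchar n (1%:M : 'M[A]_2) = 1.
Proof. by case: n => n; rewrite /tchar mxE eqxx expr1n. Qed.

Lemma tchar_map (A B : comAlgType k) (h : {lrmorphism A -> B}) n (t : 'M[A]_2) :
  tchar n (map_mx h t) = h (tchar n t).
Proof. by case: n => n; rewrite /tchar mxE rmorphXn. Qed.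

(* A module with underlying space the column vectors over k; A-points act on
   the column vectors over A. *)
Record G2Tmod := MkG2Tmod {
  mdim : nat;
  act : forall A : comAlgType k, G2T A -> 'M[A]_mdim;
  act1 : forall A : comAlgType k, act (G2T_one A) = 1%:M;
  actM : forall (A : comAlgType k) (g h : G2T A),
    act (G2T_mul g h) = act g *m act h;
  act_map : forall (A B : comAlgType k) (f : {lrmorphism A -> B}) (g : G2T A),
    act (G2T_map f g) = map_mx f (act g) }.

Definition is_hom (M N : G2Tmod) (f : 'M[k]_(mdim N, mdim M)) : Prop :=
  forall (A : comAlgType k) (g : G2T A),
    act N g *m map_mx (in_alg A) f = map_mx (in_alg A) f *m act M g.

Definition is_iso (M N : G2Tmod) (f : 'M[k]_(mdim N, mdim M)) : Prop :=
  is_hom f /\ exists g : 'M[k]_(mdim M, mdim N),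
    [/\ is_hom g, g *m f = 1%:M & f *m g = 1%:M].

Definition isomorphic (M N : G2Tmod) : Prop :=
  exists f : 'M[k]_(mdim N, mdim M), is_iso f.

Definition injective_mx m n (f : 'M[k]_(m, n)) : Prop :=
  injective (fun v : 'cV[k]_n => f *m v).

Definition surjective_mx m n (f : 'M[k]_(m, n)) : Prop :=
  forall w : 'cV[k]_m, exists v : 'cV[k]_n, f *m v = w.

Lemma triv_subproof1 (A : comAlgType k) : (1%:M : 'M[A]_1) = 1%:M *m 1%:M.
Proof. by rewrite mulmx1. Qed.
Lemma triv_subproof2 (A B : comAlgType k) (f : {lrmorphism A -> B}) :
  (1%:M : 'M[B]_1) = map_mx f 1%:M.
Proof. by rewrite map_mx1. Qed.
Definition triv : G2Tmod :=
  @MkG2Tmod 1 (fun A _ => 1%:M) (fun A => erefl)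
    (fun A _ _ => triv_subproof1 A) (fun A B f _ => triv_subproof2 f).

Section Twist.
Variables (M : G2Tmod) (m : int).
Let twist_act (A : comAlgType k) (g : G2T A) : 'M[A]_(mdim M) :=
  tchar m (frob (frob g)) *: act M g.

Lemma twist_act1 (A : comAlgType k) : twist_act (G2T_one A) = 1%:M.
Proof. by rewrite /twist_act /= !frob1 tchar1 scale1r act1. Qed.

Lemma twist_actM (A : comAlgType k) (g h : G2T A) :
  twist_act (G2T_mul g h) = twist_act g *m twist_act h.
Proof.
rewrite /twist_act /= !frobM tcharM ?G2T_diag // actM.
by rewrite -scalemxAl -scalemxAr scalerA.
Qed.

Lemma twist_act_map (A B : comAlgType k) (f : {lrmorphism A -> B}) (g : G2T A) :
  twist_act (G2T_map f g) = map_mx f (twist_act g).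
Proof. by rewrite /twist_act /= !frob_map tchar_map act_map map_mxZ. Qed.

(* The tensor product of M with the one-dimensional G_2T-module m p^2 : a
   character m p^2 of T extends to G_2T as the composition of m with F^2. *)
Definition twist : G2Tmod := MkG2Tmod twist_act1 twist_actM twist_act_map.
End Twist.

Section TauDual.
Variable M : G2Tmod.
Let tau_act (A : comAlgType k) (g : G2T A) : 'M[A]_(mdim M) :=
  (act M (G2T_tr g))^T.

Lemma tau_act1 (A : comAlgType k) : tau_act (G2T_one A) = 1%:M.
Proof.
rewrite /tau_act (_ : G2T_tr _ = G2T_one A) ?act1 ?trmx1 //.
by apply/val_inj; rewrite /= trmx1.
Qed.

Lemma tau_actM (A : comAlgType k) (g h : G2T A) :
  tau_act (G2T_mul g h) = tau_act g *m tau_act h.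
Proof.
rewrite /tau_act (_ : G2T_tr _ = G2T_mul (G2T_tr h) (G2T_tr g)).
  by rewrite actM trmx_mul.
by apply/val_inj; rewrite /= trmx_mul.
Qed.

Lemma tau_act_map (A B : comAlgType k) (f : {lrmorphism A -> B}) (g : G2T A) :
  tau_act (G2T_map f g) = map_mx f (tau_act g).
Proof.
rewrite /tau_act (_ : G2T_tr _ = G2T_map f (G2T_tr g)).
  by rewrite act_map; apply/matrixP => i j; rewrite !mxE.
by apply/val_inj/matrixP => i j; rewrite !mxE.
Qed.

(* M^* in the dual basis, g acting as the transpose of tau(g) on M, where tau
   is the transposition of 2 x 2 matrices. *)
Definition tau_dual : G2Tmod := MkG2Tmod tau_act1 tau_actM tau_act_map.
End TauDual.

Section DirectSum.
Variables (n : nat) (M : 'I_n -> G2Tmod).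
Let dsum_act (A : comAlgType k) (g : G2T A) : 'M[A]_(\sum_i mdim (M i)) :=
  \mxdiag_i act (M i) g.

Lemma dsum_act1 (A : comAlgType k) : dsum_act (G2T_one A) = 1%:M.
Proof. by rewrite /dsum_act; under eq_mxdiag do rewrite act1; rewrite mxdiagZ. Qed.

Lemma dsum_actM (A : comAlgType k) (g h : G2T A) :
  dsum_act (G2T_mul g h) = dsum_act g *m dsum_act h.
Proof.
rewrite /dsum_act; under eq_mxdiag do rewrite actM.
rewrite {3}/mxdiag mul_mxdiag_mxblock; apply/eq_mxblock => i j.
by case: (eqVneq i j) => [<-|_]; rewrite ?conform_mx_id ?mulmx0.
Qed.

Lemma dsum_act_map (A B : comAlgType k) (f : {lrmorphism A -> B}) (g : G2T A) :
  dsum_act (G2T_map f g) = map_mx f (dsum_act g).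
Proof.
rewrite /dsum_act; under eq_mxdiag do rewrite act_map.
apply/matrixP => a b; rewrite !mxE.
move: (tagnat.sig1 a) (tagnat.sig2 a) (tagnat.sig1 b) (tagnat.sig2 b).
move=> i x j y; case: eqP => [eij|_]; last by rewrite !mxE rmorph0.
by case: _ / eij y => y; rewrite !conform_mx_id mxE.
Qed.

Definition dsum : G2Tmod := MkG2Tmod dsum_act1 dsum_actM dsum_act_map.
End DirectSum.


Definition projective (P : G2Tmod) : Prop :=
  forall (M N : G2Tmod) (q : 'M[k]_(mdim N, mdim M)) (f : 'M[k]_(mdim N, mdim P)),
    is_hom q -> surjective_mx q -> is_hom f ->
    exists h : 'M[k]_(mdim M, mdim P), is_hom h /\ q *m h = f.

Definition indecomposable (M : G2Tmod) : Prop :=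
  (0 < mdim M)%N /\
  forall N : 'I_2 -> G2Tmod, isomorphic M (dsum N) -> exists i, mdim (N i) = 0%N.

Definition is_summand (S M : G2Tmod) : Prop :=
  exists N : G2Tmod, isomorphic M (dsum (fun i : 'I_2 => if i == 0 then S else N)).

Definition is_weight (M : G2Tmod) (n : int) : Prop :=
  exists2 v : 'cV[k]_(mdim M), v != 0 &
    forall (A : comAlgType k) (t : G2T A), is_torus t ->
      act M t *m map_mx (in_alg A) v = tchar n t *: map_mx (in_alg A) v.

Definition highest_weight (M : G2Tmod) (m : int) : Prop :=
  is_weight M m /\ forall n, is_weight M n -> n <= m.

Definition is_T2 (m : int) (M : G2Tmod) : Prop :=
  [/\ projective M, indecomposable M & highest_weight M m].

(* Elements of k[G_2T], as morphisms from G_2T to the affine line. *)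
Record regfun := MkRegfun {
  regval :> forall A : comAlgType k, G2T A -> A;
  regval_map : forall (A B : comAlgType k) (f : {lrmorphism A -> B}) (g : G2T A),
    regval (G2T_map f g) = f (regval g) }.

(* f(g b) = l(b)^-1 f(g) for b in B_2^+T. *)
Definition in_Ind (l : int) (f : regfun) : Prop :=
  forall (A : comAlgType k) (g b : G2T A), in_B2T b ->
    f A (G2T_mul g b) = tchar (- l) b * f A g.

(* M is a matrix form of Ind_{B_2^+T}^{G_2T}(l) with respect to a basis e of the
   space of functions above, G_2T acting by left translation. *)
Definition is_Ind (l : int) (M : G2Tmod) : Prop :=
  exists e : 'I_(mdim M) -> regfun,
    [/\ forall j, in_Ind l (e j),
        forall f : regfun, in_Ind l f ->
          exists! c : 'cV[k]_(mdim M),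
            forall (A : comAlgType k) (x : G2T A),
              f A x = \sum_j c j 0 *: e j A x
      & forall (A : comAlgType k) (g x : G2T A) j,
          e j A (G2T_mul (G2T_inv g) x) = \sum_i act M g i j * e i A x].

Definition is_Delta2 (n : int) (M : G2Tmod) : Prop :=
  is_Ind (n - 2 * (p%:Z ^+ 2 - 1)) M.

(* Indecomposable projectives in the linkage class of the projective cover of
   the trivial module, linkage being generated by nonzero homomorphisms. *)
Inductive principal : G2Tmod -> Prop :=
| principal_triv P (f : 'M[k]_(mdim triv, mdim P)) :
    projective P -> indecomposable P -> is_hom f -> f != 0 -> principal P
| principal_from P Q (f : 'M[k]_(mdim Q, mdim P)) : principal P ->
    projective Q -> indecomposable Q -> is_hom f -> f != 0 -> principal Q
| principal_to P Q (f : 'M[k]_(mdim P, mdim Q)) : principal P ->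
    projective Q -> indecomposable Q -> is_hom f -> f != 0 -> principal Q.

Definition in_P20 (Q : G2Tmod) : Prop :=
  projective Q /\
  forall S, indecomposable S -> is_summand S Q -> principal S.

Definition lam (i : int) : int :=
  if (2 %| i)%Z then i * p%:Z else (i + 1) * p%:Z - 2.

(* f is an extension along some embedding of D into P (where D is Delta_2(n) and
   P is T_2(n), it is unique up to a scalar) of a nonzero homomorphism D -> Q. *)
Definition is_gbar (D P Q : G2Tmod) (f : 'M[k]_(mdim Q, mdim P)) : Prop :=
  is_hom f /\
  exists (iota : 'M[k]_(mdim P, mdim D)) (h : 'M[k]_(mdim Q, mdim D)),
    [/\ is_hom iota, injective_mx iota, is_hom h, h != 0 & f *m iota = h].

Definition is_symform (Q : G2Tmod) (phi : 'M[k]_(mdim Q)) : Prop :=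
  @is_iso Q (tau_dual Q) phi /\ phi^T = phi.

Definition u_range (i : int) : bool :=
  [&& - p%:Z <= i, i <= p%:Z - 2 & i != -1].

Definition u'_range (i : int) : bool :=
  [&& - p%:Z + 1 <= i, i <= p%:Z - 1 & i != 0].

Definition u'_target (i : int) : int := if 0 < i then 2 * p%:Z - i else - i.

Section Generation.
Variable P : int -> G2Tmod.

Inductive is_sumP : G2Tmod -> Prop :=
| is_sumP_base i : is_sumP (P i)
| is_sumP_dsum n (M : 'I_n -> G2Tmod) :
    (forall a, is_sumP (M a)) -> is_sumP (dsum M).

Variable phi : forall i : int, 'M[k]_(mdim (P i)).

(* The additive extension of phi to direct sums of the P i. *)
Inductive phi_ext : forall M : G2Tmod, 'M[k]_(mdim M) -> Prop :=
| phi_ext_base i : phi_ext (phi i)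
| phi_ext_dsum n (M : 'I_n -> G2Tmod) (psi : forall a, 'M[k]_(mdim (M a))) :
    (forall a, phi_ext (psi a)) -> @phi_ext (dsum M) (\mxdiag_a psi a).

Variables (u : forall i : int, 'M[k]_(mdim (P (i + 1)), mdim (P i)))
  (u' : forall i : int, 'M[k]_(mdim (P (u'_target i)), mdim (P i))).

(* Identities are the empty compositions, and 0 the empty linear combination;
   gen_dsum says that a morphism between two direct sums is generated as soon as
   its components are. Tensoring with a character does not change matrices. *)
Inductive generated : forall M N : G2Tmod, 'M[k]_(mdim N, mdim M) -> Prop :=
| gen_u i : u_range i -> @generated (P i) (P (i + 1)) (u i)
| gen_u' i : u'_range i -> @generated (P i) (P (u'_target i)) (u' i)
| gen_id M : is_sumP M -> @generated M M 1%:M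
| gen_comp L M N (f : 'M[k]_(mdim M, mdim L)) (g : 'M[k]_(mdim N, mdim M)) :
    generated f -> generated g -> @generated L N (g *m f)
| gen_zero M N : is_sumP M -> is_sumP N -> @generated M N 0
| gen_lin M N (c : k) (f g : 'M[k]_(mdim N, mdim M)) :
    generated f -> generated g -> @generated M N (c *: f + g)
| gen_dual M N (f : 'M[k]_(mdim N, mdim M)) (x : 'M[k]_(mdim M))
    (y : 'M[k]_(mdim N)) : generated f -> phi_ext x -> phi_ext y ->
    @generated N M (invmx x *m f^T *m y)
| gen_twist M N (f : 'M[k]_(mdim N, mdim M)) (a : int) :
    a = 2 \/ a = - 2 -> generated f -> @generated (twist M a) (twist N a) f
| gen_dsum m n (M : 'I_m -> G2Tmod) (N : 'I_n -> G2Tmod)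
    (f : forall b a, 'M[k]_(mdim (N b), mdim (M a))) :
    (forall a, is_sumP (M a)) -> (forall b, is_sumP (N b)) ->
    (forall a b, generated (f b a)) ->
    @generated (dsum M) (dsum N) (\mxblock_(b, a) f b a).

End Generation.

End FrobeniusKernels.

(* Main.v *)
(* Write N = p^2 and let E_r, F_r (r < N) be the divided powers acting on a
   G_2T-module; by the big cell, they and the weight projections determine the
   module. If P is an indecomposable projective with highest weight vector v,
   tensoring with Steinberg modules gives v in E_{N-1} P, so in the dual
   (injective) module F_{N-1} v <> 0 and this vector lies in every nonzero
   submodule. Hence P is determined by its highest weight, and for each weight n
   the space of singular vectors (killed by all E_r, r > 0) of weight n in P_j is
   at most one-dimensional; the relations E_r F_r F_s z = 0 modulo p show that it
   can be nonzero only if n = lambda_l with j = l, l + 1, or a reflection of l or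
   l + 1 in the next multiple of p. The Casimir element and -1 confine the highest
   weights in the principal block to the lambda_i.

   A nonzero f on Delta_2(lambda_l) does not kill the highest weight vector v_l.
   Thus u_l, u'_l, their twists, the composites u'_{l+1} u_l and, when p divides
   l + 1, the composite of u'_l with the dual of u_{l+1}, realise every possible
   singular vector of weight lambda_l as the image of v_l under a generated map
   P_l -> P_j. Finally, if n is the highest weight on which f : P_i -> P_j is
   nonzero, then n = lambda_l and f agrees on that weight space with a multiple of
   g_j g_i^dagger for such maps g_i : P_l -> P_i, g_j : P_l -> P_j; subtract it
   and induct on n. *)

Require Import Defs.
From HB Require Import structures.
From mathcomp Require Import all_boot all_order all_algebra.
From mathcomp Require Import boolp ring zify mxtens.

Set Implicit Arguments.
Unset Strict Implicit.
Unset Printing Implicit Defensive.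

Import Order.TTheory GRing.Theory Num.Theory.
Local Open Scope ring_scope.

(** * Algebras on two generators *)

(** A module is a functor on all commutative algebras, so it is probed at generic points: over
    k[x, y]/(x^N, y^N) for the root subgroups and over k[t, t^-1] for the torus. The relations
    between the E_r, F_r and weight projections are coefficients of identities between 2 x 2
    matrices over these algebras; after that, everything is linear algebra over k. The delicate
    point is that no u_l is given when p divides l + 1 (up to twists, l = -1 and l = p - 1),
    although P_{l+1} has a singular vector of weight lambda_l. It has to come from u_{l+1}^dagger
    u'_l, whose nonvanishing does not follow formally from that of its factors. If it vanished, the
    image of u_{l+1} in weight lambda_l would be orthogonal, for the contravariant form, to the
    singular vector of that weight in P_{l+2}, hence would lie in the image of F_1 and F_p; a
    computation with binomial coefficients modulo p then contradicts u_{l+1}(v_{l+1}) <> 0. *)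

Section PresentedAlgebra.
Variable k : fieldType.
Local Notation kxy := {poly {poly k}}.

Definition eval2 (B : comAlgType k) (a b : B) : kxy -> B :=
  horner_eval b \o map_poly (horner_alg a).

HB.instance Definition _ (B : comAlgType k) (a b : B) :=
  GRing.RMorphism.on (eval2 a b).

Lemma eval2C (B : comAlgType k) (a b : B) c : eval2 a b c%:P%:P = c%:A.
Proof. by rewrite /eval2 /= map_polyC /= horner_algC /horner_eval hornerC. Qed.

Lemma eval2x (B : comAlgType k) (a b : B) : eval2 a b 'X%:P = a.
Proof. by rewrite /eval2 /= map_polyC /= horner_algX /horner_eval hornerC. Qed.

Lemma eval2y (B : comAlgType k) (a b : B) : eval2 a b 'X = b.
Proof. by rewrite /eval2 /= map_polyX /horner_eval hornerX. Qed.

Definition ideal2 (g1 g2 : kxy) : pred kxy :=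
  fun q => `[< exists r1 r2, q = r1 * g1 + r2 * g2 >].

(** A k-point of the scheme cut out by the relations; evaluation there shows that 1 is not in the
    ideal, so that the quotient is a nonzero ring. *)
Definition common_zero (g1 g2 : kxy) :=
  exists ab : k * k, eval2 (ab.1 : k^o) (ab.2 : k^o) g1 = 0 /\
                     eval2 (ab.1 : k^o) (ab.2 : k^o) g2 = 0.

Record presentation := Presentation {
  rel1 : kxy; rel2 : kxy; relP : common_zero rel1 rel2 }.

Variable R : presentation.
Definition pres_ideal : pred kxy := ideal2 (rel1 R) (rel2 R).
Local Notation I := pres_ideal.

Lemma ideal2_closed : idealr_closed I.
Proof.
split.
- by apply/asboolP; exists 0, 0; rewrite !mul0r addr0.
- apply/negP => /asboolP[r1 [r2 eq1]].
  have [[a b] /= [h1 h2]] := relP R.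
  have /eqP := congr1 (eval2 (a : k^o) (b : k^o)) eq1.
  by rewrite rmorph1 rmorphD !rmorphM /= h1 h2 !mulr0 addr0 oner_eq0.
- move=> c u v /asboolP[r1 [r2 ->]] /asboolP[s1 [s2 ->]].
  apply/asboolP; exists (c * r1 + s1), (c * r2 + s2).
  by rewrite mulrDr !mulrDl !mulrA addrACA.
Qed.

HB.instance Definition _ := isIdealr.Build kxy I ideal2_closed.

Definition presented : Type := {ideal_quot (I : idealr kxy)}.
HB.instance Definition _ := GRing.ComNzRing.on presented.

Definition pres_pi : kxy -> presented := \pi_{ideal_quot (I : idealr kxy)}%qT.
HB.instance Definition _ := GRing.RMorphism.on pres_pi.

Definition pres_scale (c : k) (x : presented) : presented :=
  pres_pi c%:P%:P * x.

Lemma pres_scaleA c d x : pres_scale c (pres_scale d x) = pres_scale (c * d) x.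
Proof. by rewrite /pres_scale mulrA -rmorphM -!polyCM. Qed.
Lemma pres_scale1 : left_id 1 pres_scale.
Proof. by move=> x; rewrite /pres_scale !polyC1 rmorph1 mul1r. Qed.
Lemma pres_scaleDr : right_distributive pres_scale +%R.
Proof. by move=> c x y; rewrite /pres_scale mulrDr. Qed.
Lemma pres_scaleDl x : {morph pres_scale^~ x : c d / c + d}.
Proof. by move=> c d; rewrite /pres_scale !polyCD rmorphD mulrDl. Qed.
HB.instance Definition _ := GRing.Zmodule_isLmodule.Build k presented
  pres_scaleA pres_scale1 pres_scaleDr pres_scaleDl.
Lemma pres_scaleAl (c : k) (x y : presented) : c *: (x * y) = c *: x * y.
Proof. by rewrite /GRing.scale /= /pres_scale mulrA. Qed.
HB.instance Definition _ := GRing.Lmodule_isLalgebra.Build k presented pres_scaleAl.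
Lemma pres_scaleAr (c : k) (x y : presented) : c *: (x * y) = x * (c *: y).
Proof. by rewrite /GRing.scale /= /pres_scale mulrCA. Qed.
HB.instance Definition _ := GRing.Lalgebra_isAlgebra.Build k presented pres_scaleAr.

Definition pres_x : presented := pres_pi 'X%:P.
Definition pres_y : presented := pres_pi 'X.

Lemma pres_rel1 : pres_pi (rel1 R) = 0.
Proof.
apply/eqP; rewrite -[0](rmorph0 pres_pi) /pres_pi -Quotient.idealrBE subr0.
by apply/asboolP; exists 1, 0; rewrite mul1r mul0r addr0.
Qed.
Lemma pres_rel2 : pres_pi (rel2 R) = 0.
Proof.
apply/eqP; rewrite -[0](rmorph0 pres_pi) /pres_pi -Quotient.idealrBE subr0.
by apply/asboolP; exists 0, 1; rewrite mul1r mul0r add0r.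
Qed.

Lemma pres_repr (q : presented) : pres_pi (repr q) = q.
Proof. exact: reprK. Qed.

Lemma pres_eq (p q : kxy) : pres_pi p = pres_pi q ->
  exists r1 r2, p - q = r1 * rel1 R + r2 * rel2 R.
Proof.
by move/eqP; rewrite /pres_pi -Quotient.idealrBE => /asboolP.
Qed.

Section Lift.
Variables (B : comAlgType k) (a b : B).
Hypotheses (h1 : eval2 a b (rel1 R) = 0) (h2 : eval2 a b (rel2 R) = 0).

(** Evaluation of a representative. The two equations are arguments so that the morphism instances,
    whose proofs use them, can be attached to this function. *)
Definition pres_lift_def of eval2 a b (rel1 R) = 0 & eval2 a b (rel2 R) = 0 :=
 fun q : presented => eval2 a b (repr q).
Local Notation lift := (pres_lift_def h1 h2).

Lemma pres_lift_pi q : lift (pres_pi q) = eval2 a b q.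
Proof.
have [r1 [r2 e]] := pres_eq (pres_repr (pres_pi q)).
apply/eqP; rewrite -subr_eq0 /pres_lift_def -rmorphB e.
by rewrite rmorphD !rmorphM /= h1 h2 !mulr0 addr0.
Qed.

Lemma pres_lift_zmod : zmod_morphism lift.
Proof.
move=> p q; rewrite -(pres_repr p) -(pres_repr q) -rmorphB !pres_lift_pi.
exact: rmorphB.
Qed.
HB.instance Definition _ := GRing.isZmodMorphism.Build _ _ lift pres_lift_zmod.
Lemma pres_lift_monoid : monoid_morphism lift.
Proof.
split; first by rewrite -(rmorph1 pres_pi) pres_lift_pi rmorph1.
move=> p q; rewrite -(pres_repr p) -(pres_repr q) -rmorphM !pres_lift_pi.
exact: rmorphM.
Qed.
HB.instance Definition _ := GRing.isMonoidMorphism.Build _ _ lift pres_lift_monoid.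
Lemma pres_lift_scalable : scalable lift.
Proof.
move=> c q; rewrite -(pres_repr q) {1}/GRing.scale /= /pres_scale.
by rewrite -rmorphM !pres_lift_pi rmorphM /= eval2C mulr_algl.
Qed.
HB.instance Definition _ := GRing.isScalable.Build k presented B *:%R lift pres_lift_scalable.

Definition pres_lift : {lrmorphism presented -> B} := lift.

Lemma pres_liftE q : pres_lift (pres_pi q) = eval2 a b q.
Proof. exact: pres_lift_pi. Qed.
Lemma pres_liftx : pres_lift pres_x = a.
Proof. by rewrite pres_liftE eval2x. Qed.
Lemma pres_lifty : pres_lift pres_y = b.
Proof. by rewrite pres_liftE eval2y. Qed.
End Lift.
End PresentedAlgebra.

(** * Points of G_2T and the big cell *)

Section Mx2.
Definition mx2 (A : Type) (a b c d : A) : 'M[A]_2 :=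
  \matrix_(i, j) if i == 0 then (if j == 0 then a else b)
                 else (if j == 0 then c else d).

Lemma mx2_eta (A : Type) (g : 'M[A]_2) : g = mx2 (g 0 0) (g 0 1) (g 1 0) (g 1 1).
Proof.
apply/matrixP => i j; rewrite mxE.
by case: i j => -[|[|//]] hi [[|[|//]] hj] /=; congr (g _ _); apply/val_inj.
Qed.

Lemma mx2P (A : Type) (a b c d a' b' c' d' : A) :
  a = a' -> b = b' -> c = c' -> d = d' -> mx2 a b c d = mx2 a' b' c' d'.
Proof. by move=> -> -> -> ->. Qed.

Lemma mx2M (A : pzRingType) (a b c d a' b' c' d' : A) :
  mx2 a b c d *m mx2 a' b' c' d' =
  mx2 (a * a' + b * c') (a * b' + b * d') (c * a' + d * c') (c * b' + d * d').
Proof.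
apply/matrixP => i j; rewrite !mxE !big_ord_recl big_ord0 !mxE /= addr0.
by case: i j => -[|[|//]] hi [[|[|//]] hj] /=.
Qed.

Lemma mx2_1 (A : pzRingType) : mx2 1 0 0 1 = 1%:M :> 'M[A]_2.
Proof.
apply/matrixP => i j; rewrite !mxE.
by case: i j => -[|[|//]] hi [[|[|//]] hj] /=.
Qed.

Lemma map_mx2 (A B : Type) (f : A -> B) a b c d :
  map_mx f (mx2 a b c d) = mx2 (f a) (f b) (f c) (f d).
Proof. by apply/matrixP => i j; rewrite !mxE; case: (i == 0); case: (j == 0). Qed.

Lemma tr_mx2 (A : Type) (a b c d : A) : (mx2 a b c d)^T = mx2 a c b d.
Proof. by apply/matrixP => i j; rewrite !mxE; case: (i == 0); case: (j == 0). Qed.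

Lemma det_mx2 (A : comPzRingType) (a b c d : A) : \det (mx2 a b c d) = a * d - b * c.
Proof.
rewrite (expand_det_row _ 0) !big_ord_recl big_ord0 /cofactor !det_mx11 !mxE /=.
by rewrite addr0 /= /bump /= expr0 expr1 mul1r mulN1r mulrN.
Qed.

Lemma diag_mx2 (A : nmodType) (a b c d : A) :
  is_diag_mx (mx2 a b c d) = (b == 0) && (c == 0).
Proof.
apply/is_diag_mxP/andP => [h|[/eqP -> /eqP ->] i j].
  by have := h 0 1 isT; have := h 1 0 isT; rewrite !mxE /= => -> ->.
by rewrite !mxE; case: i j => -[|[|//]] hi [[|[|//]] hj] /=.
Qed.

Lemma adj_mx2 (A : comPzRingType) (a b c d : A) : \adj (mx2 a b c d) = mx2 d (- b) (- c) a.
Proof.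
apply/matrixP => i j; rewrite mxE /cofactor det_mx11 !mxE.
case: i j => -[|[|//]] hi [[|[|//]] hj] /=;
by rewrite /= /bump /= ?expr0 ?expr1 ?sqrrN ?expr1n ?mul1r ?mulN1r.
Qed.
End Mx2.

Section Elements.
Variables (k : fieldType) (p : nat) (charp : p \in [pchar k]).
Local Notation N := (p ^ 2)%N.

Lemma p_pr : prime p.
Proof. by have /andP[] := charp. Qed.
Lemma p_gt0 : (0 < p)%N. Proof. exact: prime_gt0 p_pr. Qed.
Lemma N_gt0 : (0 < N)%N. Proof. by rewrite expn_gt0 p_gt0. Qed.
Lemma N_gt1 : (1 < N)%N.
Proof. by rewrite -(exp1n 2) ltn_exp2r // prime_gt1 // p_pr. Qed.

Lemma pfrobD (A : comAlgType k) (a b : A) : (a + b) ^+ N = a ^+ N + b ^+ N.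
Proof.
have h := pchar_alg charp A.
have /= e x : x ^+ N = pFrobenius_aut h (pFrobenius_aut h x).
  by rewrite !pFrobenius_autE -exprM mulnn.
by rewrite !e !rmorphD.
Qed.

Lemma in_G2T_mx2 (A : comAlgType k) (a b c d : A) :
  in_G2T p (mx2 a b c d) = [&& a * d - b * c == 1, b ^+ N == 0 & c ^+ N == 0].
Proof.
have e : frob p (frob p (mx2 a b c d)) = mx2 (a ^+ N) (b ^+ N) (c ^+ N) (d ^+ N).
  by rewrite /frob !map_mx2 -!exprM !mulnn.
apply/idP/idP => [/and3P[]|/and3P[/eqP h1 /eqP h2 /eqP h3]].
  by rewrite det_mx2 e diag_mx2 => -> /andP[-> ->].
apply: (in_G2TP charp); first by rewrite det_mx2.
by rewrite e diag_mx2 h2 h3 !eqxx.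
Qed.

Section OverA.
Variable A : comAlgType k.
Implicit Types a b c d : A.

Lemma mkg_subproof a b c d : a * d - b * c = 1 -> b ^+ N = 0 -> c ^+ N = 0 ->
  in_G2T p (mx2 a b c d).
Proof. by rewrite in_G2T_mx2 => -> -> ->; rewrite !eqxx. Qed.
Definition mkg a b c d h1 h2 h3 := MkG2T (@mkg_subproof a b c d h1 h2 h3).

Lemma expN0 : (0 : A) ^+ N = 0.
Proof. by rewrite expr0n gtn_eqF // N_gt0. Qed.

Lemma up_subproof a : 1 * 1 - a * 0 = 1 :> A.
Proof. by rewrite mulr1 mulr0 subr0. Qed.
Definition up a (ha : a ^+ N = 0) := mkg (up_subproof a) ha expN0.

Lemma lo_subproof a : 1 * 1 - 0 * a = 1 :> A.
Proof. by rewrite mulr1 mul0r subr0. Qed.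
Definition lo a (ha : a ^+ N = 0) := mkg (lo_subproof a) expN0 ha.

Lemma tor_subproof a b : a * b = 1 -> a * b - 0 * 0 = 1 :> A.
Proof. by rewrite mulr0 subr0. Qed.
Definition tor a b (hab : a * b = 1) := mkg (tor_subproof hab) expN0 expN0.

Lemma G2T_ext (g h : G2T p A) : (g : 'M[A]_2) = h -> g = h.
Proof. exact: val_inj. Qed.

Lemma unip_inv b : b ^+ N = 0 -> exists e, (1 + b) * e = 1.
Proof.
move=> hb; exists (\sum_(i < N) (- b) ^+ i).
have := subrX1 (- b) N; rewrite exprNn hb mulr0 sub0r => h.
by rewrite (_ : 1 + b = - (- b - 1)) ?mulNr -?h ?opprK // opprB opprK.
Qed.

(** Since b and c are nilpotent, a d = 1 + b c is a unit with inverse e, and so d e is the inverse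
    of a: every point of G_2T lies in the big cell. *)
Lemma big_cell (g : G2T p A) : exists c t t' b hc htt hb,
  g = G2T_mul charp (@lo c hc) (G2T_mul charp (@tor t t' htt) (@up b hb)).
Proof.
case: g => g gP; have := gP; rewrite {1}(mx2_eta g) in_G2T_mx2.
set a := g 0 0; set b := g 0 1; set c := g 1 0; set d := g 1 1.
move=> /and3P[/eqP det1 /eqP hb /eqP hc].
have [e he] : exists e, (1 + b * c) * e = 1.
  by apply: unip_inv; rewrite exprMn hb mul0r.
have had : a * d = 1 + b * c by rewrite -det1 subrK.
have htt : a * (d * e) = 1 by rewrite mulrA had.
have hc' : (c * (d * e)) ^+ N = 0 by rewrite exprMn hc mul0r.
have hb' : ((d * e) * b) ^+ N = 0 by rewrite exprMn hb mulr0.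
exists (c * (d * e)), a, (d * e), ((d * e) * b), hc', htt, hb'.
apply: G2T_ext; rewrite /= [g]mx2_eta !mx2M -/a -/b -/c -/d.
apply: mx2P; rewrite ?mul0r ?mulr0 ?mul1r ?mulr1 ?addr0 ?add0r //.
- by rewrite mulrA htt mul1r.
- by rewrite -mulrA [d * e * a]mulrC htt mulr1.
- rewrite -[RHS]mul1r -{1}det1; move: htt he had => /= htt he had.
  have -> : c * (d * e) * (a * (d * e * b)) = b * c * (d * e) * (a * (d * e)) by ring.
  rewrite htt mulr1 det1 mul1r -[X in _ + X]mul1r -mulrDl [b * c + 1]addrC.
  by rewrite mulrCA he mulr1.
Qed.
End OverA.

Lemma G2T_tr_up (A : comAlgType k) (a : A) ha : G2T_tr (@up A a ha) = @lo A a ha.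
Proof. by apply: G2T_ext; rewrite /= tr_mx2. Qed.
Lemma G2T_tr_lo (A : comAlgType k) (a : A) ha : G2T_tr (@lo A a ha) = @up A a ha.
Proof. by apply: G2T_ext; rewrite /= tr_mx2. Qed.
Lemma G2T_tr_tor (A : comAlgType k) (a b : A) ha : G2T_tr (@tor A a b ha) = @tor A a b ha.
Proof. by apply: G2T_ext; rewrite /= tr_mx2. Qed.
End Elements.

(** * The algebra k[x, y]/(x^N, y^N) *)

Section TruncRing.
Variables (k : fieldType) (N : nat) (N_gt0 : (0 < N)%N).

Lemma trunc_zero : common_zero (('X ^+ N)%:P : {poly {poly k}}) ('X ^+ N).
Proof.
exists (0, 0); rewrite /= (rmorphXn polyC) !rmorphXn /= eval2x eval2y.
by rewrite expr0n gtn_eqF.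
Qed.
Definition trunc_pres := Presentation trunc_zero.
Definition trunc := presented trunc_pres.
HB.instance Definition _ := GRing.ComAlgebra.on trunc.
Local Notation R2 := (trunc : comAlgType k).
Definition Xt : trunc := pres_x trunc_pres.
Definition Yt : trunc := pres_y trunc_pres.

Lemma XtN : Xt ^+ N = 0.
Proof. by rewrite -rmorphXn -rmorphXn; exact: (pres_rel1 trunc_pres). Qed.
Lemma YtN : Yt ^+ N = 0.
Proof. by rewrite -rmorphXn; exact: (pres_rel2 trunc_pres). Qed.

Section Lift.
Variables (B : comAlgType k) (a b : B) (ha : a ^+ N = 0) (hb : b ^+ N = 0).
Lemma trunc_lift1 : eval2 a b (rel1 trunc_pres) = 0.
Proof. by rewrite /= rmorphXn rmorphXn /= eval2x. Qed.
Lemma trunc_lift2 : eval2 a b (rel2 trunc_pres) = 0.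
Proof. by rewrite /= rmorphXn /= eval2y. Qed.
Definition trunc_lift : {lrmorphism R2 -> B} := pres_lift trunc_lift1 trunc_lift2.
Lemma trunc_liftX : trunc_lift Xt = a. Proof. exact: pres_liftx. Qed.
Lemma trunc_liftY : trunc_lift Yt = b. Proof. exact: pres_lifty. Qed.
End Lift.

(** For r, s < N the coefficient does not depend on the representative, since multiples of x^N and
    y^N do not reach it. Outside this range it is 0, which keeps it well defined and linear for all
    indices. *)
Definition coef2 (r s : nat) (q : trunc) : k :=
  if (r < N)%N && (s < N)%N then (repr q)`_s`_r else 0.

Lemma coef2_pi r s q : (r < N)%N -> (s < N)%N ->
  coef2 r s (pres_pi trunc_pres q) = q`_s`_r.
Proof.
move=> hr hs; rewrite /coef2 hr hs /=.
have [r1 [r2 /= e]] := pres_eq (pres_repr (pres_pi trunc_pres q)).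
apply/eqP; rewrite -subr_eq0 -!coefB e coefD coefMXn hs addr0.
by rewrite coefMC coefMXn hr.
Qed.

Lemma coef2_linear r s : linear (coef2 r s : trunc -> k^o).
Proof.
move=> c x y; case h : ((r < N) && (s < N))%N; last first.
  by rewrite /coef2 h scaler0 addr0.
have /andP[hr hs] := h.
rewrite -(pres_repr x) -(pres_repr y) [c *: pres_pi _ _]/(pres_scale _ _).
rewrite /pres_scale -rmorphM -rmorphD !coef2_pi //.
by rewrite coefD coefCM coefD coefCM.
Qed.
HB.instance Definition _ r s :=
  GRing.isLinear.Build k trunc k^o _ (coef2 r s) (coef2_linear r s).

Lemma coef2_mono r s i j : (r < N)%N -> (s < N)%N ->
  coef2 r s (Xt ^+ i * Yt ^+ j) = ((r == i) && (s == j))%:R.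
Proof.
move=> hr hs; rewrite -!rmorphXn -rmorphM coef2_pi //.
rewrite coefCM coefXn; case: (s == j); last by rewrite mulr0 coef0 andbF.
by rewrite mulr1 coefXn andbT.
Qed.

Lemma coef2_expand (q : trunc) :
  q = \sum_(r < N) \sum_(s < N) coef2 r s q *: (Xt ^+ r * Yt ^+ s).
Proof.
(* The right-hand side as a linear map of q. It fixes every monomial, and the monomials span. *)
pose H (q : trunc) : trunc :=
  \sum_(r < N) \sum_(s < N) coef2 r s q *: (Xt ^+ r * Yt ^+ s).
have HL : linear H.
  move=> c x y; rewrite /H scaler_sumr -big_split /=; apply: eq_bigr => r _.
  rewrite scaler_sumr -big_split /=; apply: eq_bigr => s _.
  by rewrite linearP scalerDl scalerA.
pose HM := GRing.isLinear.Build k trunc trunc _ H HL.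
pose Hl : {linear trunc -> trunc} := HB.pack H HM.
have Hmono i j : Hl (Xt ^+ i * Yt ^+ j) = Xt ^+ i * Yt ^+ j.
  rewrite /= /H.
  case: (ltnP i N) => [hi|hi]; last first.
    rewrite (_ : Xt ^+ i = 0) ?mul0r; last by rewrite -(subnK hi) exprD XtN mulr0.
    by rewrite big1 // => r _; rewrite big1 // => s _; rewrite linear0 scale0r.
  case: (ltnP j N) => [hj|hj]; last first.
    rewrite (_ : Yt ^+ j = 0) ?mulr0; last by rewrite -(subnK hj) exprD YtN mulr0.
    by rewrite big1 // => r _; rewrite big1 // => s _; rewrite linear0 scale0r.
  rewrite (bigD1 (Ordinal hi)) //= [X in _ + X]big1 => [|r hr]; last first.
    rewrite big1 // => s _; rewrite coef2_mono // -val_eqE /= in hr *.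
    by rewrite (negbTE hr) scale0r.
  rewrite addr0 (bigD1 (Ordinal hj)) //= big1 => [|r hr]; last first.
    rewrite coef2_mono // -val_eqE /= in hr *.
    by rewrite (negbTE hr) andbF scale0r.
  by rewrite coef2_mono // !eqxx scale1r addr0.
rewrite -[RHS]/(Hl q).
rewrite -(pres_repr q); set f := repr q.
have -> : f = \poly_(s < size f) (\poly_(r < size f`_s) f`_s`_r).
  rewrite -[LHS]coefK; apply/polyP => i; rewrite !coef_poly.
  by case: ifP => // _; rewrite coefK.
rewrite poly_def rmorph_sum raddf_sum; apply: eq_bigr => s _.
rewrite -mul_polyC poly_def rmorphM rmorphXn /= -/Yt.
rewrite (raddf_sum polyC) rmorph_sum /= mulr_suml -[RHS]/(Hl _) raddf_sum; apply: eq_bigr => r _.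
rewrite -mul_polyC polyCM rmorphM rmorphXn rmorphXn /= -/Xt -[RHS]/(Hl _).
by rewrite -mulrA [_ * (_ * _)](_ : _ = f`_s`_r *: (Xt ^+ r * Yt ^+ s)) // [RHS]linearZ [Hl _]Hmono.
Qed.
End TruncRing.

(* The universal commutative algebra on two elements with vanishing N-th power,
   kept opaque because unification through the quotient is slow. *)
Record truncated (k : fieldType) (N : nat) := Truncated {
  tr_alg :> comAlgType k;
  trX : tr_alg; trY : tr_alg;
  trXN : trX ^+ N = 0; trYN : trY ^+ N = 0;
  tr_coef : nat -> nat -> {linear tr_alg -> k^o};
  tr_coef_ge : forall r s q, (N <= r)%N -> tr_coef r s q = 0;
  tr_mono : forall r s i j, (r < N)%N -> (s < N)%N ->
    tr_coef r s (trX ^+ i * trY ^+ j) = ((r == i) && (s == j))%:R;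
  tr_expand : forall q, q = \sum_(r < N) \sum_(s < N) tr_coef r s q *: (trX ^+ r * trY ^+ s);
  tr_lift : forall B : comAlgType k, forall a b : B, a ^+ N = 0 -> b ^+ N = 0 ->
    {lrmorphism tr_alg -> B};
  tr_liftX : forall (B : comAlgType k) (a b : B) (ha : a ^+ N = 0) (hb : b ^+ N = 0), tr_lift ha hb trX = a;
  tr_liftY : forall (B : comAlgType k) (a b : B) (ha : a ^+ N = 0) (hb : b ^+ N = 0), tr_lift ha hb trY = b }.

Lemma truncated_exists (k : fieldType) (N : nat) : (0 < N)%N -> truncated k N.
Proof.
move=> N0; apply: (@Truncated k N (trunc k N0) (Xt k N0) (Yt k N0) (XtN k N0) (YtN k N0)
  (fun r s => coef2 (N_gt0 := N0) r s : {linear trunc k N0 -> k^o}) _ _ _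
  (fun B a b ha hb => trunc_lift N0 ha hb)).
- by move=> r s q h; rewrite /= /coef2 ltnNge h.
- by move=> r s i j hr hs; apply: (coef2_mono k N0 i j hr hs).
- by move=> q; apply: coef2_expand.
- by move=> *; exact: trunc_liftX.
- by move=> *; exact: trunc_liftY.
Qed.

(** * The algebra k[x, y]/(x y - 1) and the independence of torus characters *)

Section Laurent.
Variable k : fieldType.
(* [-1] is taken in the coefficients: subtraction in {poly {poly k}} makes
   unification through [eval2] very slow. *)
Definition laurent_rel : {poly {poly k}} := 'X%:P * 'X + (- 1)%:P%:P.
Lemma eval2_laurent (B : comAlgType k) (a b : B) : eval2 a b laurent_rel = a * b - 1.
Proof. by rewrite rmorphD rmorphM /= eval2x eval2y eval2C scaleNr scale1r. Qed.
Lemma laurent_zero : common_zero laurent_rel 0.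
Proof. by exists (1, 1); rewrite /= eval2_laurent mulr1 subrr rmorph0. Qed.
Definition laurent_pres := Presentation laurent_zero.
Definition laurent := presented laurent_pres.
HB.instance Definition _ := GRing.ComAlgebra.on laurent.
Definition Lx : laurent := pres_x laurent_pres.
Definition Ly : laurent := pres_y laurent_pres.
Lemma LxLy : Lx * Ly = 1.
Proof.
apply/eqP; rewrite -subr_eq0 -rmorphM; apply/eqP.
rewrite -(pres_rel1 laurent_pres) [in RHS]rmorphD; congr (_ + _).
by rewrite -scaleN1r -[_ *: 1]/(pres_scale _ _) /pres_scale mulr1.
Qed.
Section Lift.
Variables (B : comAlgType k) (a b : B) (hab : a * b = 1).
Lemma laurent_lift1 : eval2 a b (rel1 laurent_pres) = 0.
Proof. by rewrite eval2_laurent hab subrr. Qed.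
Lemma laurent_lift2 : eval2 a b (rel2 laurent_pres) = 0.
Proof. exact: rmorph0. Qed.
Definition laurent_lift : {lrmorphism (laurent : comAlgType k) -> B} :=
  pres_lift laurent_lift1 laurent_lift2.
Lemma laurent_liftx : laurent_lift Lx = a. Proof. exact: pres_liftx. Qed.
Lemma laurent_lifty : laurent_lift Ly = b. Proof. exact: pres_lifty. Qed.
Lemma laurent_liftE q : laurent_lift q = eval2 a b (repr q).
Proof. by []. Qed.
End Lift.
End Laurent.

Lemma eval2_expand (k : fieldType) (B : comAlgType k) (a b : B) D (f : {poly {poly k}}) :
  (size f <= D)%N -> (forall j, (size (f`_j)%R <= D)%N) ->
  eval2 a b f = \sum_(i < D) \sum_(j < D) (a ^+ i * b ^+ j) * (f`_j`_i)%:A.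
Proof.
move=> h1 h2; rewrite /eval2 /= /horner_eval (@horner_coef_wide _ D); last first.
  by rewrite (leq_trans (size_poly _ _)).
rewrite exchange_big; apply: eq_bigr => j _ /=.
rewrite coef_map /= /horner_alg /horner_morph (@horner_coef_wide _ D); last first.
  by rewrite (leq_trans (size_poly _ _)).
rewrite mulr_suml; apply: eq_bigr => i _; rewrite coef_map /=.
by rewrite -[LHS]mulrA [LHS]mulrC.
Qed.

(* The coordinate ring of the multiplicative group. *)
Record laurent_ring (k : fieldType) := LaurentRing {
  lr_alg :> comAlgType k;
  lrx : lr_alg; lry : lr_alg; lrxy : lrx * lry = 1;
  lr_repr : lr_alg -> {poly {poly k}};
  lr_lift : forall B : comAlgType k, forall a b : B, a * b = 1 -> {lrmorphism lr_alg -> B};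
  lr_liftx : forall (B : comAlgType k) (a b : B) (h : a * b = 1), lr_lift h lrx = a;
  lr_lifty : forall (B : comAlgType k) (a b : B) (h : a * b = 1), lr_lift h lry = b;
  lr_liftE : forall (B : comAlgType k) (a b : B) (h : a * b = 1) q, lr_lift h q = eval2 a b (lr_repr q) }.

Lemma laurent_exists (k : fieldType) : laurent_ring k.
Proof.
apply: (@LaurentRing k (laurent k) (Lx k) (Ly k) (LxLy k) (fun q => repr q)
  (fun B a b h => laurent_lift h)).
- by move=> *; exact: laurent_liftx.
- by move=> *; exact: laurent_lifty.
- by move=> *; exact: laurent_liftE.
Qed.

(** If f <> 0, then f X + 1 is not constant and has a root; this root is nonzero and is not a root
    of f. *)
Lemma closed_field_poly0 (k : closedFieldType) (f : {poly k}) :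
  (forall c, c != 0 -> f.[c] = 0) -> f = 0.
Proof.
move=> h; apply/eqP; apply/negPn/negP => f0.
have : size (f * 'X + 1%:P) != 1%N.
  have f1 : (0 < size f)%N by rewrite lt0n size_poly_eq0.
  by rewrite size_polyDl size_mulX ?size_polyC ?oner_eq0 //= eqSS -lt0n.
move=> /closed_rootP[c /rootP]; rewrite hornerD hornerMX hornerC => hc.
case: (eqVneq c 0) => [c0|/h fc]; move: hc.
  by rewrite c0 mulr0 add0r => /eqP; rewrite oner_eq0.
by rewrite fc mul0r add0r => /eqP; rewrite oner_eq0.
Qed.

Section IntPow.
Variable k : closedFieldType.

(** Linear independence of the characters c |-> c^n on the k-points of the torus. It lets weights be
    detected on k-points, although modules are functors. *)
Lemma laurent_indep m n D K (V : nat -> 'M[k]_(m, n)) :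
  (forall c : k, c != 0 -> \sum_(i < K) (c ^ (i%:Z - D%:Z)) *: V i = 0) ->
  forall i, (i < K)%N -> V i = 0.
Proof.
move=> h i hi; apply/matrixP => a b; rewrite mxE.
pose f := \poly_(i < K) V i a b.
have : f = 0.
  apply: closed_field_poly0 => c c0; rewrite horner_poly.
  have /matrixP/(_ a b) := h c c0; rewrite summxE mxE => /(congr1 ( *%R (c ^ D%:Z))).
  rewrite mulr0 mulr_sumr => e0; rewrite -[RHS]e0; apply: eq_bigr => j _; rewrite !mxE mulrA -expfzDr //.
  by rewrite addrC subrK mulrC.
by move=> /polyP/(_ i); rewrite coef_poly hi coef0.
Qed.
End IntPow.

(** * Powers of units with integer exponents *)

Definition tch (A : pzRingType) (n : int) (a b : A) : A :=
  match n with Posz m => a ^+ m | Negz m => b ^+ m.+1 end.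

Section Tch.
Variables (A : comPzRingType) (a b : A) (hab : a * b = 1).

Lemma tch_tchar (k : fieldType) (A' : comAlgType k) n (g : 'M[A']_2) : tchar n g = tch n (g 0 0) (g 1 1).
Proof. by case: n. Qed.

Lemma tchN n : tch (- n) a b = tch n b a.
Proof. by case: n => [[|m]|m] //=. Qed.

Lemma tchB (i j : nat) : tch (i%:Z - j%:Z) a b = a ^+ i * b ^+ j.
Proof.
have hn m : a ^+ m * b ^+ m = 1 by rewrite -exprMn hab expr1n.
case: (leqP j i) => [h|h].
  rewrite subzn //= -{2}(subnK h) exprD -mulrA hn mulr1 //.
rewrite -[X in tch X](opprK) opprB subzn ?tchN ?(ltnW h) //=.
by rewrite -{2}(subnK (ltnW h)) exprD mulrCA hn mulr1.
Qed.

Lemma tch_sub (m : int) (j : nat) : tch m a b * b ^+ j = tch (m - j%:Z) a b.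
Proof.
have [x [y ->]] : exists x y : nat, m = x%:Z - y%:Z.
  by case: m => m; [exists m, 0%N|exists 0%N, m.+1]; rewrite ?subr0 // NegzE sub0r.
by rewrite tchB -mulrA -exprD -tchB PoszD; congr tch; lia.
Qed.
End Tch.

Section Zmod.
Variable N : nat.
(** The torus elements met below have the form u = 1 + a b with u^N = 1, so an integer exponent of u
    counts only modulo N; this is where the residues inside binomial coefficients come from. *)
Definition zres (n : int) : nat := `|(n %% N%:Z)%Z|%N.

Lemma tch_zres (A : comPzRingType) (u e : A) n : (0 < N)%N ->
  u * e = 1 -> u ^+ N = 1 -> tch n u e = u ^+ zres n.
Proof.
move=> N0 ue uN.
have hz : (zres n)%:Z = (n %% N%:Z)%Z.
  by rewrite /zres gez0_abs // modz_ge0 // -lt0n.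
have e1 : n = ((n %/ N%:Z)%Z * N%:Z) + (zres n)%:Z by rewrite hz -divz_eq.
have eN : e ^+ N = 1.
  by have := congr1 (fun x => x ^+ N) ue; rewrite exprMn uN mul1r expr1n.
rewrite {1}e1; case: (n %/ N%:Z)%Z => q.
  by rewrite -!PoszM -PoszD /= exprD mulnC exprM uN expr1n mul1r.
rewrite NegzE mulNr -PoszM addrC tchB // mulnC exprM eN expr1n mulr1.
by [].
Qed.
End Zmod.

(** * Divided powers and weights *)

Notation "f %:sc[ A ]" := (map_mx (in_alg A) f) (at level 2, format "f %:sc[ A ]").

Section Operators.
Variables (k : closedFieldType) (p : nat) (charp : p \in [pchar k]).
Local Notation N := (p ^ 2)%N.
Local Notation mod := (G2Tmod charp).
Definition trunc2 : truncated k N := truncated_exists k (N_gt0 charp).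
Local Notation R2 := trunc2.
Local Notation X := (trX trunc2).
Local Notation coef2 := (tr_coef trunc2).
Definition lring : laurent_ring k := laurent_exists k.
Let N0 : (0 < N)%N := N_gt0 charp.
Local Notation kk := (k^o : comAlgType k).

Implicit Types M L : mod.

Lemma act_irr M (A : comAlgType k) (g h : G2T p A) :
  (g : 'M[A]_2) = h -> act M g = act M h.
Proof. by move/val_inj->. Qed.

Lemma map_mx_sc (A B : comAlgType k) (f : {lrmorphism A -> B}) m n (U : 'M[k]_(m, n)) :
  map_mx f U%:sc[A] = U%:sc[B].
Proof. by apply/matrixP => i j; rewrite !mxE linearZ rmorph1. Qed.

Lemma sc_id m n (U : 'M[k]_(m, n)) : U%:sc[kk] = U.
Proof. by apply/matrixP => i j; rewrite !mxE; exact: mulr1. Qed.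

Lemma sc_scale (A : comAlgType k) (c : k) m n (U : 'M[k]_(m, n)) :
  (c *: U)%:sc[A] = c%:A *: U%:sc[A].
Proof. by rewrite map_mxZ. Qed.

Section Coef.
Variables (r s : nat).
Lemma coefmx_sum I (P : pred I) (ri : seq I) m n (F : I -> 'M[R2]_(m, n)) :
  map_mx (coef2 r s) (\sum_(i <- ri | P i) F i) =
  \sum_(i <- ri | P i) map_mx (coef2 r s) (F i).
Proof. exact: (raddf_sum (map_mx (coef2 r s))). Qed.

Lemma coefmxZ (a : R2) m n (U : 'M[k]_(m, n)) :
  map_mx (coef2 r s) (a *: U%:sc[R2]) = coef2 r s a *: U.
Proof.
apply/matrixP => i j; rewrite !mxE -[_ * _]/(a * (U i j *: 1)) mulr_algr linearZ /=.
exact: mulrC.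
Qed.

Lemma coefmx_mull m n q (U : 'M[k]_(m, n)) (V : 'M[R2]_(n, q)) :
  map_mx (coef2 r s) (U%:sc[R2] *m V) = U *m map_mx (coef2 r s) V.
Proof.
apply/matrixP => i j; rewrite !mxE raddf_sum; apply: eq_bigr => l _.
by rewrite !mxE /= mulr_algl linearZ.
Qed.

Lemma coefmx_mulr m n q (V : 'M[R2]_(m, n)) (U : 'M[k]_(n, q)) :
  map_mx (coef2 r s) (V *m U%:sc[R2]) = map_mx (coef2 r s) V *m U.
Proof.
apply/matrixP => i j; rewrite !mxE raddf_sum; apply: eq_bigr => l _.
rewrite !mxE /= mulr_algr linearZ; exact: mulrC.
Qed.
End Coef.

Lemma mul_scale_sc (A : comAlgType k) (a b : A) m n q (U : 'M[k]_(m, n)) (V : 'M[k]_(n, q)) :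
  (a *: U%:sc[A]) *m (b *: V%:sc[A]) = (a * b) *: (U *m V)%:sc[A].
Proof. by rewrite map_mxM -scalemxAl -scalemxAr scalerA. Qed.

Lemma mul_scale_sc1 (A : comAlgType k) (a : A) m n q (U : 'M[k]_(m, n)) (V : 'M[k]_(n, q)) :
  (a *: U%:sc[A]) *m V%:sc[A] = a *: (U *m V)%:sc[A].
Proof. by rewrite map_mxM -scalemxAl. Qed.

(* Divided powers of the root vectors: act (up a) = \sum_r a^r E_r. *)
Definition opE M r : 'M[k]_(mdim M) := map_mx (coef2 r 0) (act M (up charp (trXN trunc2))).
Definition opF M r : 'M[k]_(mdim M) := map_mx (coef2 r 0) (act M (lo charp (trXN trunc2))).

Lemma opE_ge M r : (N <= r)%N -> opE M r = 0.
Proof. by move=> h; apply/matrixP => i j; rewrite !mxE tr_coef_ge. Qed.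
Lemma opF_ge M r : (N <= r)%N -> opF M r = 0.
Proof. by move=> h; apply/matrixP => i j; rewrite !mxE tr_coef_ge. Qed.

(** Specialising y to 0 keeps only the monomials x^r, so the matrix at the generic nilpotent X
    determines the matrix at a. *)
Lemma trunc_expand (A : comAlgType k) (a : A) (ha : a ^+ N = 0) m n
  (U : 'M[R2]_(m, n)) :
  map_mx (tr_lift R2 ha (expN0 charp A)) U =
  \sum_(r < N) a ^+ r *: (map_mx (coef2 r 0) U)%:sc[A].
Proof.
have := tr_liftX R2 ha (expN0 charp A); have := tr_liftY R2 ha (expN0 charp A).
move: (tr_lift _ _ _) => f fY fX.
apply/matrixP => i j; rewrite summxE mxE [U i j in LHS]tr_expand raddf_sum.
apply: eq_bigr => r _; rewrite raddf_sum (bigD1 (Ordinal N0)) //= big1 ?addr0.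
  rewrite linearZ rmorphM !rmorphXn /= fX expr0 mulr1 !mxE.
  by rewrite /= mulr_algr.
move=> s hs; rewrite linearZ rmorphM !rmorphXn /= fY expr0n.
by rewrite -val_eqE /= in hs; rewrite (negbTE hs) mulr0 scaler0.
Qed.

Lemma act_up M (A : comAlgType k) (a : A) (ha : a ^+ N = 0) :
  act M (up charp ha) = \sum_(r < N) a ^+ r *: (opE M r)%:sc[A].
Proof.
rewrite -trunc_expand -act_map; apply: act_irr.
by rewrite /= map_mx2 rmorph0 rmorph1 tr_liftX.
Qed.
Lemma act_lo M (A : comAlgType k) (a : A) (ha : a ^+ N = 0) :
  act M (lo charp ha) = \sum_(r < N) a ^+ r *: (opF M r)%:sc[A].
Proof.
rewrite -trunc_expand -act_map; apply: act_irr.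
by rewrite /= map_mx2 rmorph0 rmorph1 tr_liftX.
Qed.

Local Notation kxy := {poly {poly k}}.
Definition degbound m n (T : 'M[kxy]_(m, n)) : nat :=
  \max_(i < m) \max_(j < n)
     maxn (size (T i j)) (\max_(l < size (T i j)) size ((T i j)`_l)%R).

Lemma degbound1 m n (T : 'M[kxy]_(m, n)) i j : (size (T i j) <= degbound T)%N.
Proof.
apply: leq_trans (leq_bigmax i); apply: leq_trans (leq_bigmax j).
exact: leq_maxl.
Qed.

Lemma degbound2 m n (T : 'M[kxy]_(m, n)) i j l :
  (size ((T i j)`_l)%R <= degbound T)%N.
Proof.
case: (ltnP l (size (T i j))) => h; last by rewrite nth_default // size_poly0.
apply: leq_trans (leq_bigmax i); apply: leq_trans (leq_bigmax j).
apply: leq_trans (leq_maxr _ _); exact: (leq_bigmax (Ordinal h)).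
Qed.

Definition torpoly M : 'M[kxy]_(mdim M) :=
  map_mx (@lr_repr k lring) (act M (tor charp (lrxy lring))).

Definition tor_coef M (i j : nat) : 'M[k]_(mdim M) :=
  map_mx (fun q : kxy => q`_j`_i) (torpoly M).

(* Every exponent occurring in the matrix of a torus element is less than wbound. *)
Definition wbound M : nat := degbound (torpoly M).

Lemma act_tor_coef M (A : comAlgType k) (a b : A) (hab : a * b = 1) :
  act M (tor charp hab) =
  \sum_(i < wbound M) \sum_(j < wbound M) (a ^+ i * b ^+ j) *: (tor_coef M i j)%:sc[A].
Proof.
transitivity (map_mx (eval2 a b) (torpoly M)).
  have -> : tor charp hab = G2T_map (lr_lift lring hab) (tor charp (lrxy lring)).
    by apply: G2T_ext; rewrite /= map_mx2 lr_liftx lr_lifty rmorph0.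
  rewrite act_map /torpoly; move: (act M _) => U.
  by apply/matrixP => i j; rewrite mxE lr_liftE [RHS]mxE [in RHS]mxE.
rewrite /tor_coef /wbound; move: (torpoly M) => T.
apply/matrixP => i j.
rewrite mxE (eval2_expand _ _ (degbound1 T i j) (degbound2 T i j)).
rewrite summxE; apply: eq_bigr => r _; rewrite summxE; apply: eq_bigr => s _.
by rewrite !mxE.
Qed.

(** The individual [tor_coef M i j] depend on the polynomials chosen to represent classes modulo x y
    - 1. Their sum over i - j = n does not: it is the projection onto the weight space n. *)
Definition wproj M (n : int) : 'M[k]_(mdim M) :=
  \sum_(i < wbound M) \sum_(j < wbound M | i%:Z - j%:Z == n) tor_coef M i j.

Local Notation wt M i := (i%:Z - (wbound M)%:Z).
Local Notation wK M := ((wbound M).*2.+1).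

Lemma wproj_out M n : (n < - (wbound M)%:Z) || ((wbound M)%:Z < n) -> wproj M n = 0.
Proof.
move=> h; rewrite /wproj big1 // => i _; rewrite big1 // => j /eqP e.
have := ltn_ord i; have := ltn_ord j; lia.
Qed.

Lemma act_tor M (A : comAlgType k) (a b : A) (hab : a * b = 1) :
  act M (tor charp hab) =
  \sum_(m < wK M) tch (wt M m) a b *: (wproj M (wt M m))%:sc[A].
Proof.
rewrite act_tor_coef.
transitivity (\sum_(i < wbound M) \sum_(j < wbound M) \sum_(m < wK M | i%:Z - j%:Z == wt M m)
   tch (i%:Z - j%:Z) a b *: (tor_coef M i j)%:sc[A]).
  apply: eq_bigr => i _; apply: eq_bigr => j _.
  have hm : (i + (wbound M - j) < wK M)%N.
    by have := ltn_ord i; have := ltn_ord j; lia.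
  rewrite (big_pred1 (Ordinal hm)) ?tchB // => m /=.
  have := ltn_ord i; have := ltn_ord j => h1 h2.
  apply/eqP/eqP => [e|->]; last by rewrite /=; lia.
  by apply/val_inj => /=; lia.
under eq_bigr do rewrite (exchange_big_dep xpredT) //=.
rewrite exchange_big /=; apply: eq_bigr => m _.
rewrite /wproj raddf_sum scaler_sumr; apply: eq_bigr => i _.
rewrite raddf_sum scaler_sumr; apply: eq_bigr => j /eqP e.
by rewrite e.
Qed.

Lemma unitVr (c : k) : c != 0 -> (c : kk) * c^-1 = 1.
Proof. exact: divff. Qed.

Definition rho M (c : k) : 'M[k]_(mdim M) :=
  \sum_(m < wK M) c ^ (wt M m) *: wproj M (wt M m).

Lemma act_rho M (c : k) (hc : c != 0) : act M (tor charp (unitVr hc)) = rho M c.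
Proof.
rewrite act_tor /rho; apply: eq_bigr => m _.
rewrite sc_id; congr (_ *: _).
by case: (wt M m) => q //=; rewrite NegzE /exprz exprVn.
Qed.

Lemma rho1 M : rho M 1 = 1%:M.
Proof.
rewrite -(act_rho M (oner_neq0 k)); apply: etrans _ (act1 M kk); apply: act_irr.
by rewrite /= invr1 mx2_1.
Qed.

Lemma rhoM M c d : c != 0 -> d != 0 -> rho M (c * d) = rho M c *m rho M d.
Proof.
move=> hc hd; have hcd : c * d != 0 by rewrite mulf_neq0.
rewrite -(act_rho M hcd) -(act_rho M hc) -(act_rho M hd).
transitivity (act M (G2T_mul charp (tor charp (unitVr hc)) (tor charp (unitVr hd)))).
  apply: (@act_irr M kk).
  by rewrite /= mx2M; apply: mx2P; rewrite ?mulr0 ?mul0r ?addr0 ?add0r // invfM.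
exact: (@actM _ _ _ M kk).
Qed.

Lemma wproj_sum M : \sum_(m < wK M) wproj M (wt M m) = 1%:M.
Proof.
by rewrite -rho1 /rho; apply: eq_bigr => m _; rewrite exp1rz scale1r.
Qed.

Lemma rho_wproj M c n : c != 0 -> rho M c *m wproj M n = c ^ n *: wproj M n.
Proof.
move=> hc.
have hin m : (m < wK M)%N ->
   rho M c *m wproj M (wt M m) = c ^ (wt M m) *: wproj M (wt M m).
  move=> hm; apply/eqP; rewrite -subr_eq0; apply/eqP; move: m hm.
  (* Compare the coefficients of the characters of d in rho(c) rho(d) = rho(c d). *)
  apply: (@laurent_indep _ _ _ (wbound M)) => d hd.
  under eq_bigr do rewrite scalerBr.
  rewrite sumrB; apply/eqP; rewrite subr_eq0; apply/eqP.
  transitivity (rho M c *m rho M d).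
    rewrite [rho M d]/rho mulmx_sumr; apply: eq_bigr => m _.
    by rewrite -scalemxAr.
  rewrite -rhoM // /rho; apply: eq_bigr => m _.
  by rewrite scalerA expfzMl mulrC.
case: (boolP ((n < - (wbound M)%:Z) || ((wbound M)%:Z < n))) => h.
  by rewrite wproj_out // mulmx0 scaler0.
have [m [hm ->]] : exists m : nat, (m < wK M)%N /\ n = wt M m.
  by exists (absz (n + (wbound M)%:Z)); split; lia.
exact: hin.
Qed.

(** By independence of characters, a vector on which T(k) acts by c |-> c^n has no other weight
    component. All later weight computations pass through this criterion. *)
Lemma wt_projE M n m (v : 'M[k]_(mdim M, m)) :
  (forall c, c != 0 -> rho M c *m v = c ^ n *: v) -> forall i, wproj M i *m v = (i == n)%:R *: v.
Proof.
move=> h i.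
(* E is so large that n, i and all weights of M lie in [-E, E], which gives one common range for the
   comparison of coefficients. *)
have [E [hE1 hE2 hE3]] : exists E : nat, [/\ (wbound M <= E)%N, (absz n <= E)%N & (absz i <= E)%N].
  by exists (wbound M + absz n + absz i)%N; split; lia.
have hin j : (j < E.*2.+1)%N ->
   wproj M (j%:Z - E%:Z) *m v - (j%:Z - E%:Z == n)%:R *: v = 0.
  move: j; apply: (@laurent_indep _ _ _ E) => c hc.
  under eq_bigr do rewrite scalerBr.
  rewrite sumrB; apply/eqP; rewrite subr_eq0; apply/eqP.
  transitivity (rho M c *m v).
    rewrite /rho mulmx_suml.
    rewrite [RHS](eq_bigr (fun m : 'I_(wK M) => c ^ wt M m *: (wproj M (wt M m) *m v))); last first.
      by move=> l _; rewrite scalemxAl.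
    rewrite -(big_mkord xpredT (fun m => c ^ wt M m *: (wproj M (wt M m) *m v))).
    rewrite -(big_mkord xpredT (fun j => c ^ (j%:Z - E%:Z) *: (wproj M (j%:Z - E%:Z) *m v))).
    rewrite (@big_cat_nat _ _ _ (E - wbound M)) /=; [|lia|lia].
    rewrite big_nat_cond big1 ?add0r; last first.
      by move=> j hj; rewrite wproj_out ?mul0mx ?scaler0 //; lia.
    rewrite (@big_cat_nat _ _ _ (E + wbound M).+1) /=; [|lia|lia].
    rewrite [X in _ + X]big_nat_cond [X in _ + X]big1 ?addr0; last first.
      by move=> j hj; rewrite wproj_out ?mul0mx ?scaler0 //; lia.
    rewrite -{1}[(E - wbound M)%N]add0n big_addn.
    have -> : ((E + wbound M).+1 - (E - wbound M) = wK M)%N by lia.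
    apply: eq_bigr => j _.
    by have -> : (j + (E - wbound M))%N%:Z - E%:Z = wt M j by lia.
  rewrite h //.
  have hj : (absz (n + E%:Z)%R < E.*2.+1)%N by lia.
  rewrite (bigD1 (Ordinal hj)) //= [X in _ + X]big1; last first.
    move=> j; rewrite -val_eqE /= => hne.
    by rewrite [_ == n](_ : _ = false) ?scale0r ?scaler0 //; apply/eqP; lia.
  have -> : (absz (n + E%:Z))%:Z - E%:Z = n by lia.
  by rewrite eqxx scale1r addr0.
have hj : (absz (i + E%:Z)%R < E.*2.+1)%N by lia.
have := hin _ hj; have -> : (absz (i + E%:Z))%:Z - E%:Z = i by lia.
by move/eqP; rewrite subr_eq0 => /eqP.
Qed.
End Operators.

(** Names for the operators that determine a module. Homomorphisms and submodules are those
    compatible with all of them ([op_is_hom], [opstable_act]), which replaces the functor by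
    finitely many matrices over k. *)
Variant opidx := OE of nat | OF of nat | OW of int.

Section Operators2.
Variables (k : closedFieldType) (p : nat) (charp : p \in [pchar k]).
Local Notation N := (p ^ 2)%N.
Local Notation mod := (G2Tmod charp).
Let N0 : (0 < N)%N := N_gt0 charp.
Local Notation R2 := (trunc2 charp).
Local Notation X := (trX (trunc2 charp)).
Local Notation Y := (trY (trunc2 charp)).
Local Notation coef2 := (tr_coef (trunc2 charp)).
Local Notation kk := (k^o : comAlgType k).
Local Notation wt M i := (i%:Z - (wbound M)%:Z).
Local Notation wK M := ((wbound M).*2.+1).
Implicit Types M L : mod.

Definition op M (o : opidx) : 'M[k]_(mdim M) :=
  match o with OE r => opE M r | OF r => opF M r | OW n => wproj M n end.

Lemma wprojM M i n : wproj M i *m wproj M n = (i == n)%:R *: wproj M n.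
Proof. by apply: wt_projE => c hc; rewrite rho_wproj. Qed.

Lemma rho_wt M n m (v : 'M[k]_(mdim M, m)) c : c != 0 ->
  wproj M n *m v = v -> rho M c *m v = c ^ n *: v.
Proof. by move=> hc <-; rewrite mulmxA rho_wproj // scalemxAl. Qed.

Lemma act_tor_wt M (A : comAlgType k) (a b : A) (hab : a * b = 1) n m
  (v : 'M[k]_(mdim M, m)) : wproj M n *m v = v ->
  act M (tor charp hab) *m v%:sc[A] = tch n a b *: v%:sc[A].
Proof.
move=> hv; rewrite act_tor mulmx_suml.
rewrite (eq_bigr (fun i : 'I_(wK M) => tch (wt M i) a b *: ((wt M i == n)%:R *: v)%:sc[A])); last first.
  by move=> i _; rewrite mul_scale_sc1 -{1}hv mulmxA wprojM -scalemxAl hv.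
case: (boolP ((n < - (wbound M)%:Z) || ((wbound M)%:Z < n))) => h.
  have -> : v = 0 by rewrite -hv wproj_out // mul0mx.
  by rewrite map_mx0 scaler0 big1 // => i _; rewrite scaler0 map_mx0 scaler0.
have hj : (absz (n + (wbound M)%:Z)%R < wK M)%N by lia.
rewrite (bigD1 (Ordinal hj)) //= big1; last first.
  move=> j; rewrite -val_eqE /= => hne.
  by rewrite [_ == n](_ : _ = false) ?scale0r ?map_mx0 ?scaler0 //;
     apply/eqP; lia.
have -> : (absz (n + (wbound M)%:Z))%:Z - (wbound M)%:Z = n by lia.
by rewrite eqxx scale1r addr0.
Qed.

Lemma big_cell_ind (Q : forall A : comAlgType k, G2T p A -> Prop) :
  (forall A g h, Q A g -> Q A h -> Q A (G2T_mul charp g h)) ->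
  (forall (A : comAlgType k) (a : A) (ha : a ^+ N = 0), Q A (up charp ha)) ->
  (forall (A : comAlgType k) (a : A) (ha : a ^+ N = 0), Q A (lo charp ha)) ->
  (forall (A : comAlgType k) (a b : A) (hab : a * b = 1), Q A (tor charp hab)) ->
  forall A g, Q A g.
Proof.
move=> hM hu hl ht A g.
have [c [t [t' [b [hc [htt [hb ->]]]]]]] := big_cell charp g.
by apply: (hM); [|apply: (hM)].
Qed.

(** Used with e = 0 for homomorphisms and with e = 2r, -2r for E_r and F_r. *)
Lemma tor_intertwine M L (f : 'M[k]_(mdim L, mdim M)) e :
  (forall c, c != 0 -> rho L c *m f = c ^ e *: (f *m rho M c)) ->
  forall n, wproj L (n + e) *m f = f *m wproj M n.
Proof.
move=> h n.
have key m i : wproj L i *m (f *m wproj M m) = (i == m + e)%:R *: (f *m wproj M m).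
  apply: wt_projE => c hc; rewrite mulmxA h // -scalemxAl -mulmxA rho_wproj //.
  by rewrite -scalemxAr scalerA -expfzDr // addrC.
rewrite -{1}[f]mulmx1 -(wproj_sum M) !mulmx_sumr.
transitivity (\sum_(i < wK M) wproj L (n + e) *m (f *m wproj M n *m wproj M (wt M i))).
  apply: eq_bigr => i _; rewrite key -!mulmxA wprojM -scalemxAr -scalemxAr key.
  case: (eqVneq n (wt M i)) => [->|hn]; first by rewrite eqxx !scale1r.
  rewrite scale0r (_ : _ == _ = false) ?scale0r //.
  by apply/eqP => /addIr e'; rewrite e' eqxx in hn.
by rewrite -!mulmx_sumr wproj_sum mulmx1 key eqxx scale1r.
Qed.

Lemma is_hom_op M L (f : 'M[k]_(mdim L, mdim M)) :
  is_hom f -> forall o, op L o *m f = f *m op M o.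
Proof.
move=> h [r|r|n] /=.
- by rewrite /opE -coefmx_mulr h coefmx_mull.
- by rewrite /opF -coefmx_mulr h coefmx_mull.
have := @tor_intertwine M L f 0 _ n; rewrite addr0 => -> // c hc.
rewrite expr0z scale1r; have := h kk (tor charp (unitVr hc)).
by rewrite sc_id !act_rho.
Qed.

Lemma op_is_hom M L (f : 'M[k]_(mdim L, mdim M)) :
  (forall o, op L o *m f = f *m op M o) -> is_hom f.
Proof.
move=> h; apply: big_cell_ind => [A g g' hg hg'|A a ha|A a ha|A a b hab].
- by rewrite !actM -mulmxA hg' mulmxA hg mulmxA.
- rewrite !act_up mulmx_suml mulmx_sumr; apply: eq_bigr => r _.
  by rewrite mul_scale_sc1 (h (OE r)) map_mxM scalemxAr.
- rewrite !act_lo mulmx_suml mulmx_sumr; apply: eq_bigr => r _.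
  by rewrite mul_scale_sc1 (h (OF r)) map_mxM scalemxAr.
- rewrite (act_tor M) mulmx_sumr.
  rewrite -{1}[f]mulmx1 -(wproj_sum M) mulmx_sumr raddf_sum mulmx_sumr.
  apply: eq_bigr => i _ /=.
  rewrite (act_tor_wt hab (n := wt M i)); first by rewrite -scalemxAr map_mxM.
  by rewrite -(h (OW _)) /= mulmxA wprojM eqxx scale1r.
Qed.

Lemma opstable_act M d (B : 'M[k]_(mdim M, d)) :
  (forall o, exists Z, op M o *m B = B *m Z) ->
  forall A (g : G2T p A), exists Z, act M g *m B%:sc[A] = B%:sc[A] *m Z.
Proof.
move=> h.
have sum (A : comAlgType k) I (r : seq I) (a : I -> A) (o : I -> opidx) :
   exists Z, (\sum_(i <- r) a i *: (op M (o i))%:sc[A]) *m B%:sc[A] = B%:sc[A] *m Z.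
  elim: r => [|i r [Z IH]]; first by exists 0; rewrite big_nil mul0mx mulmx0.
  have [W hW] := h (o i); exists (a i *: W%:sc[A] + Z).
  by rewrite big_cons mulmxDl IH mul_scale_sc1 hW map_mxM scalemxAr mulmxDr.
apply: big_cell_ind => [A g g' [Z hg] [Z' hg']|A a ha|A a ha|A a b hab].
- by exists (Z *m Z'); rewrite actM -mulmxA hg' [LHS]mulmxA hg [RHS]mulmxA.
- by rewrite act_up; apply: (sum A _ _ _ (fun r : 'I_N => OE r)).
- by rewrite act_lo; apply: (sum A _ _ _ (fun r : 'I_N => OF r)).
- by rewrite act_tor; apply: (sum A _ _ _ (fun r : 'I_(wK M) => OW (wt M r))).
Qed.

Lemma tch_alg (A : comAlgType k) (c : k) n : tch n (c%:A : A) (c^-1)%:A = (c ^ n)%:A.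
Proof.
by case: n => n; rewrite ?NegzE /= -[_%:A]/(in_alg A _) -rmorphXn //= exprVn.
Qed.

Lemma alg_inv (A : comAlgType k) (c : k) : c != 0 -> c%:A * (c^-1)%:A = 1 :> A.
Proof. by move=> hc; rewrite mulr_algl scalerA divff // scale1r. Qed.

Lemma act_rho_alg M (A : comAlgType k) (c : k) (hc : c != 0) :
  act M (tor charp (alg_inv A hc)) = (rho M c)%:sc[A].
Proof.
rewrite act_tor /rho raddf_sum; apply: eq_bigr => i _.
by rewrite tch_alg /= sc_scale.
Qed.

(** * Relations in SL_2 and the commutation rules they give *)

Section GroupRelations.
Variable A : comAlgType k.
Implicit Types a b u v e : A.

Lemma tor_up a b (hab : a * b = 1) u v (hu : u ^+ N = 0) (hv : v ^+ N = 0) :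
  v * b = a * u ->
  G2T_mul charp (tor charp hab) (up charp hu) = G2T_mul charp (up charp hv) (tor charp hab).
Proof.
move=> e; apply: G2T_ext; rewrite /= !mx2M; apply: mx2P;
by rewrite ?mulr0 ?mul0r ?mulr1 ?mul1r ?addr0 ?add0r.
Qed.

Lemma tor_lo a b (hab : a * b = 1) u v (hu : u ^+ N = 0) (hv : v ^+ N = 0) :
  v * a = b * u ->
  G2T_mul charp (tor charp hab) (lo charp hu) = G2T_mul charp (lo charp hv) (tor charp hab).
Proof.
move=> e; apply: G2T_ext; rewrite /= !mx2M; apply: mx2P;
by rewrite ?mulr0 ?mul0r ?mulr1 ?mul1r ?addr0 ?add0r.
Qed.

Lemma up_up u v (hu : u ^+ N = 0) (hv : v ^+ N = 0) (huv : (u + v) ^+ N = 0) :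
  G2T_mul charp (up charp hu) (up charp hv) = up charp huv.
Proof.
apply: G2T_ext; rewrite /= !mx2M; apply: mx2P;
by rewrite ?mulr0 ?mul0r ?mulr1 ?mul1r ?addr0 ?add0r // addrC.
Qed.

Lemma lo_lo u v (hu : u ^+ N = 0) (hv : v ^+ N = 0) (huv : (u + v) ^+ N = 0) :
  G2T_mul charp (lo charp hu) (lo charp hv) = lo charp huv.
Proof.
apply: G2T_ext; rewrite /= !mx2M; apply: mx2P;
by rewrite ?mulr0 ?mul0r ?mulr1 ?mul1r ?addr0 ?add0r.
Qed.

(** Here e is the inverse of 1 + u v; this is the factorisation of a product in the wrong order,
    from which [kostant] is read off. *)
Lemma up_lo u v e (hu : u ^+ N = 0) (hv : v ^+ N = 0) (he : (1 + u * v) * e = 1)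
  (hve : (v * e) ^+ N = 0) (hue : (u * e) ^+ N = 0) :
  G2T_mul charp (up charp hu) (lo charp hv) =
  G2T_mul charp (lo charp hve) (G2T_mul charp (tor charp he) (up charp hue)).
Proof.
apply: G2T_ext; rewrite /= !mx2M; apply: mx2P;
  rewrite ?mulr0 ?mul0r ?mulr1 ?mul1r ?addr0 ?add0r //.
- by rewrite mulrCA he mulr1.
- by rewrite -mulrA [e * _]mulrC he mulr1.
- have -> : v * e * ((1 + u * v) * (u * e)) = u * v * e * ((1 + u * v) * e) by ring.
  by rewrite he mulr1 -[X in _ + X]mul1r -mulrDl [u * v + 1]addrC he.
Qed.

Lemma alg_conj (c : k) u : c != 0 -> (c ^+ 2)%:A * u * (c^-1)%:A = c%:A * u.
Proof. by move=> hc; rewrite mulr_algr !mulr_algl scalerA expr2 mulKf. Qed.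

Lemma alg_conjV (c : k) u : c != 0 -> (c ^- 2)%:A * u * c%:A = (c^-1)%:A * u.
Proof.
by move=> hc; rewrite mulr_algr !mulr_algl scalerA expr2 invfM mulrA divff // mul1r.
Qed.

Lemma tor_up_alg (c : k) (hc : c != 0) u (hu : u ^+ N = 0)
  (hv : ((c ^+ 2)%:A * u) ^+ N = 0) :
  G2T_mul charp (tor charp (alg_inv A hc)) (up charp hu) =
  G2T_mul charp (up charp hv) (tor charp (alg_inv A hc)).
Proof. by apply: tor_up; rewrite alg_conj. Qed.

Lemma tor_lo_alg (c : k) (hc : c != 0) u (hu : u ^+ N = 0)
  (hv : ((c ^- 2)%:A * u) ^+ N = 0) :
  G2T_mul charp (tor charp (alg_inv A hc)) (lo charp hu) =
  G2T_mul charp (lo charp hv) (tor charp (alg_inv A hc)).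
Proof. by apply: tor_lo; rewrite alg_conjV. Qed.
End GroupRelations.

Lemma coef2Z r s c (x : R2) : coef2 r s (c *: x) = c * coef2 r s x.
Proof. by rewrite linearZ. Qed.

(** The coefficient of X^r in t up(X) = up(c^2 X) t, where t = diag(c, c^-1). *)
Lemma opE_wt M r n : wproj M (n + (r.*2)%:Z) *m opE M r = opE M r *m wproj M n.
Proof.
apply: tor_intertwine => c hc.
case: (ltnP r N) => hr; last by rewrite opE_ge // mulmx0 mul0mx scaler0.
have hh : ((c ^+ 2)%:A * X) ^+ N = 0 by rewrite exprMn trXN mulr0.
have := congr1 (@act _ _ _ M _) (tor_up_alg hc (trXN (trunc2 charp)) hh).
rewrite !actM act_rho_alg => /(congr1 (map_mx (coef2 r 0))).
rewrite coefmx_mull coefmx_mulr => ->; rewrite act_up coefmx_sum scalemxAl; congr (_ *m _).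
rewrite (bigD1 (Ordinal hr)) //= big1 ?addr0.
  rewrite exprMn -[_%:A]/(in_alg _ _) -rmorphXn /= mulr_algl coefmxZ coef2Z.
  have := tr_mono (trunc2 charp) r 0 hr N0; rewrite expr0 mulr1 => ->.
  by rewrite !eqxx mulr1 -exprM -mul2n.
move=> i; rewrite -val_eqE /= => hi.
rewrite exprMn -[_%:A]/(in_alg _ _) -rmorphXn /= mulr_algl coefmxZ coef2Z.
have := tr_mono (trunc2 charp) i 0 hr N0; rewrite expr0 mulr1 => ->.
by rewrite [_ == _](negbTE _) ?mulr0 ?scale0r // eq_sym.
Qed.

Lemma opF_wt M r n : wproj M (n - (r.*2)%:Z) *m opF M r = opF M r *m wproj M n.
Proof.
apply: tor_intertwine => c hc.
case: (ltnP r N) => hr; last by rewrite opF_ge // mulmx0 mul0mx scaler0.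
have hh : ((c ^- 2)%:A * X) ^+ N = 0 by rewrite exprMn trXN mulr0.
have := congr1 (@act _ _ _ M _) (tor_lo_alg hc (trXN (trunc2 charp)) hh).
rewrite !actM act_rho_alg => /(congr1 (map_mx (coef2 r 0))).
rewrite coefmx_mull coefmx_mulr => ->; rewrite act_lo coefmx_sum scalemxAl; congr (_ *m _).
rewrite (bigD1 (Ordinal hr)) //= big1 ?addr0.
  rewrite exprMn -[_%:A]/(in_alg _ _) -rmorphXn /= mulr_algl coefmxZ coef2Z.
  have := tr_mono (trunc2 charp) r 0 hr N0; rewrite expr0 mulr1 => ->.
  by rewrite !eqxx mulr1 -exprVn -exprM -mul2n -exprnN exprVn.
move=> i; rewrite -val_eqE /= => hi.
rewrite exprMn -[_%:A]/(in_alg _ _) -rmorphXn /= mulr_algl coefmxZ coef2Z.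
have := tr_mono (trunc2 charp) i 0 hr N0; rewrite expr0 mulr1 => ->.
by rewrite [_ == _](negbTE _) ?mulr0 ?scale0r // eq_sym.
Qed.

(** The coefficient of X^r Y^s in D(X) D(Y) = D(X + Y). *)
Lemma divided_powers n (D : nat -> 'M[k]_n) : (forall r, (N <= r)%N -> D r = 0) ->
  (\sum_(r < N) X ^+ r *: (D r)%:sc[R2]) *m (\sum_(r < N) Y ^+ r *: (D r)%:sc[R2]) =
  \sum_(r < N) (X + Y) ^+ r *: (D r)%:sc[R2] ->
  forall r s, D r *m D s = ('C(r + s, r))%:R *: D (r + s)%N.
Proof.
move=> D0 hD r s.
case: (ltnP r N) => hr; last first.
  by rewrite (D0 r hr) mul0mx D0 ?scaler0 // (leq_trans hr (leq_addr _ _)).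
case: (ltnP s N) => hs; last first.
  by rewrite (D0 s hs) mulmx0 D0 ?scaler0 // (leq_trans hs (leq_addl _ _)).
move: hD => /(congr1 (map_mx (coef2 r s))).
rewrite mulmx_suml !coefmx_sum (bigD1 (Ordinal hr)) //= [X in _ + X]big1 ?addr0; last first.
  move=> i; rewrite -val_eqE /= => hi; rewrite mulmx_sumr coefmx_sum big1 // => j _.
  by rewrite mul_scale_sc coefmxZ tr_mono // eq_sym (negbTE hi) scale0r.
rewrite mulmx_sumr coefmx_sum (bigD1 (Ordinal hs)) //= big1 ?addr0; last first.
  move=> j; rewrite -val_eqE /= => hj.
  by rewrite mul_scale_sc coefmxZ tr_mono // [s == _]eq_sym (negbTE hj) andbF scale0r.
rewrite mul_scale_sc coefmxZ tr_mono // !eqxx /= (scale1r (D r *m D s)) => ->.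
have key t : coef2 r s ((X + Y) ^+ t) = (t == (r + s)%N)%:R * 'C(t, s)%:R.
  rewrite exprDn raddf_sum.
  transitivity (\sum_(i < t.+1) (if (r == t - i)%N && (s == i) then 'C(t, i)%:R else 0) : k).
    apply: eq_bigr => i _; rewrite raddfMn /= tr_mono //.
    by case: ((r == _) && _); rewrite ?mul0rn.
  rewrite -big_mkcond /=.
  case: (eqVneq t (r + s)%N) => [->|ht].
    rewrite mul1r.
    have hs1 : (s < (r + s).+1)%N by rewrite ltnS leq_addl.
    rewrite (big_pred1 (Ordinal hs1)) // => i /=; have := ltn_ord i => hi.
    apply/andP/eqP => [[/eqP h1 /eqP h2]|->]; first by apply/val_inj.
    by rewrite /= eqxx addnK.
  rewrite mul0r big_pred0 // => i; have := ltn_ord i => hi.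
  by apply/negP => /andP[/eqP h1 /eqP h2]; move/eqP: ht; lia.
under eq_bigr => t _ do rewrite coefmxZ key.
case: (ltnP (r + s) N) => hrs; last first.
  rewrite D0 // scaler0 big1 // => t _; have := ltn_ord t.
  by case: eqVneq => [->|]; [rewrite ltnNge hrs|rewrite mul0r scale0r].
rewrite (bigD1 (Ordinal hrs)) //= eqxx mul1r big1 ?addr0.
  by rewrite -[in RHS]bin_sub ?leq_addr // addKn.
by move=> i; rewrite -val_eqE /= => hi; rewrite (negbTE hi) mul0r scale0r.
Qed.

Lemma XYN : (X + Y) ^+ N = 0.
Proof. by rewrite (pfrobD charp) trXN trYN addr0. Qed.

Lemma opEM M r s : opE M r *m opE M s = ('C(r + s, r))%:R *: opE M (r + s).
Proof.
apply: divided_powers; first exact: opE_ge.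
have := congr1 (@act _ _ _ M _) (up_up (trXN (trunc2 charp)) (trYN (trunc2 charp)) XYN).
by rewrite actM !act_up.
Qed.

Lemma opFM M r s : opF M r *m opF M s = ('C(r + s, r))%:R *: opF M (r + s).
Proof.
apply: divided_powers; first exact: opF_ge.
have := congr1 (@act _ _ _ M _) (lo_lo (trXN (trunc2 charp)) (trYN (trunc2 charp)) XYN).
by rewrite actM !act_lo.
Qed.

Lemma kostant_act M (A : comAlgType k) (a b e : A) (ha : a ^+ N = 0) (hb : b ^+ N = 0)
  (he : (1 + a * b) * e = 1) m (v : 'M[k]_(mdim M, m)) n : wproj M n *m v = v ->
  act M (up charp ha) *m (act M (lo charp hb) *m v%:sc[A]) =
  \sum_(s < N) \sum_(i < N) (a ^+ i * b ^+ s * (1 + a * b) ^+ zres N (n + i%:Z - s%:Z)) *: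
     (opF M s *m (opE M i *m v))%:sc[A].
Proof.
move=> hv.
have hbe : (b * e) ^+ N = 0 by rewrite exprMn hb mul0r.
have hae : (a * e) ^+ N = 0 by rewrite exprMn ha mul0r.
have uN : (1 + a * b) ^+ N = 1.
  by rewrite (pfrobD charp) expr1n exprMn ha mul0r addr0.
rewrite mulmxA -actM (up_lo ha hb he hbe hae) !actM -!mulmxA.
rewrite act_lo mulmx_suml; apply: eq_bigr => s _.
rewrite act_up mulmx_suml !mulmx_sumr; apply: eq_bigr => i _.
rewrite mul_scale_sc1 -[act _ _ *m (_ *: _)]scalemxAr (act_tor_wt he (n := n + (i.*2)%:Z)).
  rewrite scalerA mul_scale_sc; congr (_ *: _).
  have <- : tch (n + (i.*2)%:Z) (1 + a * b) e * e ^+ (i + s) =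
      (1 + a * b) ^+ zres N (n + i%:Z - s%:Z).
    rewrite tch_sub // (tch_zres _ N0 he uN); congr (_ ^+ zres N _).
    by rewrite -addnn !PoszD; ring.
  by rewrite !exprMn exprD; ring.
by rewrite mulmxA opE_wt -mulmxA hv.
Qed.

(** Kostant's formula: E_r F_t is the sum of the F_{t-j} binom(H - r - t + 2j, j) E_{r-j}. Since
    E_{r-j} v has weight n + 2(r - j), the toral factor acts on it as binom(n + r - t, j). It is the
    coefficient of X^r Y^t in [kostant_act]. *)
Lemma kostant M r t n m (v : 'M[k]_(mdim M, m)) : (r < N)%N -> (t < N)%N ->
  wproj M n *m v = v ->
  opE M r *m (opF M t *m v) =
  \sum_(j < N | (j <= r)%N && (j <= t)%N)
     ('C(zres N (n + r%:Z - t%:Z), j))%:R *: (opF M (t - j) *m (opE M (r - j) *m v)).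
Proof.
move=> hr ht hv.
have hxy : (X * Y) ^+ N = 0 by rewrite exprMn trXN mul0r.
have [e he] := unip_inv hxy.
have := kostant_act (trXN (trunc2 charp)) (trYN (trunc2 charp)) he hv.
rewrite act_up act_lo => /(congr1 (map_mx (coef2 r t))).
rewrite mulmx_suml coefmx_sum (bigD1 (Ordinal hr)) //= [X in _ + X]big1 ?addr0; last first.
  move=> i; rewrite -val_eqE /= => hi; rewrite mulmx_suml mulmx_sumr coefmx_sum big1 // => j _.
  by rewrite mul_scale_sc1 mul_scale_sc coefmxZ tr_mono // eq_sym (negbTE hi) scale0r.
rewrite mulmx_suml mulmx_sumr coefmx_sum (bigD1 (Ordinal ht)) //= [X in _ + X]big1 ?addr0; last first.
  move=> j; rewrite -val_eqE /= => hj.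
  by rewrite mul_scale_sc1 mul_scale_sc coefmxZ tr_mono // [t == _]eq_sym (negbTE hj) andbF scale0r.
rewrite mul_scale_sc1 mul_scale_sc coefmxZ tr_mono // !eqxx /=.
rewrite (scale1r (opE M r *m (opF M t *m v))) => ->.
(* A term X^i Y^s (X Y)^j contributes to X^r Y^t only if j = r - i = t - s. *)
have key (s i : nat) z : coef2 r t (X ^+ i * Y ^+ s * (1 + X * Y) ^+ z) =
   ((i <= r)%N && (r - i == t - s)%N && (s <= t)%N)%:R * 'C(z, r - i)%:R.
  rewrite exprDn mulr_sumr raddf_sum.
  transitivity (\sum_(j < z.+1) (if (r == i + j)%N && (t == s + j)%N then 'C(z, j)%:R else 0) : k).
    apply: eq_bigr => j _; rewrite expr1n mul1r exprMn mulrnAr mulrACA -!exprD raddfMn /= tr_mono //.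
    by case: ((r == _) && _); rewrite ?mul0rn.
  rewrite -big_mkcond /=.
  case: (boolP ((i <= r)%N && (r - i == t - s)%N && (s <= t)%N)) => [/andP[/andP[h1 /eqP h2] h3]|hn].
    rewrite mul1r; case: (ltnP (r - i) z.+1) => hz.
      rewrite (big_pred1 (Ordinal hz)) // => j /=.
      apply/andP/eqP => [[/eqP e1 /eqP e2]|->]; last by rewrite /=; split; apply/eqP; lia.
      by apply/val_inj => /=; lia.
    rewrite bin_small // big_pred0 // => j; have := ltn_ord j => hj.
    by apply/negP => /andP[/eqP e1 /eqP e2]; lia.
  rewrite mul0r big_pred0 // => j.
  by apply/negP => /andP[/eqP e1 /eqP e2]; move/negP: hn; apply; lia.
rewrite coefmx_sum.
transitivity (\sum_(s < N) \sum_(j < N | (j <= r)%N && (j <= t)%N && (s == t - j :> nat)%N)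
   ('C(zres N (n + r%:Z - t%:Z), j))%:R *: (opF M (t - j) *m (opE M (r - j) *m v))).
  apply: eq_bigr => s _; rewrite coefmx_sum.
  under eq_bigr => i _ do rewrite coefmxZ key.
  case: (leqP s t) => hst; last first.
    rewrite big1; last by move=> i _; rewrite andbF mul0r scale0r.
    by rewrite big_pred0 // => j; apply/negP => /andP[_ /eqP h]; lia.
  case: (leqP (t - s) r) => hts; last first.
    rewrite big1; last first.
      move=> i _; rewrite andbT (_ : _ && _ = false) ?mul0r ?scale0r //.
      by apply/negP => /andP[h1 /eqP h2]; lia.
    by rewrite big_pred0 // => j; apply/negP => /andP[/andP[h1 h2] /eqP h3]; lia.
  have hj : (t - s < N)%N by lia.
  have hi : (r - (t - s) < N)%N by lia.
  rewrite (bigD1 (Ordinal hi)) //= big1 ?addr0; last first.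
    move=> i; rewrite -val_eqE /= => hne; rewrite andbT (_ : _ && _ = false) ?mul0r ?scale0r //.
    by apply/negP => /andP[h1 /eqP h2]; move/eqP: hne; lia.
  rewrite (big_pred1 (Ordinal hj)); last first.
    move=> j /=; apply/andP/eqP => [[/andP[h1 h2] /eqP h3]|->].
      by apply/val_inj => /=; lia.
    by rewrite /=; split; [apply/andP; split; lia | apply/eqP; lia].
  rewrite /= andbT (_ : (_ && _) = true); last by apply/andP; split; [lia|apply/eqP; lia].
  rewrite mul1r; have -> : (r - (r - (t - s)) = t - s)%N by lia.
  have -> : (t - (t - s) = s)%N by lia.
  by have -> : n + (r - (t - s))%N%:Z - s%:Z = n + r%:Z - t%:Z by lia.
rewrite (exchange_big_dep (fun j : 'I_N => (j <= r)%N && (j <= t)%N)) /=; last first.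
  by move=> s j _ /andP[].
apply: eq_bigr => j /andP[h1 h2].
have hs : (t - j < N)%N by lia.
rewrite (big_pred1 (Ordinal hs)) // => s /=.
by rewrite h1 h2 /=.
Qed.
End Operators2.

(** * Homomorphisms, duality and direct sums *)

(** The effect of tau on operators: passing to the tau-dual transposes and exchanges E_r with
    F_r. *)
Definition oswap o := match o with OE r => OF r | OF r => OE r | OW n => OW n end.
Lemma oswapK o : oswap (oswap o) = o. Proof. by case: o. Qed.

Section Modules.
Variables (k : closedFieldType) (p : nat) (charp : p \in [pchar k]).
Local Notation mod := (G2Tmod charp).
Local Notation wt M i := (i%:Z - (wbound M)%:Z).
Local Notation wK M := ((wbound M).*2.+1).
Implicit Types M L Q : mod.

Lemma hom_op M L (f : 'M[k]_(mdim L, mdim M)) :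
  is_hom f <-> forall o, op L o *m f = f *m op M o.
Proof. by split; [exact: is_hom_op|exact: op_is_hom]. Qed.

Lemma hom_id M : @is_hom _ _ charp M M 1%:M.
Proof. by apply/hom_op => o; rewrite mulmx1 mul1mx. Qed.

Lemma hom_comp M L Q (f : 'M[k]_(mdim L, mdim M)) (g : 'M[k]_(mdim Q, mdim L)) :
  is_hom f -> is_hom g -> @is_hom _ _ charp M Q (g *m f).
Proof. by move=> /hom_op hf /hom_op hg; apply/hom_op => o; rewrite mulmxA hg -!mulmxA hf. Qed.

Lemma hom_lin M L (c : k) (f g : 'M[k]_(mdim L, mdim M)) :
  is_hom f -> is_hom g -> @is_hom _ _ charp M L (c *: f + g).
Proof.
move=> /hom_op hf /hom_op hg; apply/hom_op => o.
by rewrite mulmxDr mulmxDl -scalemxAr -scalemxAl hf hg.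
Qed.

Lemma hom_0 M L : @is_hom _ _ charp M L 0.
Proof. by apply/hom_op => o; rewrite mulmx0 mul0mx. Qed.

Lemma hom_add M L (f g : 'M[k]_(mdim L, mdim M)) :
  is_hom f -> is_hom g -> @is_hom _ _ charp M L (f + g).
Proof. by move=> hf hg; rewrite -[f]scale1r; apply: hom_lin. Qed.

Lemma hom_scale M L (c : k) (f : 'M[k]_(mdim L, mdim M)) :
  is_hom f -> @is_hom _ _ charp M L (c *: f).
Proof. by move=> hf; rewrite -[_ *: _]addr0; apply: hom_lin => //; apply: hom_0. Qed.

Lemma hom_sub M L (f g : 'M[k]_(mdim L, mdim M)) :
  is_hom f -> is_hom g -> @is_hom _ _ charp M L (f - g).
Proof. by move=> hf hg; rewrite addrC -scaleN1r; apply: hom_lin. Qed.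

Lemma is_iso_sym M L (f : 'M[k]_(mdim L, mdim M)) : @is_iso _ _ charp M L f ->
  exists g, [/\ @is_iso _ _ charp L M g, g *m f = 1%:M & f *m g = 1%:M].
Proof. by case=> hf [g [hg h1 h2]]; exists g; split=> //; split=> //; exists f. Qed.

Lemma isomorphic_sym M L : isomorphic M L -> isomorphic L M.
Proof. by case=> f /is_iso_sym[g [hg _ _]]; exists g. Qed.

Lemma isomorphic_dim M L : isomorphic M L -> mdim M = mdim L.
Proof.
case=> f [_ [g [_ h1 h2]]]; apply/eqP.
by rewrite eqn_leq (mulmx1_min h1) (mulmx1_min h2).
Qed.

Lemma hom_invertible M (f : 'M[k]_(mdim M)) : @is_hom _ _ charp M M f ->
  f \in unitmx -> @is_hom _ _ charp M M (invmx f).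
Proof.
move=> /hom_op hf fu; apply/hom_op => o.
by rewrite -[LHS](mulKmx fu) [f *m (_ *m _)]mulmxA -hf mulmxK.
Qed.

Section Tau.
Variable M : mod.

Lemma opE_tau r : opE (tau_dual M) r = (opF M r)^T.
Proof. by rewrite /opE /opF /= G2T_tr_up map_trmx. Qed.
Lemma opF_tau r : opF (tau_dual M) r = (opE M r)^T.
Proof. by rewrite /opE /opF /= G2T_tr_lo map_trmx. Qed.

Lemma rho_tau c : c != 0 -> rho (tau_dual M) c = (rho M c)^T.
Proof. by move=> hc; rewrite -!(act_rho _ hc) /= G2T_tr_tor. Qed.

Lemma wproj_tau n : wproj (tau_dual M) n = (wproj M n)^T.
Proof.
have h i m : wproj (tau_dual M) i *m (wproj M m)^T = (i == m)%:R *: (wproj M m)^T.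
  apply: (@wt_projE _ _ _ (tau_dual M)) => c hc; rewrite rho_tau // -trmx_mul.
  rewrite (_ : _ *m _ = c ^ m *: wproj M m) ?linearZ //.
  rewrite mulmx_sumr -(rho_wproj M m hc) /rho mulmx_suml; apply: eq_bigr => i' _.
  rewrite -scalemxAr -scalemxAl !wprojM eq_sym.
  by case: eqP => [->|]; rewrite ?scale0r ?scaler0.
rewrite -[LHS]mulmx1 -trmx1 -(wproj_sum M) (raddf_sum (@trmx _ _ _)) mulmx_sumr.
transitivity (\sum_(i < wK M) (wproj M (wt M i) *m wproj M n)^T).
  apply: eq_bigr => i _; rewrite h wprojM eq_sym linearZ /=.
  by case: eqP => [->|]; rewrite ?scale0r.
by rewrite -raddf_sum -mulmx_suml wproj_sum mul1mx.
Qed.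

Lemma op_tau o : op (tau_dual M) o = (op M (oswap o))^T.
Proof. by case: o => x /=; rewrite ?opE_tau ?opF_tau ?wproj_tau. Qed.
End Tau.

Lemma hom_tr M L (f : 'M[k]_(mdim L, mdim M)) : is_hom f ->
  @is_hom _ _ charp (tau_dual L) (tau_dual M) f^T.
Proof.
by move=> /hom_op h; apply/hom_op => o; rewrite !op_tau -!trmx_mul h.
Qed.

Lemma hom_tr_l M L (f : 'M[k]_(mdim L, mdim M)) : @is_hom _ _ charp M (tau_dual L) f ->
  @is_hom _ _ charp L (tau_dual M) f^T.
Proof.
move=> /hom_op h; apply/hom_op => o.
by rewrite op_tau -trmx_mul -h op_tau trmx_mul oswapK trmxK.
Qed.

(** Injectivity of i is expressed by a linear left inverse C, which need not be a homomorphism. *)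
Definition injectiveM Q : Prop :=
  forall M L (i : 'M[k]_(mdim L, mdim M)) (C : 'M[k]_(mdim M, mdim L))
    (f : 'M[k]_(mdim Q, mdim M)), is_hom i -> C *m i = 1%:M -> is_hom f ->
  exists h : 'M[k]_(mdim Q, mdim L), is_hom h /\ h *m i = f.

Lemma projective_tau_injective Q : projective Q -> injectiveM (tau_dual Q).
Proof.
move=> hQ M L i C f hi hC hf.
have [|h [h1 h2]] := hQ (tau_dual L) (tau_dual M) i^T f^T (hom_tr hi) _ (hom_tr_l hf).
  move=> w; exists (C^T *m w).
  by rewrite mulmxA -trmx_mul hC trmx1 mul1mx.
exists h^T; split; first exact: hom_tr_l.
by apply: trmx_inj; rewrite trmx_mul trmxK.
Qed.

Lemma injective_iso Q Q' : isomorphic Q Q' -> injectiveM Q -> injectiveM Q'.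
Proof.
case=> g [hg [g' [hg' e1 e2]]] hQ M L i C f hi hC hf.
have [h [h1 h2]] := hQ M L i C (g' *m f) hi hC (hom_comp hf hg').
exists (g *m h); split; first exact: hom_comp.
by rewrite -mulmxA h2 mulmxA e2 mul1mx.
Qed.

Section Sub.
Variables (M : mod) (d : nat) (B : 'M[k]_(mdim M, d)) (C : 'M[k]_(d, mdim M)).
Hypotheses (hCB : C *m B = 1%:M).
Hypothesis (hst : forall o, exists Z, op M o *m B = B *m Z).

Let sub_act (A : comAlgType k) (g : G2T p A) : 'M[A]_d :=
  C%:sc[A] *m act M g *m B%:sc[A].

Let hCBA (A : comAlgType k) : C%:sc[A] *m B%:sc[A] = 1%:M.
Proof. by rewrite -map_mxM hCB map_mx1. Qed.

Let sub_actE (A : comAlgType k) (g : G2T p A) :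
  B%:sc[A] *m sub_act g = act M g *m B%:sc[A].
Proof.
have [Z hZ] := opstable_act hst g.
by rewrite /sub_act -mulmxA hZ [C%:sc[A] *m _]mulmxA hCBA mul1mx.
Qed.

Lemma sub_act1 (A : comAlgType k) : sub_act (G2T_one charp A) = 1%:M.
Proof. by rewrite /sub_act act1 mulmx1 hCBA. Qed.
Lemma sub_actM (A : comAlgType k) (g h : G2T p A) :
  sub_act (G2T_mul charp g h) = sub_act g *m sub_act h.
Proof.
rewrite {1}/sub_act actM -!mulmxA -sub_actE [act M g *m _]mulmxA -sub_actE.
by rewrite -mulmxA [C%:sc[A] *m _]mulmxA hCBA mul1mx.
Qed.
Lemma sub_act_map (A A' : comAlgType k) (f : {lrmorphism A -> A'}) (g : G2T p A) :
  sub_act (G2T_map f g) = map_mx f (sub_act g).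
Proof. by rewrite /sub_act act_map !map_mxM !map_mx_sc. Qed.

(** The submodule spanned by the columns of B, in the coordinates given by these columns; C reads
    the coordinates off. *)
Definition sub_mod : mod := MkG2Tmod sub_act1 sub_actM sub_act_map.

Lemma sub_hom : @is_hom _ _ charp sub_mod M B.
Proof. by move=> A g; rewrite -sub_actE. Qed.

Lemma op_sub o : op sub_mod o = C *m op M o *m B.
Proof.
by rewrite -mulmxA (is_hom_op sub_hom) mulmxA hCB mul1mx.
Qed.
End Sub.

(** The operators act on the columns of B and on those of f by the same matrices Z, so B c |-> f c
    is a homomorphism on the column space of B. *)
Lemma injective_extend Q M d (B : 'M[k]_(mdim M, d)) C (f : 'M[k]_(mdim Q, d))
  (Z : opidx -> 'M[k]_d) :
  injectiveM Q -> C *m B = 1%:M ->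
  (forall o, op M o *m B = B *m Z o) -> (forall o, op Q o *m f = f *m Z o) ->
  exists h : 'M[k]_(mdim Q, mdim M), is_hom h /\ h *m B = f.
Proof.
move=> hQ hCB hB hf.
have hst o : exists Z, op M o *m B = B *m Z by exists (Z o).
apply: (hQ (sub_mod hCB hst) M B C f (sub_hom _ _) hCB).
apply/hom_op => o; rewrite op_sub -mulmxA hB mulmxA hCB mul1mx; exact: hf.
Qed.

Lemma map_mxcol (A A' : Type) (f : A -> A') n (q : 'I_n -> nat) m (D : forall i, 'M[A]_(q i, m)) :
  map_mx f (\mxcol_i D i) = \mxcol_i map_mx f (D i).
Proof. by apply/matrixP => a b; rewrite !mxE. Qed.

Lemma map_mxrow (A A' : Type) (f : A -> A') n (q : 'I_n -> nat) m (D : forall i, 'M[A]_(m, q i)) :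
  map_mx f (\mxrow_i D i) = \mxrow_i map_mx f (D i).
Proof. by apply/matrixP => a b; rewrite !mxE. Qed.

Lemma map_submxcol (A A' : Type) (f : A -> A') n (q : 'I_n -> nat) m
  (D : 'M[A]_(\sum_i q i, m)) i : map_mx f (submxcol D i) = submxcol (map_mx f D) i.
Proof. by apply/matrixP => a b; rewrite !mxE. Qed.

Lemma map_submxrow (A A' : Type) (f : A -> A') n (q : 'I_n -> nat) m
  (D : 'M[A]_(m, \sum_i q i)) i : map_mx f (submxrow D i) = submxrow (map_mx f D) i.
Proof. by apply/matrixP => a b; rewrite !mxE. Qed.

Section DsumHom.
Variables (n : nat) (D : 'I_n -> mod) (M : mod).
Lemma hom_mxcol (f : forall i, 'M[k]_(mdim (D i), mdim M)) :
  (forall i, is_hom (f i)) -> @is_hom _ _ charp M (dsum D) (\mxcol_i f i).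
Proof.
move=> h A g; rewrite /= map_mxcol mul_mxdiag_mxcol mxcol_mul.
by apply: eq_mxcol => i; rewrite h.
Qed.
Lemma hom_mxrow (f : forall i, 'M[k]_(mdim M, mdim (D i))) :
  (forall i, is_hom (f i)) -> @is_hom _ _ charp (dsum D) M (\mxrow_i f i).
Proof.
move=> h A g; rewrite /= map_mxrow mul_mxrow_mxdiag mul_mxrow.
by apply: eq_mxrow => i; rewrite h.
Qed.
Lemma hom_submxcol (f : 'M[k]_(mdim (dsum D), mdim M)) i :
  is_hom f -> @is_hom _ _ charp M (D i) (submxcol f i).
Proof.
move=> h A g; rewrite map_submxcol submxcol_mul -h /=.
by rewrite -[X in _ = submxcol (_ *m X) _]submxcolK mul_mxdiag_mxcol mxcolK.
Qed.
Lemma hom_submxrow (f : 'M[k]_(mdim M, mdim (dsum D))) i :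
  is_hom f -> @is_hom _ _ charp (D i) M (submxrow f i).
Proof.
move=> h A g; rewrite map_submxrow mul_submxrow h /=.
by rewrite -[X in submxrow (X *m _) _]submxrowK mul_mxrow_mxdiag mxrowK.
Qed.
End DsumHom.

Section Splitting.
Variables (n : nat) (M : mod) (D : 'I_n -> mod).
Variables (b : forall i, 'M[k]_(mdim M, mdim (D i))) (c : forall i, 'M[k]_(mdim (D i), mdim M)).
Lemma split_iso : (forall i, is_hom (b i)) -> (forall i, is_hom (c i)) ->
  (forall i, c i *m b i = 1%:M) -> (forall i j, i != j -> c i *m b j = 0) ->
  \sum_i b i *m c i = 1%:M -> isomorphic M (dsum D).
Proof.
move=> hb hc cb1 cb0 s1; exists (\mxcol_i c i); split; first exact: hom_mxcol.
exists (\mxrow_i b i); split; first exact: hom_mxrow.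
  by rewrite mul_mxrow_mxcol.
rewrite mul_mxcol_mxrow -(mxdiagZ (p_ := fun i => mdim (D i)) 1); apply/eq_mxblock => i j.
case: (eqVneq i j) => [<-|h]; last by rewrite cb0.
by rewrite cb1 conform_mx_id.
Qed.
End Splitting.

Lemma iso_dsum_split n M (D : 'I_n -> mod) : isomorphic M (dsum D) ->
  exists (b : forall i, 'M[k]_(mdim M, mdim (D i))) (c : forall i, 'M[k]_(mdim (D i), mdim M)),
  [/\ forall i, is_hom (b i), forall i, is_hom (c i),
  forall i, c i *m b i = 1%:M, forall i j, i != j -> c i *m b j = 0 &
  \sum_i b i *m c i = 1%:M].
Proof.
case=> f [hf [g [hg e1 e2]]].
exists (fun i => submxrow g i), (fun i => submxcol f i); split.
- by move=> i; apply: hom_submxrow.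
- by move=> i; apply: hom_submxcol.
- move=> i; rewrite mul_submxrow submxcol_mul e2 -submxblockEv.
  by rewrite -(mxdiagZ (p_ := fun i => mdim (D i)) 1) submxblock_diag.
- move=> i j ij; rewrite mul_submxrow submxcol_mul e2 -submxblockEv.
  rewrite -(mxdiagZ (p_ := fun i => mdim (D i)) 1) /mxdiag mxblockK.
  by rewrite (negbTE ij).
- by rewrite -mul_mxrow_mxcol submxrowK submxcolK.
Qed.

(** For a full-rank factorisation U V of an idempotent, U and V can be cancelled from U V U V = U V.
    Thus the image of an idempotent comes with its inclusion and projection. *)
Lemma idem_factor n d (U : 'M[k]_(n, d)) (V : 'M[k]_(d, n)) c r :
  c *m U = 1%:M -> V *m r = 1%:M -> (U *m V) *m (U *m V) = U *m V -> V *m U = 1%:M.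
Proof.
move=> hc hr /(congr1 (mulmx c)); rewrite !mulmxA hc !mul1mx => /(congr1 (mulmx^~ r)).
by rewrite -!mulmxA hr !mulmx1.
Qed.

Section Idempotents.
Variables (n : nat) (M : mod) (e : 'I_n -> 'M[k]_(mdim M)).
Hypotheses (he : forall i, @is_hom _ _ charp M M (e i)).
Hypotheses (hee : forall i, e i *m e i = e i) (he0 : forall i j, i != j -> e i *m e j = 0).
Hypothesis he1 : \sum_i e i = 1%:M.

Lemma idem_base i : row_base (e i) *m col_base (e i) = 1%:M.
Proof.
have /row_fullP[c hc] := col_base_full (e i).
have /row_freeP[r hr] := row_base_free (e i).
by apply: (idem_factor hc hr); rewrite mulmx_base hee.
Qed.

Lemma idem_stable i o : exists Z, op M o *m col_base (e i) = col_base (e i) *m Z.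
Proof.
have hb : e i *m col_base (e i) = col_base (e i).
  by rewrite -[X in X *m _](mulmx_base (e i)) -mulmxA idem_base mulmx1.
exists (row_base (e i) *m op M o *m col_base (e i)).
by rewrite -{1}hb mulmxA (is_hom_op (he i)) -[X in X *m op M o *m _](mulmx_base (e i)) -!mulmxA.
Qed.

Definition idem_mod i := sub_mod (idem_base i) (idem_stable i).

Lemma idem_iso : isomorphic M (dsum idem_mod).
Proof.
apply: (@split_iso _ M idem_mod (fun i => col_base (e i)) (fun i => row_base (e i))).
- by move=> i; apply: sub_hom.
- move=> i; apply/hom_op => o.
  rewrite op_sub -[LHS](mulmxA (row_base (e i) *m op M o)) mulmx_base.
  have hb : row_base (e i) *m e i = row_base (e i).
    by rewrite -[X in _ *m X](mulmx_base (e i)) mulmxA idem_base mul1mx.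
  rewrite -[LHS](mulmxA (row_base (e i)) (op M o)) (is_hom_op (he i)).
  by rewrite [LHS](mulmxA (row_base (e i)) (e i)) hb.
- exact: idem_base.
- move=> i j ij; have := he0 ij; rewrite -[X in X *m _](mulmx_base (e i)) -[X in _ *m X](mulmx_base (e j)).
  move: (idem_base i) (idem_base j).
  move: (row_base (e i)) (col_base (e i)) (row_base (e j)) (col_base (e j)).
  move=> ri bi rj bj hi hj /(congr1 (mulmx ri)) /(congr1 (mulmx^~ bj)).
  by rewrite !mulmxA hi mul1mx -mulmxA hj mulmx1 mulmx0 mul0mx.
- by rewrite -he1; apply: eq_bigr => i _; rewrite mulmx_base.
Qed.
End Idempotents.

Lemma indecomposable_idem M (e : 'M[k]_(mdim M)) : indecomposable M ->
  @is_hom _ _ charp M M e -> e *m e = e -> e = 0 \/ e = 1%:M.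
Proof.
move=> [M0 hM] he ee.
pose E (i : 'I_2) := if i == 0 then e else 1%:M - e.
have hE i : @is_hom _ _ charp M M (E i).
  by rewrite /E; case: ifP => // _; apply: hom_sub => //; apply: hom_id.
have ee' : (1%:M - e) *m (1%:M - e) = 1%:M - e.
  by rewrite mulmxBl mul1mx mulmxBr mulmx1 ee subrr subr0.
have hEE i : E i *m E i = E i by rewrite /E; case: ifP.
have hE0 i j : i != j -> E i *m E j = 0.
  rewrite /E; case: i j => -[|[|//]] hi [[|[|//]] hj] //= _.
    by rewrite mulmxBr mulmx1 ee subrr.
  by rewrite mulmxBl mul1mx ee subrr.
have hE1 : \sum_i E i = 1%:M.
  by rewrite !big_ord_recl big_ord0 /E /= addr0 addrC subrK.
have [i /= hi] := hM _ (idem_iso hE hEE hE0 hE1).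
have : E i = 0 by apply/eqP; rewrite -mxrank_eq0 hi.
rewrite /E; case: ifP => _; first by left.
by move/eqP; rewrite subr_eq0 => /eqP ->; right.
Qed.
End Modules.

(** * Binomial coefficients modulo p *)

Section Binomials.
Variables (k : fieldType) (p : nat) (charp : p \in [pchar k]).
Local Notation N := (p ^ 2)%N.
Let p0 : (0 < p)%N := p_gt0 charp.

Lemma nat_eq0 n : (n%:R == 0 :> k) = (p %| n)%N.
Proof. by rewrite (dvdn_pcharf charp). Qed.

Lemma polyX1_pchar n : ('X + 1 : {poly k}) ^+ (p * n) = ('X ^+ p + 1) ^+ n.
Proof.
have hp : p \in [pchar {poly k}] by rewrite pchar_poly.
by rewrite exprM -(pFrobenius_autE hp) rmorphD rmorph1 /= pFrobenius_autE.
Qed.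

Lemma coefX1n n i : (('X + 1 : {poly k}) ^+ n)`_i = 'C(n, i)%:R.
Proof.
rewrite addrC exprDn coef_sum.
case: (ltnP i n.+1) => hi.
  rewrite (bigD1 (Ordinal hi)) //= big1 ?addr0.
    by rewrite expr1n mul1r coefMn coefXn eqxx.
  move=> j; rewrite -val_eqE /= => hj.
  by rewrite expr1n mul1r coefMn coefXn eq_sym (negbTE hj) mul0rn.
rewrite bin_small // big1 // => j _; rewrite expr1n mul1r coefMn coefXn.
by rewrite [_ == _](_ : _ = false) ?mul0rn //; apply/eqP => e; have := ltn_ord j; lia.
Qed.

(** Compare coefficients in (X + 1)^(p a + b) = (X^p + 1)^a (X + 1)^b. *)
Lemma lucas a b c d : (b < p)%N -> (d < p)%N ->
  'C(p * a + b, p * c + d)%:R = 'C(a, c)%:R * 'C(b, d)%:R :> k.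
Proof.
move=> hb hd; rewrite -coefX1n exprD polyX1_pchar addrC exprDn mulr_suml coef_sum.
have term (i : nat) : ((1 ^+ (a - i) * 'X^p ^+ i *+ 'C(a, i) : {poly k}) * ('X + 1) ^+ b)`_(p * c + d) =
   (i == c)%:R * ('C(a, c)%:R * 'C(b, d)%:R).
  rewrite expr1n mul1r mulrnAl coefMn -exprM coefXnM.
  case: (eqVneq i c) => [->|hi].
    by rewrite ltnNge leq_addr /= addKn coefX1n mul1r mulr_natl.
  rewrite mul0r; case: ltnP => h; first by rewrite mul0rn.
  rewrite coefX1n bin_small ?mul0rn //; move: h => h.
  have : (i < c)%N.
    rewrite ltn_neqAle hi /= -ltnS; rewrite -(ltn_pmul2l p0) mulnS.
    by apply: leq_ltn_trans h _; rewrite addnC ltn_add2r.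
  move=> hic; have : (p * i.+1 <= p * c)%N by rewrite leq_pmul2l.
  by rewrite mulnS; lia.
under eq_bigr => i _ do rewrite term.
case: (ltnP c a.+1) => hc.
  rewrite (bigD1 (Ordinal hc)) //= eqxx mul1r big1 ?addr0 // => j.
  by rewrite -val_eqE /= => /negbTE ->; rewrite mul0r.
rewrite bin_small // mul0r big1 // => j _.
by rewrite mulr0.
Qed.

Lemma bin_lt_neq0 b d : (b < p)%N -> (d <= b)%N -> 'C(b, d)%:R != 0 :> k.
Proof.
move=> hb hd; rewrite nat_eq0; apply/negP => h.
have : (p %| b`!)%N by rewrite -(bin_fact hd) dvdn_mulr.
elim: b {hd h} hb => [|b IH] hb; first by rewrite fact0 dvdn1 => /eqP e; move: hb (p_pr charp); rewrite e.
rewrite factS Euclid_dvdM ?(p_pr charp) // => /orP[h|]; last exact: IH (ltnW hb).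
by have := dvdn_leq (ltn0Sn b) h; rewrite leqNgt hb.
Qed.

(** Both base p digits of N - 1 are p - 1, so each factor given by [lucas] is nonzero. *)
Lemma binN1_neq0 t : (t < N)%N -> 'C(N.-1, t)%:R != 0 :> k.
Proof.
move=> ht.
have -> : (N.-1 = p * p.-1 + p.-1)%N.
  by case: (p) p0 => // q _; rewrite expnS expn1 /= mulnS; lia.
rewrite {1}(divn_eq t p) [(_ * p)%N]mulnC lucas ?ltn_pmod // ?prednK //.
apply: mulf_neq0; apply: bin_lt_neq0; rewrite ?prednK //.
  by rewrite -ltnS prednK // ltn_divLR // mulnn.
by rewrite -ltnS prednK // ltn_pmod.
Qed.

Lemma binp n : 'C(n, p)%:R = (n %/ p)%:R :> k.
Proof.
have h := lucas (n %/ p) 1 (ltn_pmod n p0) p0.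
by rewrite muln1 addn0 bin1 bin0 mulr1 mulnC -divn_eq in h.
Qed.
End Binomials.

(** * Fitting's lemma *)

Section Fitting.
Variable k : closedFieldType.

Lemma linv_of_inj m n (U : 'M[k]_(m, n)) :
  (forall y : 'cV_n, U *m y = 0 -> y = 0) -> exists C, C *m U = 1%:M.
Proof.
move=> h; have hf : row_free U^T.
  rewrite -kermx_eq0; apply/eqP/row_matrixP => i; rewrite row0.
  apply: trmx_inj; rewrite trmx0; apply: h.
  apply: trmx_inj; rewrite trmx_mul trmxK trmx0 -row_mul mulmx_ker row0.
  by [].
have [C hC] := row_freeP hf; exists C^T.
by apply: trmx_inj; rewrite trmx_mul trmxK hC trmx1.
Qed.

(** The projection onto the generalised kernel of f, obtained as a polynomial in f so that it
    commutes with whatever commutes with f, in particular with the module operators. *)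
Lemma fitting_mx n (f : 'M[k]_n) : exists e : 'M[k]_n,
  [/\ e *m e = e, forall g, f *m g = g *m f -> e *m g = g *m e,
      e = 0 -> f \in unitmx & e = 1%:M -> exists a, iter a (mulmx f) 1%:M = 0].
Proof.
case: n f => [|n] f.
  exists 0; split.
  - by rewrite mul0mx.
  - by move=> g _; rewrite mul0mx mulmx0.
  - by move=> _; rewrite unitmxE det_mx00 unitr1.
  - by move=> _; exists 0%N; apply/matrixP => -[].
have [m [q hq e]] := multiplicity_XsubC (char_poly f) 0.
have q0 : ~~ root q 0 by move: hq; rewrite monic_neq0 ?char_poly_monic.
rewrite subr0 in e.
(* The exponent is m + 1 and not m, so that a factor f is available for proving invertibility also
   when m = 0. *)
have : coprimep q ('X^(m.+1)).
  by rewrite coprimep_expr //; have := coprimep_XsubC q 0; rewrite polyC0 subr0 => ->.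
move=> /Bezout_eq1_coprimepP[[u1 u2] /= hu].
pose h := horner_mx f.
have hX : h 'X^(m.+1) = f ^+ m.+1 by rewrite /h rmorphXn /= horner_mx_X.
have hs : h (u1 * q) + h (u2 * 'X^(m.+1)) = 1 by rewrite /h -rmorphD hu rmorph1.
have h2 : h (u2 * 'X^(m.+1)) = h u2 * f ^+ m.+1.
  by rewrite -hX /h (rmorphM (horner_mx f)).
have hz : h (u1 * q) * h 'X^(m.+1) = 0.
  have eq : u1 * q * 'X^(m.+1) = (u1 * 'X) * char_poly f by rewrite e exprS; ring.
  transitivity (h (u1 * 'X) * h (char_poly f)); last by rewrite [h (char_poly f)]Cayley_Hamilton mulr0.
  by rewrite /h -!(rmorphM (horner_mx f)) eq.
exists (h (u1 * q)); split.
- change (h (u1 * q) * h (u1 * q) = h (u1 * q)).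
  rewrite -{2}[h (u1 * q)](addrK (h (u2 * 'X^(m.+1)))) hs mulrBr mulr1.
  by rewrite [u2 * _]mulrC [h (_ * u2)]rmorphM mulrA hz mul0r subr0.
- move=> g hg; exact: (comm_horner_mx _ hg).
- move=> h0; rewrite h0 add0r h2 exprSr mulrA in hs.
  by have [] := mulmx1_unit hs.
- move=> h1; exists m.+1; move: hz; rewrite h1 hX [1%:M * _]mul1r => <-.
  by elim: m.+1 => [|a IH] //=; rewrite exprS -IH.
Qed.

Variables (p : nat) (charp : p \in [pchar k]).

Definition idem_trivial (M : G2Tmod charp) : Prop :=
  forall e : 'M[k]_(mdim M), @is_hom _ _ charp M M e -> e *m e = e -> e = 0 \/ e = 1%:M.

Lemma fitting (M : G2Tmod charp) (f : 'M[k]_(mdim M)) : idem_trivial M ->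
  @is_hom _ _ charp M M f -> f \in unitmx \/ exists a, iter a (mulmx f) 1%:M = 0.
Proof.
move=> hM hf; have [e [ee ec e0 e1]] := fitting_mx f.
have he : @is_hom _ _ charp M M e.
  by apply/hom_op => o; apply/esym/ec; rewrite (is_hom_op hf).
by case: (hM e he ee) => h; [left; apply: e0|right; apply: e1].
Qed.

Lemma nilp_fix n m (f : 'M[k]_n) (v : 'M[k]_(n, m)) a :
  iter a (mulmx f) 1%:M = 0 -> f *m v = v -> v = 0.
Proof.
move=> h fv; have : iter a (mulmx f) 1%:M *m v = v.
  by elim: a {h} => [|a IH] /=; rewrite ?mul1mx // -mulmxA IH.
by rewrite h mul0mx.
Qed.
End Fitting.

(** * Singular vectors in injective hulls *)

Section Hull.
Variables (k : closedFieldType) (p : nat) (charp : p \in [pchar k]).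
Local Notation N := (p ^ 2)%N.
Local Notation mod := (G2Tmod charp).
Local Notation kk := (k^o : comAlgType k).
Implicit Types M L Q : mod.
Let N0 : (0 < N)%N := N_gt0 charp.

Lemma opE0 M : opE M 0 = 1%:M.
Proof.
have := act_up M (A := kk) (expN0 charp kk).
rewrite (bigD1 (Ordinal N0)) //= big1 ?addr0; last first.
  move=> i; rewrite -val_eqE /= => hi.
  by rewrite expr0n (negbTE hi) scale0r.
rewrite expr0 scale1r sc_id => <-.
transitivity (act M (G2T_one charp kk)); last exact: (@act1 _ _ _ M kk).
by apply: (@act_irr _ _ _ M kk); rewrite /= mx2_1.
Qed.

Lemma opF0 M : opF M 0 = 1%:M.
Proof. by rewrite -[LHS]trmxK -opE_tau opE0 trmx1. Qed.

Lemma opE_wtv M n r m (v : 'M[k]_(mdim M, m)) : wproj M n *m v = v ->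
  wproj M (n + (r.*2)%:Z) *m (opE M r *m v) = opE M r *m v.
Proof. by move=> h; rewrite mulmxA opE_wt -mulmxA h. Qed.

Lemma opF_wtv M n r m (v : 'M[k]_(mdim M, m)) : wproj M n *m v = v ->
  wproj M (n - (r.*2)%:Z) *m (opF M r *m v) = opF M r *m v.
Proof. by move=> h; rewrite mulmxA opF_wt -mulmxA h. Qed.

Lemma wproj_wtv M n i m (v : 'M[k]_(mdim M, m)) : wproj M n *m v = v ->
  wproj M i *m v = (i == n)%:R *: v.
Proof. by move=> <-; rewrite mulmxA wprojM scalemxAl. Qed.

(* A weight vector killed by the augmentation ideal of Dist(U^+_2). *)
Definition singular M n (z : 'cV[k]_(mdim M)) : Prop :=
  wproj M n *m z = z /\ forall r, (0 < r)%N -> opE M r *m z = 0.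

Lemma sing_EF M n z r s : singular n z -> (s < N)%N ->
  opE M r *m (opF M s *m z) =
  if (r <= s)%N then 'C(zres N (n + r%:Z - s%:Z), r)%:R *: (opF M (s - r) *m z) else 0.
Proof.
move=> [hw hz] hs; case: (ltnP r N) => hr; last first.
  by rewrite opE_ge // mul0mx ifF // leqNgt (leq_trans hs hr).
rewrite (kostant hr hs hw) big_mkcond (bigD1 (Ordinal hr)) //= leqnn /=.
rewrite big1 ?addr0.
  by case: ifP => // h; rewrite subnn opE0 mul1mx.
move=> j; rewrite -val_eqE /= => hj; case: ifP => // /andP[h1 h2].
by rewrite hz ?mulmx0 ?scaler0 // subn_gt0 ltn_neqAle hj.
Qed.

(** Its columns F_s z span the submodule generated by z when z is singular. For a highest weight
    vector of a hull they are independent and span a copy of a baby Verma module. *)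
Definition Fmx M (z : 'cV[k]_(mdim M)) : 'M[k]_(mdim M, N) :=
  \matrix_(i, s) (opF M s *m z) i 0.

Lemma FmxE M (z : 'cV[k]_(mdim M)) (y : 'cV_N) :
  Fmx z *m y = \sum_(s < N) y s 0 *: (opF M s *m z).
Proof.
apply/colP => i; rewrite mxE summxE; apply: eq_bigr => s _.
by rewrite !mxE mulrC.
Qed.

Lemma col_Fmx M (z : 'cV[k]_(mdim M)) (s : 'I_N) : col s (Fmx z) = opF M s *m z.
Proof. by apply/colP => i; rewrite !mxE. Qed.

Lemma opF_span M (z : 'cV[k]_(mdim M)) s : exists y, opF M s *m z = Fmx z *m y.
Proof.
case: (ltnP s N) => h; last by exists 0; rewrite opF_ge // mul0mx mulmx0.
by exists (delta_mx (Ordinal h) 0); rewrite -colE col_Fmx.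
Qed.

(* The matrices by which the operators act on U^-_2 z for z singular of weight n. *)
Definition singZ (n : int) (o : opidx) : 'M[k]_N :=
  \matrix_(t, s) match o with
    | OE r => if (r <= s)%N && (t == s - r :> nat)%N then 'C(zres N (n + r%:Z - s%:Z), r)%:R else 0
    | OF r => if (t == r + s :> nat)%N then 'C(r + s, r)%:R else 0
    | OW i => if t == s then (i == n - (s.*2)%:Z)%:R else 0
  end.

Lemma sing_op M n z : singular n z -> forall o, op M o *m Fmx z = Fmx z *m singZ n o.
Proof.
move=> hz o; apply: trmx_inj; apply/row_matrixP => s; rewrite -!tr_col; congr (_^T).
rewrite colE -[LHS]mulmxA -colE col_Fmx [RHS]colE -[RHS]mulmxA FmxE -/(op M o).
have E (t : 'I_N) : (singZ n o *m (delta_mx s 0 : 'cV_N)) t 0 = singZ n o t s.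
  by rewrite -colE [LHS]mxE.
under eq_bigr => t _ do rewrite E mxE.
case: o {E} => [r|r|i] /=.
- rewrite (sing_EF r hz) //; case: ifP => h; last first.
    by rewrite big1 // => t _; rewrite scale0r.
  have hsr : (s - r < N)%N by apply: leq_ltn_trans (leq_subr _ _) _.
  rewrite (bigD1 (Ordinal hsr)) //= eqxx big1 ?addr0 // => t.
  by rewrite -val_eqE /= => /negbTE ->; rewrite scale0r.
- rewrite mulmxA opFM -scalemxAl; case: (ltnP (r + s) N) => hrs.
    rewrite (bigD1 (Ordinal hrs)) //= eqxx big1 ?addr0 // => t.
    by rewrite -val_eqE /= => /negbTE ->; rewrite scale0r.
  rewrite opF_ge // mul0mx scaler0 big1 // => t _.
  by rewrite ifF ?scale0r //; apply/negP => /eqP e; have := ltn_ord t; rewrite e ltnNge hrs.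
- rewrite (wproj_wtv i (opF_wtv s hz.1)) (bigD1 s) //= eqxx big1 ?addr0 // => t.
  by move=> /negbTE ->; rewrite scale0r.
Qed.

Lemma sing_stable M n z : singular n z -> forall o, exists Z, op M o *m Fmx z = Fmx z *m Z.
Proof. by move=> hz o; exists (singZ n o); apply: sing_op. Qed.

(** If s0 is the least index with y_s0 <> 0, then F_{N-1-s0} kills the later terms and maps F_s0 v
    to a nonzero multiple of F_{N-1} v, by [binN1_neq0]. *)
Lemma Fmx_extract M (v : 'cV[k]_(mdim M)) (y : 'cV[k]_N) : y != 0 ->
  exists t, exists2 c, c != 0 & opF M t *m (Fmx v *m y) = c *: (opF M N.-1 *m v).
Proof.
move=> y0.
have [s0 hs0 hmin] : exists2 s : 'I_N, y s 0 != 0 & forall s' : 'I_N, y s' 0 != 0 -> (s <= s')%N.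
  have [s hs] : exists s : 'I_N, y s 0 != 0.
    apply/existsP; apply: contraNT y0; rewrite negb_exists => /forallP h.
    by apply/eqP/colP => s; rewrite mxE; apply/eqP; have := h s; rewrite negbK.
  case: (@arg_minnP _ s (fun s => y s 0 != 0) (fun s => s : nat) hs) => s1 h1 h2.
  by exists s1.
exists (N.-1 - s0)%N; have hs : (s0 <= N.-1)%N by rewrite -ltnS prednK.
exists ('C(N.-1, N.-1 - s0)%:R * y s0 0).
  by rewrite mulf_neq0 // (binN1_neq0 charp) // -[X in (_ < X)%N](prednK N0) ltnS leq_subr.
rewrite FmxE mulmx_sumr (bigD1 s0) //= big1 ?addr0.
  by rewrite -scalemxAr mulmxA opFM subnK // -scalemxAl scalerA mulrC.
move=> s hne; rewrite -scalemxAr mulmxA opFM.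
case: (eqVneq (y s 0) 0) => [->|/hmin hle]; first by rewrite scale0r.
rewrite opF_ge ?scaler0 ?mul0mx ?scaler0 //.
have : s0 != s :> nat by rewrite eq_sym.
have := N0; move: hs hle => /=; lia.
Qed.

(* Satisfied by T_2(m) and its dual, v being a highest weight vector; the vector
   F_{N-1} v then lies in every nonzero submodule. *)
Record hull (Q : mod) (m : int) (v : 'cV[k]_(mdim Q)) : Prop := Hull {
  hull_inj : injectiveM Q;
  hull_ind : idem_trivial Q;
  hull_wt : wproj Q m *m v = v;
  hull_top : forall n, wproj Q n != 0 -> n <= m;
  hull_low : opF Q N.-1 *m v != 0 }.

Section HullTheory.
Variables (Q : mod) (m : int) (v : 'cV[k]_(mdim Q)).
Hypothesis hQ : hull m v.
Local Notation w := (opF Q N.-1 *m v).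
Local Notation l := (m - (N.-1.*2)%:Z).

Lemma top_singular z : wproj Q m *m z = z -> singular m z.
Proof.
move=> hz; split=> // r r0; rewrite -(opE_wtv r hz).
have [->|/(hull_top hQ)] := eqVneq (wproj Q (m + (r.*2)%:Z)) 0; first by rewrite mul0mx.
by lia.
Qed.

Lemma Fmx_inj (y : 'cV_N) : Fmx v *m y = 0 -> y = 0.
Proof.
move=> h; apply/eqP; apply/negPn/negP => /(Fmx_extract v)[t [c c0]].
rewrite h mulmx0 => /esym/eqP; rewrite scaler_eq0 (negbTE c0) /=.
by rewrite (negbTE (hull_low hQ)).
Qed.

Lemma low_wt : wproj Q l *m w = w.
Proof. exact: opF_wtv (hull_wt hQ). Qed.

(** Otherwise, by [Fmx_extract], the submodule b and the span of the F_s v are independent.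
    Injectivity then gives an endomorphism that is the identity on the first and zero on the second;
    by Fitting it is invertible or nilpotent, and both are impossible. *)
Lemma hull_meet d (B : 'M[k]_(mdim Q, d)) : B != 0 ->
  (forall o, exists Z, op Q o *m B = B *m Z) -> exists c, w = B *m c.
Proof.
move=> B0 hB; apply: contrapT => hno.
have [d' [b [r [b' [r' [eB hb' hr']]]]]] : exists d' (b : 'M[k]_(mdim Q, d'))
    (r : 'M_(d', d)) b' r', [/\ B = b *m r, b' *m b = 1%:M & r *m r' = 1%:M].
  have /row_fullP[b' hb'] := col_base_full B; have /row_freeP[r' hr'] := row_base_free B.
  by exists (\rank B), (col_base B), (row_base B), b', r'; rewrite mulmx_base.
have eb : b = B *m r' by rewrite eB -mulmxA hr' mulmx1.
have hbs o : exists Z, op Q o *m b = b *m Z.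
  have [Z hZ] := hB o; exists (r *m Z *m r').
  by rewrite !mulmxA -eB -hZ -mulmxA -eb.
have {hno} sep (x : 'cV_d') (y : 'cV_N) : b *m x = Fmx v *m y -> y = 0.
  move=> e; apply/eqP; apply/negPn/negP => /(Fmx_extract v)[t [c c0 hc]]; apply: hno.
  have [Z hZ] := hbs (OF t).
  exists (c^-1 *: (r' *m (Z *m x))).
  rewrite -scalemxAr [B *m _]mulmxA -eb mulmxA -hZ /= -mulmxA e hc scalerA mulVf //.
  by rewrite scale1r.
have inj (y : 'cV_(d' + N)) : row_mx b (Fmx v) *m y = 0 -> y = 0.
  rewrite -[y]vsubmxK mul_row_col => e.
  have e2 : dsubmx y = 0.
    by apply: (@sep (- usubmx y)); apply/eqP; rewrite mulmxN eq_sym -addr_eq0 addrC e.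
  move: e; rewrite e2 mulmx0 addr0 => e.
  have -> : usubmx y = 0 by rewrite -[usubmx y]mul1mx -hb' -mulmxA e mulmx0.
  by rewrite col_mx0.
have [C hC] := linv_of_inj inj.
have /choice[Z1 hZ1] := hbs.
have /choice[Z2 hZ2] := sing_stable (top_singular (hull_wt hQ)).
have hB1 o : op Q o *m row_mx b (Fmx v) = row_mx b (Fmx v) *m block_mx (Z1 o) 0 0 (Z2 o).
  by rewrite mul_mx_row mul_row_block hZ1 hZ2 !mulmx0 addr0 add0r.
have hB2 o : op Q o *m row_mx b 0 = row_mx b 0 *m block_mx (Z1 o) 0 0 (Z2 o).
  by rewrite mul_mx_row mul_row_block hZ1 !mulmx0 mul0mx !addr0.
have [h [hh he]] := injective_extend (hull_inj hQ) hC hB1 hB2.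
move: he; rewrite mul_mx_row => /eq_row_mx[hb hF].
have b0 : b != 0 by apply: contra B0 => /eqP b0; rewrite eB b0 mul0mx.
have [hu|[a ha]] := fitting (hull_ind hQ) hh.
  have F0 : Fmx v = 0 by rewrite -[LHS](mulKmx hu) hF mulmx0.
  have [y hy] := opF_span v N.-1.
  by have /eqP := hull_low hQ; apply; rewrite hy F0 mul0mx.
by rewrite (nilp_fix ha hb) eqxx in b0.
Qed.

(** The submodule spanned by the F_s z contains w by [hull_meet], and comparing weights leaves a
    single s. *)
Lemma hull_sing n (z : 'cV[k]_(mdim Q)) : singular n z -> z != 0 ->
  exists s, [/\ (s < N)%N, n - (s.*2)%:Z = l & exists2 c, c != 0 & opF Q s *m z = c *: w].
Proof.
move=> hz z0.
have B0 : Fmx z != 0.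
  apply: contra z0 => /eqP h; rewrite -[z]mul1mx -(opF0 Q).
  by have [y ->] := opF_span z 0; rewrite h mul0mx.
have [y hy] := hull_meet B0 (sing_stable hz).
have hs (s : 'I_N) : n - (s.*2)%:Z != l -> wproj Q l *m (opF Q s *m z) = 0.
  by move=> hne; rewrite (wproj_wtv l (opF_wtv s hz.1)) eq_sym (negbTE hne) scale0r.
have e : w = \sum_(s < N) y s 0 *: (wproj Q l *m (opF Q s *m z)).
  rewrite -{1}low_wt hy FmxE mulmx_sumr; apply: eq_bigr => s _.
  by rewrite -scalemxAr.
have [s hsl] : exists s : 'I_N, n - (s.*2)%:Z == l.
  apply/existsP; apply: contraT; rewrite negb_exists => /forallP h.
  have := hull_low hQ; rewrite e big1 ?eqxx // => s _.
  by rewrite hs ?scaler0.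
exists s; split => //; first exact/eqP.
have e' : w = y s 0 *: (opF Q s *m z).
  rewrite e (bigD1 s) //= big1 ?addr0.
    by rewrite (wproj_wtv l (opF_wtv s hz.1)) eq_sym hsl scale1r.
  move=> s' hne; rewrite hs ?scaler0 //; apply: contra hne => /eqP h'.
  by apply/eqP/val_inj => /=; move/eqP: hsl; lia.
have y0 : y s 0 != 0.
  by apply: contra (hull_low hQ) => /eqP h0; rewrite e' h0 scale0r.
by exists (y s 0)^-1; rewrite ?invr_neq0 // e' scalerA mulVf // scale1r.
Qed.

Lemma singular_lin n (z z' : 'cV[k]_(mdim Q)) c : singular n z -> singular n z' -> @singular Q n (c *: z + z').
Proof.
move=> [h1 h2] [h3 h4]; split; first by rewrite mulmxDr -scalemxAr h1 h3.
by move=> r r0; rewrite mulmxDr -scalemxAr h2 // h4 // scaler0 addr0.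
Qed.

(** Some combination x of z and z' is killed by the one F_s that could map it onto w; by
    [hull_sing], x = 0. *)
Lemma hull_sing_uniq n (z z' : 'cV[k]_(mdim Q)) : singular n z -> z != 0 -> singular n z' ->
  exists c, z' = c *: z.
Proof.
move=> hz z0 hz'.
have [-> |z'0] := eqVneq z' 0; first by exists 0; rewrite scale0r.
have [s [hs1 hs2 [c c0 hc]]] := hull_sing hz z0.
have [s' [hs1' hs2' [c' c'0 hc']]] := hull_sing hz' z'0.
have es : s' = s by lia.
rewrite es in hc'.
pose x := (- (c' / c)) *: z + z'.
have hx : singular n x by apply: singular_lin.
have hx0 : opF Q s *m x = 0.
  rewrite mulmxDr -scalemxAr hc hc' scalerA -scalerDl mulNr divfK // addNr.
  by rewrite scale0r.
case: (eqVneq x 0) => [x0|/(hull_sing hx)[t [ht1 ht2 [d d0 hd]]]].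
  exists (c' / c); apply/eqP; rewrite -subr_eq0 -x0 /x scaleNr addrC.
  by [].
have et : t = s by lia.
rewrite et hx0 in hd; move/esym/eqP: hd; rewrite scaler_eq0 (negbTE d0) /=.
by rewrite (negbTE (hull_low hQ)).
Qed.

(** For r > 0, F_r kills F_s z, a multiple of F_{N-1} v. Applying E_r to F_r F_s z gives binom(r +
    s, r) binom(n - s, r) = 0 modulo p whenever r + s < N. The cases r = 1 and r = p give the two
    conditions; if r + s >= N, then s = N - 1, respectively s %/ p = p - 1, and the first
    alternative holds. *)
Lemma hull_sing_cond n (z : 'cV[k]_(mdim Q)) : singular n z -> z != 0 ->
  exists s, [/\ (s < N)%N, n - (s.*2)%:Z = l,
     exists2 c, c != 0 & opF Q s *m z = c *: w,
     (p %| s.+1)%N || (p%:Z %| n - s%:Z)%Z &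
     (p %| (s %/ p).+1)%N || (p %| zres N (n - s%:Z) %/ p)%N].
Proof.
move=> hz z0; have [s [hs1 hs2 [c c0 hc]]] := hull_sing hz z0.
have key r : (0 < r)%N -> (r + s < N)%N -> 'C(r + s, r)%:R * 'C(zres N (n - s%:Z), r)%:R = 0 :> k.
  move=> r0 hrs; have : opE Q r *m (opF Q r *m (opF Q s *m z)) = 0.
    by rewrite hc -scalemxAr mulmxA opFM opF_ge ?scaler0 ?mul0mx ?scaler0 ?mulmx0 //;
       have := N0; lia.
  rewrite [opF Q r *m _]mulmxA opFM -scalemxAl -scalemxAr (sing_EF r hz) // leq_addr addKn hc.
  have -> : n + r%:Z - (r + s)%N%:Z = n - s%:Z by lia.
  rewrite !scalerA => /eqP; rewrite scaler_eq0 (negbTE (hull_low hQ)) orbF => /eqP h.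
  by apply: (mulIf c0); rewrite mul0r -h; ring.
have p0 := p_gt0 charp.
have hN : N = (p * p)%N by rewrite mulnn.
exists s; split=> //; first by exists c.
- case: (ltnP (1 + s) N) => h.
    have /eqP := key 1%N isT h; rewrite mulf_eq0 !bin1 !(nat_eq0 charp) add1n.
    case/orP=> [->//|h2]; apply/orP; right.
    have : (p%:Z %| (zres N (n - s%:Z))%:Z)%Z by [].
    have NZ : N%:Z != 0 by have := N0; lia.
    rewrite /zres gez0_abs ?modz_ge0 //.
    rewrite [X in _ -> (_ %| X)%Z](divz_eq _ N%:Z) => h3; apply: rpredD => //; apply: dvdz_mull.
    by rewrite hN PoszM dvdz_mulr.
  by have -> : (s.+1 = N)%N; [lia|rewrite hN dvdn_mulr].
- case: (ltnP (p + s) N) => h.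
    have /eqP := key p p0 h; rewrite mulf_eq0 !(binp charp) !(nat_eq0 charp).
    by rewrite divnDl ?dvdnn // divnn p0 add1n.
  have hs : (s %/ p = p.-1)%N.
    apply/eqP; rewrite eqn_leq -ltnS prednK // ltn_divLR // -hN hs1 /=.
    by rewrite leq_divRL //; move: h; rewrite hN; case: (p) p0 => //= q _; nia.
  by rewrite hs prednK // dvdnn.
Qed.
End HullTheory.
End Hull.

(** * The Steinberg module *)

Section Homogenize.
Variable A : comNzRingType.
Implicit Types (a b : A) (f U V : {poly A}).
Definition lin (a b : A) : {poly A} := a *: 'X + b%:P.
(** The homogenisation of f in degree n, evaluated at (U, V). It expresses the composition of two
    linear substitutions in [symmxM]. *)
Definition homog n (f U V : {poly A}) : {poly A} :=
  \sum_(r < n.+1) f`_r *: (U ^+ r * V ^+ (n - r)).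

Lemma coef_lin a b f r : (lin a b * f)`_r = a * (if r is r'.+1 then f`_r' else 0) + b * f`_r.
Proof.
rewrite mulrDl coefD coefCM -scalerAl coefZ [_ * f]mulrC coefMX.
by case: r.
Qed.

Lemma homog_lin n a b f U V : (size f <= n.+1)%N ->
  homog n.+1 (lin a b * f) U V = (a *: U + b *: V) * homog n f U V.
Proof.
move=> hf; rewrite /homog; under eq_bigr => r _ do rewrite coef_lin scalerDl.
rewrite big_split /= mulrDl; congr (_ + _).
  rewrite big_ord_recl /= mulr0 scale0r add0r mulr_sumr; apply: eq_bigr => r _.
  by rewrite /bump /= add1n subSS exprS -scalerA -scalerAl -!scalerAr mulrA.
rewrite big_ord_recr /= (nth_default 0 hf) mulr0 scale0r addr0 mulr_sumr.
apply: eq_bigr => r _; have hr : (r <= n)%N by rewrite -ltnS.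
by rewrite subSn // exprS -scalerA -scalerAl -!scalerAr [V * (_ * _)]mulrCA.
Qed.

Lemma size_lin a b n f : (size f <= n)%N -> (size (lin a b * f)%R <= n.+1)%N.
Proof.
move=> h; apply: leq_trans (size_polyMleq _ _) _.
have : (size (lin a b) <= 2)%N.
  rewrite (leq_trans (size_polyD _ _)) // geq_max (leq_trans (size_scale_leq _ _)) ?size_polyX //.
  by rewrite (leq_trans (size_polyC_leq1 _)).
by move: h; lia.
Qed.

Lemma homog_prod a b c d U V s t :
  (size (lin a b ^+ s * lin c d ^+ t)%R <= (s + t).+1)%N /\
  homog (s + t) (lin a b ^+ s * lin c d ^+ t) U V =
  (a *: U + b *: V) ^+ s * (c *: U + d *: V) ^+ t.
Proof.
elim: s => [|s [IH1 IH2]].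
  rewrite expr0 mul1r add0n [in RHS]expr0 mul1r; elim: t => [|t [IH1 IH2]].
    rewrite !expr0 size_poly1; split=> //.
    by rewrite /homog big_ord_recl big_ord0 /= coef1 /= !expr0 mulr1 scale1r addr0.
  rewrite !exprS; split; first exact: size_lin.
  by rewrite homog_lin // IH2.
rewrite !exprS -mulrA addSn; split; first exact: size_lin.
by rewrite homog_lin // IH2 mulrA.
Qed.

(** The action of g on the n-th symmetric power of the natural module, in the basis x^s y^(n-s) with
    y set to 1. *)
Definition symmx n (g : 'M[A]_2) : 'M[A]_n.+1 :=
  \matrix_(r, s) ((lin (g 0 0) (g 1 0) ^+ s * lin (g 0 1) (g 1 1) ^+ (n - s)) : {poly A})`_r.

Lemma symmxM n (g h : 'M[A]_2) : symmx n (g *m h) = symmx n g *m symmx n h.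
Proof.
apply/matrixP => q s; rewrite [LHS]mxE [RHS]mxE.
have E2 i j : (g *m h) i j = g i 0 * h 0 j + g i 1 * h 1 j.
  by rewrite mxE !big_ord_recl big_ord0 addr0; congr (_ + g i _ * h _ j); apply/val_inj.
have hs : (s + (n - s) = n)%N by rewrite subnKC // -ltnS.
have [_] := homog_prod (h 0 0) (h 1 0) (h 0 1) (h 1 1)
  (lin (g 0 0) (g 1 0)) (lin (g 0 1) (g 1 1)) s (n - s).
have e (a b a' b' c d : A) : c *: lin a b + d *: lin a' b' = lin (a * c + a' * d) (b * c + b' * d).
  rewrite /lin !scalerDr !scalerA -!mul_polyC -!polyCM addrACA -mulrDl -!polyCD.
  by rewrite [c * a]mulrC [d * a']mulrC [c * b]mulrC [d * b']mulrC.
rewrite !e hs !E2 => <-.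
rewrite /homog coef_sum; apply: eq_bigr => r _; rewrite coefZ !mxE mulrC.
by [].
Qed.

Lemma symmx1 n : symmx n 1%:M = 1%:M.
Proof.
apply/matrixP => r s; rewrite !mxE /= /lin scale1r addr0 scale0r add0r expr1n mulr1.
by rewrite coefXn.
Qed.
End Homogenize.

Lemma symmx_map (A B : comNzRingType) (f : {rmorphism A -> B}) n (g : 'M[A]_2) :
  symmx n (map_mx f g) = map_mx f (symmx n g).
Proof.
have e a b : lin (f a) (f b) = map_poly f (lin a b).
  by rewrite rmorphD /= map_polyC /= map_polyZ map_polyX.
apply/matrixP => r s; rewrite !mxE !e -!rmorphXn -rmorphM coef_map.
by [].
Qed.

Lemma sum_tens (V : nmodType) m n (F : 'I_m -> 'I_n -> V) :
  \sum_(c < m * n) F (mxtens_unindex c).1 (mxtens_unindex c).2 = \sum_i \sum_j F i j.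
Proof.
rewrite pair_big [LHS](reindex (@mxtens_index m n)); last first.
  by exists (@mxtens_unindex m n) => i _; rewrite (mxtens_indexK, mxtens_unindexK).
by apply: eq_bigr => -[i j] _; rewrite mxtens_indexK.
Qed.

Section Tensor.
Variables (k : closedFieldType) (p : nat) (charp : p \in [pchar k]).
Local Notation N := (p ^ 2)%N.
Local Notation mod := (G2Tmod charp).
Local Notation R2 := (trunc2 charp).
Local Notation X := (trX (trunc2 charp)).
Local Notation coef2 := (tr_coef (trunc2 charp)).
Implicit Types M L Q : mod.
Let N0 : (0 < N)%N := N_gt0 charp.
Local Notation "A *t B" := (tensmx A B) (at level 40, left associativity).

Lemma polyX1N : ('X + 1 : {poly k}) ^+ N = 'X^N + 1.
Proof.
have hp : p \in [pchar {poly k}] by rewrite pchar_poly.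
by rewrite -mulnn exprM -!(pFrobenius_autE hp) !rmorphD !rmorph1 /= !pFrobenius_autE -exprM.
Qed.

(** Pascal's rule together with binom(N, s + 1) = 0 modulo p for s + 1 < N; the bound s < N suffices
    because only the smaller indices enter the induction. *)
Lemma binN1 s : (s < N)%N -> 'C(N.-1, s)%:R = (-1) ^+ s :> k.
Proof.
elim: s => [|s IH] hs; first by rewrite bin0 expr0.
have h : 'C(N, s.+1)%:R = 0 :> k.
  by rewrite -(coefX1n charp) polyX1N coefD coefXn coef1 (ltn_eqF hs) addr0.
rewrite -(prednK N0) binS natrD in h.
by rewrite exprS -IH ?(ltnW hs) // mulN1r; apply/eqP; rewrite -addr_eq0 h.
Qed.

(** In (X^N + 1) (X + 1)^(j-1) the term X^j cannot occur, because j - 1 < j < N. *)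
Lemma binN_0 (j : nat) : (0 < j)%N -> (j < N)%N -> 'C(N.-1 + j, j)%:R = 0 :> k.
Proof.
move=> j0 hj; have -> : (N.-1 + j = N + j.-1)%N by lia.
rewrite -(coefX1n charp) exprD polyX1N mulrDl mul1r coefD coefXnM hj add0r (coefX1n charp).
by rewrite bin_small // prednK.
Qed.

Section TensMod.
Variables (M L : mod).
Let tens_act (A : comAlgType k) (g : G2T p A) : 'M[A]_(mdim M * mdim L) :=
  act M g *t act L g.
Lemma tens_act1 (A : comAlgType k) : tens_act (G2T_one charp A) = 1%:M.
Proof.
rewrite /tens_act !act1; apply/matrixP => i j.
case: (mxtens_indexP i) => i1 i2; case: (mxtens_indexP j) => j1 j2.
rewrite tensmxE !mxE (can_eq (@mxtens_indexK _ _)) -natrM mulnb.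
by [].
Qed.
Lemma tens_actM (A : comAlgType k) (g h : G2T p A) :
  tens_act (G2T_mul charp g h) = tens_act g *m tens_act h.
Proof. by rewrite /tens_act !actM tensmx_mul. Qed.
Lemma tens_act_map (A B : comAlgType k) (f : {lrmorphism A -> B}) (g : G2T p A) :
  tens_act (G2T_map f g) = map_mx f (tens_act g).
Proof. by rewrite /tens_act !act_map; apply/matrixP => i j; rewrite !mxE rmorphM. Qed.
Definition tens : mod := MkG2Tmod tens_act1 tens_actM tens_act_map.
End TensMod.

Section Steinberg.
Lemma St_act_map (A B : comAlgType k) (f : {lrmorphism A -> B}) (g : G2T p A) :
  symmx N.-1 (G2T_map f g) = map_mx f (symmx N.-1 g).
Proof. exact: symmx_map. Qed.
Definition St : mod := @MkG2Tmod k p charp N.-1.+1 (fun A g => symmx N.-1 g)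
  (fun A => symmx1 A N.-1) (fun A g h => symmxM N.-1 g h) St_act_map.

(** The invariant form on the (N-1)-st symmetric power. It pairs x^s y^(N-1-s) with x^(N-1-s) y^s by
    (-1)^s / binom(N-1, s), which is 1 modulo p. *)
Definition antidiag (A : comNzRingType) : 'M[A]_(N.-1.+1) :=
  \matrix_(i, j) (i + j == N.-1)%N%:R.

(** In these coordinates, the form of two polynomials is the coefficient of X^(N-1) in their
    product. *)
Lemma St_formE (A : comNzRingType) (g : 'M[A]_2) (s t : 'I_(N.-1.+1)) :
  ((symmx N.-1 g)^T *m antidiag A *m symmx N.-1 g) s t =
  (lin (g 0 0) (g 1 0) ^+ (s + t) * lin (g 0 1) (g 1 1) ^+ (N.-1.*2 - (s + t)))`_(N.-1).
Proof.
have hs := ltn_ord s; have ht := ltn_ord t; rewrite ltnS in hs; rewrite ltnS in ht.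
have -> : (N.-1.*2 - (s + t) = (N.-1 - s) + (N.-1 - t))%N by lia.
rewrite !exprD mulrACA coefM -mulmxA mxE; apply: eq_bigr => i _.
rewrite !mxE; congr (_ * _).
have hi : (N.-1 - i < N.-1.+1)%N by rewrite ltnS leq_subr.
rewrite (bigD1 (Ordinal hi)) //= big1 ?addr0 => [|j].
  have e : (i + (N.-1 - i) == N.-1)%N by rewrite subnKC // -ltnS.
  by rewrite !mxE /= e mul1r.
rewrite -val_eqE /= => hj; rewrite !mxE.
rewrite (_ : (_ == _) = false) ?mul0r //; apply/negP => /eqP e.
by move: hj; move: e; lia.
Qed.

Lemma coef_lin_pow (A : comNzRingType) (c d : A) n r :
  (lin c d ^+ n)`_r = c ^+ r * d ^+ (n - r) *+ 'C(n, r).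
Proof.
rewrite /lin addrC exprDn coef_sum.
case: (ltnP r n.+1) => hr; last first.
  rewrite bin_small // mulr0n big1 // => i _.
  rewrite coefMn exprZn -scalerAr coefZ -rmorphXn /= coefCM coefXn.
  rewrite (_ : (_ == _) = false) ?mulr0 ?mulr0 ?mul0rn //.
  by apply/eqP => e; have := ltn_ord i; lia.
rewrite (bigD1 (Ordinal hr)) //= big1 ?addr0 => [|i].
  rewrite coefMn exprZn -scalerAr coefZ -rmorphXn /= coefCM coefXn eqxx mulr1.
  by [].
rewrite -val_eqE /= => hi.
rewrite coefMn exprZn -scalerAr coefZ -rmorphXn /= coefCM coefXn eq_sym (negbTE hi).
by rewrite !mulr0 mul0rn.
Qed.

Lemma natr_alg0 (A : comAlgType k) n : n%:R = 0 :> k -> n%:R = 0 :> A.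
Proof. by move=> h; rewrite -(rmorph_nat (in_alg A)) h rmorph0. Qed.

(** For unipotent elements, the entries off the antidiagonal vanish by degree or contain a factor
    binom(N-1+j, j) with 0 < j < N, zero by [binN_0]. *)
Lemma St_form (A : comAlgType k) (g : G2T p A) :
  (act St g)^T *m antidiag A *m act St g = antidiag A.
Proof.
move: A g; apply: big_cell_ind => [A g h hg hh|A a ha|A a ha|A a b hab].
- rewrite actM trmx_mul; move: hg hh; move: (act St g) (act St h) (antidiag A) => G H J hg hh.
  by rewrite -[in RHS]hh -[in RHS]hg !mulmxA.
- apply/matrixP => s t; rewrite St_formE !mxE /=.
  have hs := ltn_ord s; have ht := ltn_ord t; rewrite ltnS in hs; rewrite ltnS in ht.
  have hx : (s + t <= N.-1.*2)%N by rewrite -addnn leq_add.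
  move: (s + t)%N hx => x hx {s t hs ht}.
  rewrite /lin scale1r addr0 coefXnM -/(lin a 1).
  case: ltngtP => h.
  + by [].
  + rewrite coef_lin_pow.
    have -> : (N.-1.*2 - x = N.-1 + (N.-1 - x))%N by lia.
    rewrite -mulr_natr (natr_alg0 A (binN_0 _ _)) ?mulr0 //; have := N0; lia.
  + rewrite h subnn coef_lin_pow expr0 mul1r expr1n bin0.
    by [].
- apply/matrixP => s t; rewrite St_formE !mxE /=.
  have hs := ltn_ord s; have ht := ltn_ord t; rewrite ltnS in hs; rewrite ltnS in ht.
  have hx : (s + t <= N.-1.*2)%N by rewrite -addnn leq_add.
  move: (s + t)%N hx => x hx {s t hs ht}.
  rewrite [X in _ * X ^+ _](_ : _ = 1) ?expr1n ?mulr1; last by rewrite /lin scale0r add0r.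
  rewrite coef_lin_pow expr1n mul1r.
  case: ltngtP => h.
  + by rewrite bin_small // mulr0n.
  + rewrite -bin_sub ?(ltnW h) //.
    have e : (x = N.-1 + (x - N.-1))%N by lia.
    rewrite {2}e -mulr_natr (natr_alg0 A (binN_0 _ _)) ?mulr0 //; have := N0; lia.
  + by rewrite h subnn expr0 binn.
- apply/matrixP => s t; rewrite St_formE !mxE /=.
  have hs := ltn_ord s; have ht := ltn_ord t; rewrite ltnS in hs; rewrite ltnS in ht.
  have hx : (s + t <= N.-1.*2)%N by rewrite -addnn leq_add.
  move: (s + t)%N hx => x hx {s t hs ht}.
  rewrite {1}/lin addr0 exprZn -scalerAl coefZ coefXnM.
  rewrite [X in X ^+ (_ - _)](_ : _ = b%:P); last by rewrite /lin scale0r add0r.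
  rewrite -rmorphXn /= coefC.
  case: ltngtP => h.
  + by rewrite mulr0.
  + by rewrite subn_eq0 leqNgt h /= mulr0.
  + rewrite h subnn /= -addnn addnK -exprMn hab expr1n.
    by [].
Qed.

(** Contraction of the two Steinberg factors by the invariant form. For projective M it splits, so M
    is a summand of M tensored twice with [St]. *)
Definition contract M : 'M[k]_(mdim M, mdim (tens (tens M St) St)) :=
  \matrix_(i, c) ((i == (mxtens_unindex (mxtens_unindex c).1).1)%:R *
    antidiag k (mxtens_unindex (mxtens_unindex c).1).2 (mxtens_unindex c).2).

Lemma contract_hom M : @is_hom _ _ charp (tens (tens M St) St) M (contract M).
Proof.
move=> A g; apply/matrixP => i c; have := St_form g => /=.
case: (mxtens_indexP c) => d t; case: (mxtens_indexP d) => i' s.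
move: (act M g) (symmx N.-1 g) => G H /matrixP/(_ s t).
rewrite !mxE => hf.
transitivity (G i i' * (s + t == N.-1)%N%:R).
  rewrite (bigD1 i') //= big1 ?addr0 => [|j hj].
    by rewrite !mxE !mxtens_indexK /= eqxx mul1r; case: (_ == _); rewrite ?scale1r ?scale0r.
  by rewrite !mxE !mxtens_indexK /= (negbTE hj) mul0r scale0r mulr0.
pose F (d : 'I_(mdim M * N.-1.+1)) (t' : 'I_(N.-1.+1)) : A :=
  ((i == (mxtens_unindex d).1)%:R * antidiag k (mxtens_unindex d).2 t')%:A *
    (G (mxtens_unindex d).1 i' * H (mxtens_unindex d).2 s * H t' t).
transitivity (\sum_(c < mdim M * N.-1.+1 * N.-1.+1) F (mxtens_unindex c).1 (mxtens_unindex c).2); last first.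
  by apply: eq_bigr => c' _; rewrite /F !mxE !mxtens_indexK.
rewrite sum_tens.
pose F' (i'' : 'I_(mdim M)) (s' : 'I_(N.-1.+1)) : A :=
  \sum_t' ((i == i'')%:R * antidiag k s' t')%:A * (G i'' i' * H s' s * H t' t).
transitivity (\sum_(d < mdim M * N.-1.+1) F' (mxtens_unindex d).1 (mxtens_unindex d).2); last by [].
rewrite sum_tens (bigD1 i) //= [X in _ + X]big1 ?addr0; last first.
  move=> j hj; rewrite big1 // => s' _; rewrite /F' big1 // => t' _.
  by rewrite eq_sym (negbTE hj) mul0r scale0r mul0r.
rewrite -hf mulr_sumr /F' [RHS]exchange_big /=; apply: eq_bigr => t' _.
rewrite mxE mulr_suml mulr_sumr; apply: eq_bigr => s' _.
rewrite !mxE eqxx mul1r; case: (_ == _); last by rewrite scale0r mulr0 !mul0r mulr0.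
by rewrite scale1r mulr1 mul1r mulrA.
Qed.

Lemma contract_onto M : exists C, contract M *m C = 1%:M.
Proof.
exists (\matrix_(c, i) ((i == (mxtens_unindex (mxtens_unindex c).1).1) &&
   ((mxtens_unindex (mxtens_unindex c).1).2 == ord0) && ((mxtens_unindex c).2 == ord_max))%:R).
apply/matrixP => i j; rewrite !mxE.
pose c0 := mxtens_index (mxtens_index (j, ord0 : 'I_(N.-1.+1)), ord_max : 'I_(N.-1.+1)).
rewrite (bigD1 c0) // big1 ?addr0.
  by rewrite !mxE /c0 !mxtens_indexK /= add0n !eqxx !mulr1 addr0.
move=> c; rewrite !mxE; case: (mxtens_indexP c) => d t; case: (mxtens_indexP d) => i' s.
rewrite !mxtens_indexK /=; case: (boolP (_ && _)) => // [/andP[/andP[/eqP <- /eqP ->] /eqP ->]|].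
  by rewrite eqxx.
by rewrite mulr0.
Qed.

(** This is the freeness of [St], hence of [tens Q St], over Dist(U^+_2), made explicit: a fixed
    vector is determined by its last component x_max, and it equals E_{N-1}(x_max tensor e_0). *)
Lemma opE_tens_fixed Q (xi : 'cV[k]_(mdim (tens Q St))) :
  (forall r, (0 < r)%N -> opE (tens Q St) r *m xi = 0) ->
  exists eta, xi = opE (tens Q St) N.-1 *m eta.
Proof.
move=> hxi.
pose hX := trXN (trunc2 charp).
have hXn : (- X) ^+ N = 0 by rewrite exprNn hX mulr0.
have hfix : act (tens Q St) (up charp hX) *m xi%:sc[R2] = xi%:sc[R2].
  rewrite act_up mulmx_suml (bigD1 (Ordinal N0)) //= big1 ?addr0.
    by rewrite mul_scale_sc1 opE0 mul1mx expr0 scale1r.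
  move=> i; rewrite -val_eqE /= => hi; rewrite mul_scale_sc1 hxi ?lt0n //.
  by rewrite map_mx0 scaler0.
have hinv : act Q (up charp hXn) *m act Q (up charp hX) = 1%:M.
  rewrite -actM -(act1 Q); apply: act_irr; rewrite /= mx2M -mx2_1.
  by apply: mx2P; rewrite ?mulr0 ?mul0r ?mulr1 ?mul1r ?addr0 ?add0r // subrr.
have sgn n : (-1) ^+ n = ((-1) ^+ n)%:A :> R2.
  by rewrite -[RHS]/(in_alg _ _) rmorphXn rmorphN1.
pose x (s : 'I_(N.-1.+1)) : 'cV[k]_(mdim Q) := \col_i xi (mxtens_index (i, s)) 0.
(* Invariance under u = up(X), with the action on Q moved to the other side: (1 tensor u) xi = (u^-1
   tensor 1) xi. The last component of this identity yields all x s. *)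
have h1 : (1%:M *t act St (up charp hX)) *m xi%:sc[R2] =
          (act Q (up charp hXn) *t 1%:M) *m xi%:sc[R2].
  rewrite -{2}hfix mulmxA; congr (_ *m _).
  by rewrite [act (tens Q St) _]/(_ *t _) tensmx_mul hinv mul1mx.
have hx s : x s = (-1) ^+ (N.-1 - s) *: (opE Q (N.-1 - s) *m x ord_max).
  apply/colP => i; rewrite 2!mxE.
  have hsN : (N.-1 - s < N)%N by rewrite (leq_ltn_trans (leq_subr _ _)) // prednK.
  have /matrixP/(_ (mxtens_index (i, ord_max)) 0) := h1.
  have -> : ((1%:M *t act St (up charp hX)) *m xi%:sc[R2]) (mxtens_index (i, ord_max)) 0 =
     \sum_(s' < N.-1.+1) X ^+ (N.-1 - s') * (xi (mxtens_index (i, s')) 0)%:A.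
    rewrite mxE.
    pose F i' s' : R2 := (i == i')%:R * symmx N.-1 (up charp hX) ord_max s' * (xi (mxtens_index (i', s')) 0)%:A.
    transitivity (\sum_(c < mdim Q * N.-1.+1) F (mxtens_unindex c).1 (mxtens_unindex c).2).
      apply: eq_bigr => c _; case: (mxtens_indexP c) => i' s'.
      by rewrite /F tensmxE !mxtens_indexK /= !mxE.
    rewrite sum_tens (bigD1 i) //= [X in _ + X]big1 ?addr0; last first.
      by move=> j hj; rewrite big1 // => s' _; rewrite /F eq_sym (negbTE hj) !mul0r.
    apply: eq_bigr => s' _; rewrite /F eqxx mul1r; congr (_ * _).
    rewrite !mxE /= /lin scale1r addr0 coefXnM ltnNge -ltnS ltn_ord /= -/(lin X 1).
    by rewrite coef_lin_pow expr1n mulr1 binn.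
  have -> : ((act Q (up charp hXn) *t 1%:M) *m xi%:sc[R2]) (mxtens_index (i, ord_max)) 0 =
     (act Q (up charp hXn) *m (x ord_max)%:sc[R2]) i 0.
    rewrite !mxE.
    pose F i' (s' : 'I_(N.-1.+1)) : R2 := act Q (up charp hXn) i i' * (ord_max == s')%:R * (xi (mxtens_index (i', s')) 0)%:A.
    transitivity (\sum_(c < mdim Q * N.-1.+1) F (mxtens_unindex c).1 (mxtens_unindex c).2).
      apply: eq_bigr => c _; case: (mxtens_indexP c) => i' s'.
      by rewrite /F tensmxE !mxtens_indexK /= !mxE.
    rewrite sum_tens; apply: eq_bigr => i' _.
    rewrite (bigD1 ord_max) //= big1 ?addr0.
      by rewrite /F eqxx mulr1 !mxE.
    by move=> s' hs'; rewrite /F eq_sym (negbTE hs') mulr0 mul0r.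
  move=> /(congr1 (coef2 (N.-1 - s) 0)).
  rewrite raddf_sum (bigD1 s) //= big1 ?addr0; last first.
    move=> s' hs'; rewrite mulr_algr linearZ /=.
    have := tr_mono R2 (N.-1 - s') 0 hsN N0; rewrite expr0 mulr1 => ->.
    rewrite andbT (_ : (_ == _) = false) ?scaler0 //.
    by apply/negP => /eqP e; move/eqP: hs'; apply; apply/val_inj => /=; have := ltn_ord s; have := ltn_ord s'; lia.
  rewrite mulr_algr linearZ /=.
  have := tr_mono R2 (N.-1 - s) 0 hsN N0; rewrite expr0 mulr1 => ->.
  rewrite !eqxx /= => e.
  transitivity ((map_mx (coef2 (N.-1 - s) 0) (act Q (up charp hXn) *m (x ord_max)%:sc[R2])) i 0).
    by rewrite [RHS]mxE -e; apply/esym/mulr1.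
  rewrite coefmx_mulr; suff -> : map_mx (coef2 (N.-1 - s) 0) (act Q (up charp hXn)) =
    (-1) ^+ (N.-1 - s) *: opE Q (N.-1 - s) by rewrite -scalemxAl mxE.
  rewrite act_up coefmx_sum (bigD1 (Ordinal hsN)) //= big1 ?addr0.
    rewrite (exprNn X) sgn mulr_algl coefmxZ linearZ /=.
    have := tr_mono R2 (N.-1 - s) 0 hsN N0; rewrite expr0 mulr1 => ->.
    by rewrite !eqxx /= [_ *: _%:R](mulr1 _).
  move=> r; rewrite -val_eqE /= => hr.
  rewrite (exprNn X) sgn mulr_algl coefmxZ linearZ /=.
  have := tr_mono R2 r 0 hsN N0; rewrite expr0 mulr1 => ->.
  by rewrite eq_sym (negbTE hr) /= scaler0 scale0r.
exists (\col_c (x ord_max (mxtens_unindex c).1 0 * ((mxtens_unindex c).2 == ord0)%:R)).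
set eta := (X in _ = _ *m X).
have hN1 : (N.-1 < N)%N by rewrite prednK.
apply/colP => c; case: (mxtens_indexP c) => i s.
have hs : (s < N)%N by rewrite -[X in (_ < X)%N](prednK N0) ltn_ord.
have -> : xi (mxtens_index (i, s)) 0 = x s i 0 by rewrite mxE.
rewrite hx.
have -> : opE (tens Q St) N.-1 *m eta =
   map_mx (coef2 N.-1 0) (act (tens Q St) (up charp hX) *m (eta : 'cV_(mdim (tens Q St)))%:sc[R2]).
  by rewrite coefmx_mulr.
rewrite [RHS]mxE.
have -> : (act (tens Q St) (up charp hX) *m (eta : 'cV_(mdim (tens Q St)))%:sc[R2]) (mxtens_index (i, s)) 0 =
    (X ^+ s *+ 'C(N.-1, s)) * (act Q (up charp hX) *m (x ord_max)%:sc[R2]) i 0.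
  rewrite !mxE.
  pose F i' (s' : 'I_(N.-1.+1)) : R2 := act Q (up charp hX) i i' * symmx N.-1 (up charp hX) s s' *
     (x ord_max i' 0 * (s' == ord0)%:R)%:A.
  transitivity (\sum_(c < mdim Q * N.-1.+1) F (mxtens_unindex c).1 (mxtens_unindex c).2).
    apply: eq_bigr => c' _; case: (mxtens_indexP c') => i' s'.
    by rewrite /F tensmxE !mxtens_indexK [(map_mx _ _) _ _]mxE [eta _ _]mxE !mxtens_indexK.
  rewrite sum_tens mulr_sumr; apply: eq_bigr => i' _.
  rewrite (bigD1 ord0) //= big1 ?addr0.
    rewrite /F eqxx mulr1 [(map_mx _ _) _ _]mxE /= mulrAC [LHS]mulrC; congr (_ * _).
    rewrite mxE /= expr0 mul1r subn0 !mxE /= coef_lin_pow expr1n mulr1.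
    by [].
  by move=> s' hs'; rewrite /F (negbTE hs') mulr0 scale0r mulr0.
rewrite act_up mulmx_suml summxE mulr_sumr raddf_sum.
have hsN : (N.-1 - s < N)%N by rewrite (leq_ltn_trans (leq_subr _ _)) // prednK.
have term (r : nat) : coef2 N.-1 0 (X ^+ s *+ 'C(N.-1, s) * (X ^+ r *: (opE Q r)%:sc[R2] *m (x ord_max)%:sc[R2]) i 0) =
   (N.-1 == s + r)%N%:R * ('C(N.-1, s)%:R * (opE Q r *m x ord_max) i 0).
  rewrite mul_scale_sc1; move: (opE Q r *m x ord_max) => U.
  have -> : (X ^+ r *: U%:sc[R2]) i 0 = X ^+ r * (U i 0)%:A by rewrite 2!mxE.
  rewrite mulrnAl mulrA -exprD -mulrnAl -mulr_natl -(rmorph_nat (in_alg R2)) /= -mulrA.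
  rewrite mulr_algl mulr_algr scalerA linearZ /=.
  have := tr_mono R2 (s + r) 0 hN1 N0; rewrite expr0 mulr1 => ->.
  rewrite andbT; exact: mulrC.
rewrite (bigD1 (Ordinal hsN)) //= big1 ?addr0.
  rewrite term subnKC ?eqxx ?mul1r; last by rewrite -ltnS prednK.
  rewrite mxE binN1 //; congr (_ * _).
  (* This avoids a case distinction on the parity of p: the sign is binom(N-1, N-1). *)
  have h1N : (-1) ^+ N.-1 = 1 :> k by rewrite -binN1 // binn.
  have hsl : (s <= N.-1)%N by rewrite -ltnS prednK.
  have e1 : (-1) ^+ (N.-1 - s) * (-1) ^+ s = 1 :> k by rewrite -exprD subnK.
  have e2 : (-1) ^+ s * (-1) ^+ s = 1 :> k.
    by rewrite -exprD addnn -mul2n exprM sqrrN !expr1n.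
  transitivity ((-1) ^+ (N.-1 - s) * (-1) ^+ s * (-1) ^+ s : k); last by rewrite e1 mul1r.
  by rewrite -mulrA e2 mulr1.
move=> r; rewrite -val_eqE /= => hr; rewrite term (_ : (_ == _) = false) ?mul0r //.
apply/negP => /eqP e; move/eqP: hr; apply. by move: e; move: (nat_of_ord s) (nat_of_ord r) => s1 r1 e; rewrite (_ : N.-1 = s1 + r1)%N ?addKn.
Qed.

(** A section of [contract Q] embeds Q into a module of the form tens (_) St, to which
    [opE_tens_fixed] applies; the top weight space is killed by all E_r with r > 0. *)
Lemma projective_top Q m (x : 'cV[k]_(mdim Q)) : projective Q ->
  (forall n, wproj Q n != 0 -> n <= m) -> wproj Q m *m x = x ->
  exists y, x = opE Q N.-1 *m y.
Proof.
move=> hQ htop hx.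
have [C hC] := contract_onto Q.
have hsurj : surjective_mx (contract Q).
  by move=> w; exists (C *m w); rewrite mulmxA hC mul1mx.
have [h [hh eh]] := hQ _ _ _ _ (contract_hom Q) hsurj (hom_id Q).
have [eta heta] : exists eta, h *m x = opE (tens (tens Q St) St) N.-1 *m eta.
  apply: opE_tens_fixed => r r0; rewrite mulmxA [_ *m h](is_hom_op hh (OE r)) -mulmxA /=.
  rewrite -(opE_wtv r hx); have [->|/htop] := eqVneq (wproj Q (m + (r.*2)%:Z)) 0.
    by rewrite mul0mx mulmx0.
  by lia.
exists (contract Q *m eta).
rewrite mulmxA -[_ *m contract Q]/(op Q (OE N.-1) *m contract Q) (is_hom_op (contract_hom Q)) /=.
by rewrite -mulmxA -heta mulmxA eh mul1mx.
Qed.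
End Steinberg.
End Tensor.

(** * Indecomposables of the principal block *)

Lemma col_neq0 (R : nmodType) m n (T : 'M[R]_(m, n)) : T != 0 -> exists j, col j T != 0.
Proof.
move=> T0; apply: contrapT => hno; case/eqP: T0; apply/matrixP => i j.
have /colP/(_ i) : col j T = 0 by apply/eqP/negPn/negP => h; apply: hno; exists j.
by rewrite !mxE.
Qed.

Section Classification.
Variables (k : closedFieldType) (p : nat) (charp : p \in [pchar k]).
Local Notation N := (p ^ 2)%N.
Local Notation mod := (G2Tmod charp).
Local Notation kk := (k^o : comAlgType k).
Local Notation wt M i := (i%:Z - (wbound M)%:Z).
Local Notation wK M := ((wbound M).*2.+1).
Implicit Types M L Q P : mod.
Let N0 : (0 < N)%N := N_gt0 charp.

Lemma wproj_ext M m (U V : 'M[k]_(m, mdim M)) :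
  (forall n, U *m wproj M n = V *m wproj M n) -> U = V.
Proof.
move=> h; rewrite -[U]mulmx1 -[V]mulmx1 -(wproj_sum M) !mulmx_sumr.
by apply: eq_bigr => i _; rewrite h.
Qed.

Lemma is_weight_wproj M n : is_weight M n -> exists2 v : 'cV[k]_(mdim M), v != 0 & wproj M n *m v = v.
Proof.
case=> v v0 hv; exists v => //.
rewrite (@wt_projE _ _ _ M n 1 v) ?eqxx ?scale1r // => c hc.
have := hv kk (tor charp (unitVr hc)).
rewrite sc_id act_rho => -> //.
  congr (_ *: _); rewrite /= tch_tchar !mxE /=.
  by case: (n) => q //=; rewrite NegzE /exprz exprVn.
by rewrite /is_torus /= diag_mx2 !eqxx det_mx2 mulr0 subr0 (unitVr hc) eqxx.
Qed.

Lemma is_weight_wproj0 M n : is_weight M n -> wproj M n != 0.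
Proof.
by move=> /is_weight_wproj[v v0 hv]; apply: contra v0 => /eqP h; rewrite -hv h mul0mx.
Qed.

Lemma wproj_is_weight M n : wproj M n != 0 -> is_weight M n.
Proof.
move=> /col_neq0[j hj].
exists (col j (wproj M n)) => // A t ht.
have [a [b [hab et]]] : exists a b (hab : a * b = 1), t = tor charp hab :> G2T p A.
  case: t ht => t tP /=; rewrite {1}(mx2_eta t) /is_torus diag_mx2 det_mx2.
  move=> /andP[/andP[/eqP h1 /eqP h2] /eqP h3].
  rewrite h1 h2 mulr0 subr0 in h3.
  by exists (t 0 0), (t 1 1), h3; apply: G2T_ext; rewrite /= [LHS]mx2_eta h1 h2.
rewrite et (act_tor_wt hab (n := n)).
  by congr (_ *: _); rewrite tch_tchar /= !mxE.
by rewrite colE mulmxA wprojM eqxx scale1r.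
Qed.

Lemma highest_weight_top M m : highest_weight M m -> forall n, wproj M n != 0 -> n <= m.
Proof. by move=> [_ h] n /wproj_is_weight/h. Qed.

Lemma idem_trivial_tau M : idem_trivial M -> idem_trivial (tau_dual M).
Proof.
move=> h e he ee; have he' : @is_hom _ _ charp M M e^T.
  apply/hom_op => o; apply: trmx_inj; rewrite !trmx_mul trmxK.
  by have := is_hom_op he (oswap o); rewrite op_tau oswapK.
have ee' : e^T *m e^T = e^T by rewrite -trmx_mul ee.
case: (h _ he' ee') => e0; [left|right]; rewrite -[e]trmxK e0.
  by rewrite trmx0.
by rewrite trmx1.
Qed.

(** F_{N-1} on the dual is the transpose of E_{N-1} on P. If it killed v, then v would vanish on the
    top weight space of P, which lies in the image of E_{N-1} by [projective_top]. *)
Lemma tau_hull P m : projective P -> idem_trivial P -> highest_weight P m ->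
  exists v, @hull _ _ charp (tau_dual P) m v.
Proof.
move=> hP hi hm; have htop := highest_weight_top hm.
have hw := is_weight_wproj0 hm.1.
have [j hj] : exists j, col j (wproj P m)^T != 0 by apply: col_neq0; rewrite trmx_eq0.
exists (col j (wproj P m)^T).
have hv : (wproj P m)^T *m col j (wproj P m)^T = col j (wproj P m)^T.
  by rewrite colE mulmxA -trmx_mul wprojM eqxx scale1r.
split.
- exact: projective_tau_injective.
- exact: idem_trivial_tau.
- by rewrite wproj_tau.
- move=> n; rewrite wproj_tau => h; apply: htop; apply: contra h => /eqP ->.
  by rewrite trmx0.
- rewrite opF_tau; apply: contra hj => /eqP h.
  set v := col _ _ in hv h *.
  have z i : v^T *m col i (wproj P m) = 0.
    have hc : wproj P m *m col i (wproj P m) = col i (wproj P m).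
      by rewrite colE mulmxA wprojM eqxx scale1r.
    have [y ->] := projective_top hP htop hc.
    by rewrite mulmxA -[v^T *m _]trmxK trmx_mul trmxK h trmx0 mul0mx.
  apply/eqP; apply: trmx_inj; rewrite trmx0 -hv trmx_mul trmxK; apply/rowP => i.
  by have /matrixP/(_ 0 0) := z i; rewrite colE mulmxA -colE [LHS]mxE => ->; rewrite !mxE.
Qed.

(** A nonzero kernel would be a submodule, and so would contain F_{N-1} v. *)
Lemma hull_hom_inj Q m v L (h : 'M[k]_(mdim L, mdim Q)) : @hull _ _ charp Q m v ->
  is_hom h -> h *m (opF Q N.-1 *m v) != 0 -> exists C, C *m h = 1%:M.
Proof.
move=> hQ hh hw; pose B := (kermx h^T)^T.
have hB : h *m B = 0.
  by apply: trmx_inj; rewrite trmx_mul trmxK trmx0 mulmx_ker.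
have B0 : B = 0.
  apply/eqP; apply/negPn/negP => B0.
  have [o|c hc] := hull_meet hQ B0; last by rewrite hc mulmxA hB mul0mx eqxx in hw.
  have : ((op Q o *m B)^T <= kermx h^T)%MS.
    by apply/sub_kermxP; rewrite -trmx_mul mulmxA -(is_hom_op hh) -mulmxA hB mulmx0 trmx0.
  case/submxP => D hD; exists D^T; apply: trmx_inj; rewrite hD trmx_mul trmxK.
  by rewrite trmxK.
have : row_free h^T by rewrite -kermx_eq0 -trmx_eq0 -/B B0.
by move=> /row_freeP[C hC]; exists C^T; apply: trmx_inj; rewrite trmx_mul trmxK hC trmx1.
Qed.

Lemma hull_map Q Q' m v v' : @hull _ _ charp Q m v -> @hull _ _ charp Q' m v' ->
  exists h : 'M[k]_(mdim Q', mdim Q), [/\ is_hom h & exists C, C *m h = 1%:M].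
Proof.
move=> hQ hQ'.
have [C hC] := linv_of_inj (Fmx_inj hQ).
have s1 := sing_op (top_singular hQ (hull_wt hQ)).
have s2 := sing_op (top_singular hQ' (hull_wt hQ')).
have [h [hh eh]] := injective_extend (hull_inj hQ') hC s1 s2.
exists h; split=> //; apply: (hull_hom_inj hQ hh).
have e z : Fmx z *m delta_mx (Ordinal (etrans (ltn_predL N) N0)) 0 = opF Q N.-1 *m z.
  by rewrite -colE col_Fmx.
have e' z : Fmx z *m delta_mx (Ordinal (etrans (ltn_predL N) N0)) 0 = opF Q' N.-1 *m z.
  by rewrite -colE col_Fmx.
by rewrite -e mulmxA eh e' (hull_low hQ').
Qed.

(** The two hulls embed in each other. The injective endomorphism h' h is invertible, so h splits,
    and the nonzero idempotent h g must be 1. *)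
Lemma hull_unique Q Q' m v v' : @hull _ _ charp Q m v -> @hull _ _ charp Q' m v' ->
  isomorphic Q Q'.
Proof.
move=> hQ hQ'.
have [h [hh [C hC]]] := hull_map hQ hQ'.
have [h' [hh' [C' hC']]] := hull_map hQ' hQ.
have hu : h' *m h \in unitmx.
  by have [] := @mulmx1_unit _ _ (C *m C') (h' *m h); rewrite // -mulmxA [C' *m _]mulmxA hC' mul1mx.
pose g := invmx (h' *m h) *m h'.
have hg : @is_hom _ _ charp Q' Q g.
  by apply: hom_comp => //; apply: hom_invertible => //; apply: hom_comp.
have gh : g *m h = 1%:M by rewrite /g -mulmxA mulVmx.
exists h; split=> //; exists g; split=> //.
have he : @is_hom _ _ charp Q' Q' (h *m g) by apply: hom_comp.
have ee : (h *m g) *m (h *m g) = h *m g.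
  by rewrite mulmxA -[h *m g *m h]mulmxA gh mulmx1.
case: (hull_ind hQ' he ee) => // e0; have h0 : h = 0 by rewrite -[h]mulmx1 -gh mulmxA e0 mul0mx.
by have := hull_low hQ; rewrite -[opF _ _ *m _]mul1mx -gh h0 mulmx0 mul0mx eqxx.
Qed.

(* Four times the Casimir element of sl_2, up to an additive constant. *)
Definition cartan2 M : 'M[k]_(mdim M) :=
  \sum_(i < wK M) ((wt M i) * (wt M i + 2))%:~R *: wproj M (wt M i).
Definition casimir M : 'M[k]_(mdim M) := 4%:R *: (opF M 1 *m opE M 1) + cartan2 M.

Lemma cartan2_wt M n m (x : 'M[k]_(mdim M, m)) : wproj M n *m x = x ->
  cartan2 M *m x = (n * (n + 2))%:~R *: x.
Proof.
move=> hx; transitivity (\sum_(i < wK M) (n * (n + 2))%:~R *: (wproj M (wt M i) *m x)).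
  rewrite mulmx_suml; apply: eq_bigr => i _; rewrite -scalemxAl (wproj_wtv _ hx).
  by case: eqP => [->|]; rewrite ?scale0r ?scaler0.
by rewrite -scaler_sumr -mulmx_suml wproj_sum mul1mx.
Qed.

Lemma casimir_wt M n m (x : 'M[k]_(mdim M, m)) : wproj M n *m x = x ->
  casimir M *m x = 4%:R *: (opF M 1 *m (opE M 1 *m x)) + (n * (n + 2))%:~R *: x.
Proof. by move=> hx; rewrite mulmxDl (cartan2_wt hx) -scalemxAl mulmxA. Qed.

Lemma casimir_tau M : casimir (tau_dual M) = (casimir M)^T.
Proof.
rewrite /casimir opE_tau opF_tau -trmx_mul [RHS]linearD linearZ /=; congr (_ + _).
apply: (@wproj_ext (tau_dual M)) => n.
have h0 L : wproj L n *m wproj L n = wproj L n by rewrite wprojM eqxx scale1r.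
rewrite (@cartan2_wt (tau_dual M) n _ _ (h0 _)) wproj_tau -trmx_mul.
have -> : wproj M n *m cartan2 M = cartan2 M *m wproj M n.
  rewrite mulmx_sumr mulmx_suml; apply: eq_bigr => i _.
  rewrite -scalemxAr -scalemxAl !wprojM eq_sym.
  by case: eqP => [->|]; rewrite ?scale0r ?scaler0.
by rewrite (cartan2_wt (h0 M)) linearZ.
Qed.

Lemma natr_zres (n : int) : (zres N n)%:R = n%:~R :> k.
Proof.
have NZ : N%:Z != 0 by have := N0; lia.
have e : (zres N n)%:Z = (n %% N%:Z)%Z by rewrite /zres gez0_abs ?modz_ge0.
have Nk : N%:R = 0 :> k by rewrite -mulnn natrM (pcharf0 charp) mul0r.
have e1 : n = (n %/ N%:Z)%Z * N%:Z + (zres N n)%:Z by rewrite e -divz_eq.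
move: (zres N n) ((n %/ N%:Z)%Z) e1 => z q ->.
by rewrite rmorphD rmorphM /= [X in _ * X](_ : _ = 0) ?mulr0 ?add0r // -[RHS]Nk.
Qed.

(** Commuting F_1 past E_r produces r (n + r + 1) E_r on weight n. Four times this compensates the
    change of n (n + 2) under n |-> n + 2r. *)
Lemma casimir_opE M r : casimir M *m opE M r = opE M r *m casimir M.
Proof.
apply: wproj_ext => n; rewrite -!mulmxA.
have [v ev] : exists v, wproj M n = v by exists (wproj M n).
have hw : wproj M n *m v = v by rewrite -ev wprojM eqxx scale1r.
rewrite ev {ev}.
case: (ltnP r N) => hr; last by rewrite opE_ge // mul0mx mul0mx mulmx0.
rewrite (casimir_wt hw) (casimir_wt (opE_wtv r hw)) mulmxDr -!scalemxAr.
have h1 := opE_wtv 1 hw.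
rewrite (kostant hr (N_gt1 charp) h1).
case: r hr => [|r] hr.
  rewrite (big_pred1 (Ordinal N0)) => [|j]; last by rewrite /= -val_eqE /=; case: (j : nat).
  by rewrite /= bin0 scale1r !opE0 !mul1mx addr0.
rewrite (bigD1 (Ordinal N0)) //= (big_pred1 (Ordinal (N_gt1 charp))) => [|j]; last first.
  by rewrite /= -!val_eqE /=; case: (j : nat) => [|[|?]] //=; rewrite andbF.
rewrite /= bin0 scale1r bin1 !subn0 subnn opF0 mul1mx subn1 /=.
rewrite scalerDr -[RHS]addrA; congr (_ + _).
  by rewrite [opE M 1 *m (opE M r.+1 *m v)]mulmxA [opE M r.+1 *m (opE M 1 *m v)]mulmxA !opEM add1n addn1 bin1 binSn.
rewrite [opE M r *m (opE M 1 *m v)]mulmxA opEM addn1 -scalemxAl !scalerA -scalerDl; congr (_ *: _).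
rewrite natr_zres binSn.
have e4 : 4%:R = (4%:Z)%:~R :> k by [].
have er : r.+1%:R = (r.+1%:Z)%:~R :> k by [].
rewrite e4 er -!rmorphM -rmorphD; congr (_%:~R); rewrite /= -!mul2n !PoszM; lia.
Qed.

Lemma casimir_hom M : @is_hom _ _ charp M M (casimir M).
Proof.
apply/hom_op => -[r|r|n] /=.
- by rewrite casimir_opE.
- have := casimir_opE (tau_dual M) r; rewrite casimir_tau opE_tau -!trmx_mul.
  by move/trmx_inj => ->.
- have h0 i : wproj M i *m wproj M i = wproj M i by rewrite wprojM eqxx scale1r.
  have h1 := opE_wtv 1 (h0 n); have := opF_wtv 1 h1; rewrite addrK => h2.
  rewrite (casimir_wt (h0 n)) mulmxDr; congr (_ + _).
    rewrite -scalemxAr; congr (_ *: _).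
    apply: wproj_ext => i; rewrite -!mulmxA.
    have h3 := opF_wtv 1 (opE_wtv 1 (h0 i)); rewrite addrK in h3.
    rewrite (wproj_wtv n h3) wprojM.
    by case: (eqVneq n i) => [<-|hni]; rewrite ?scale1r ?scale0r ?mulmx0.
  rewrite mulmx_sumr.
  transitivity (\sum_(i < wK M) (wt M i * (wt M i + 2))%:~R *: (wproj M (wt M i) *m wproj M n)).
    apply: eq_bigr => i _; rewrite -scalemxAr !wprojM eq_sym.
    by case: eqP => [->|]; rewrite ?scale0r.
  transitivity (cartan2 M *m wproj M n); last exact: cartan2_wt.
  by rewrite mulmx_suml; apply: eq_bigr => i _; rewrite -scalemxAl.
Qed.

Lemma rho_hom M c : c != 0 -> c ^+ 2 = 1 -> @is_hom _ _ charp M M (rho M c).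
Proof.
move=> hc c2; have h0 i : wproj M i *m wproj M i = wproj M i by rewrite wprojM eqxx scale1r.
have c2n (r : nat) : c ^ ((r.*2)%:Z) = 1 by rewrite -mul2n -exprnP exprM c2 expr1n.
apply/hom_op => -[r|r|n] /=; apply: wproj_ext => i; rewrite -!mulmxA rho_wproj // -scalemxAr.
- by rewrite (rho_wt hc (opE_wtv r (h0 i))) expfzDr // c2n mulr1.
- by rewrite (rho_wt hc (opF_wtv r (h0 i))) expfzDr // -[c ^ (- _)]invr_expz c2n invr1 mulr1.
- by rewrite wprojM -scalemxAr rho_wproj // !scalerA mulrC.
Qed.

(* The Casimir element and the central element -1 are enough to cut out the
   highest weights lam p j of the principal block. *)
Definition in_block M : Prop :=
  (exists a, iter a (mulmx (casimir M)) 1%:M = 0) /\ rho M (-1) = 1%:M.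

Hypothesis hp : (2 < p)%N.

Lemma two_neq0 : 2%:R != 0 :> k.
Proof. by rewrite (nat_eq0 charp); apply/negP => /dvdn_leq h; have := h isT; lia. Qed.

(** Since p is odd, (1 + rho(-1))/2 is an idempotent endomorphism. *)
Lemma rho_m1 P : idem_trivial P -> rho P (-1) = 1%:M \/ rho P (-1) = - 1%:M.
Proof.
move=> hP; have n1 : -1 != 0 :> k by rewrite oppr_eq0 oner_neq0.
have s1 : (-1) ^+ 2 = 1 :> k by rewrite sqrrN expr1n.
have hh := rho_hom P n1 s1.
have rr : rho P (-1) *m rho P (-1) = 1%:M by rewrite -rhoM // mulrNN mulr1 rho1.
move: (rho P (-1)) hh rr => g hh rr.
pose e := 2%:R^-1 *: (1%:M + g).
have he : @is_hom _ _ charp P P e.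
  by apply: hom_scale; apply: hom_add => //; apply: hom_id.
have ge : g = 2%:R *: e - 1%:M.
  by rewrite /e scalerA mulfV ?two_neq0 // scale1r addrC addKr.
have ee : e *m e = e.
  rewrite {1}/e -scalemxAl mulmxDl mul1mx /e -scalemxAr mulmxDr mulmx1 rr.
  rewrite [g + _]addrC -mulr2n -scaler_nat scalerA mulVf ?two_neq0 // scale1r.
  by [].
by case: (hP e he ee) => e0; [right|left]; rewrite ge e0 ?scaler0 ?sub0r // scaler_nat mulr2n addrK.
Qed.

(** By Fitting, the Casimir element is nilpotent or invertible on P. It commutes with f and is
    nilpotent on M, so invertibility would force f = 0; the sign of -1 on P is fixed in the same
    way. *)
Lemma in_block_from P M (f : 'M[k]_(mdim M, mdim P)) : idem_trivial P -> in_block M ->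
  is_hom f -> f != 0 -> in_block P.
Proof.
move=> hP [[a ha] hr] hf f0.
have hcf : casimir M *m f = f *m casimir P.
  have h0 i : wproj M i *m wproj M i = wproj M i by rewrite wprojM eqxx scale1r.
  apply: wproj_ext => n; rewrite -!mulmxA.
  have h0' i : wproj P i *m wproj P i = wproj P i by rewrite wprojM eqxx scale1r.
  rewrite (casimir_wt (h0' n)).
  have hx : wproj M n *m (f *m wproj P n) = f *m wproj P n.
    by rewrite mulmxA [wproj M n *m f](is_hom_op hf (OW n)) -mulmxA h0'.
  rewrite (casimir_wt hx) mulmxDr -!scalemxAr; congr (_ *: _ + _).
  rewrite [opE M 1 *m _]mulmxA [opE M 1 *m f](is_hom_op hf (OE 1)) -mulmxA.
  by rewrite mulmxA [opF M 1 *m f](is_hom_op hf (OF 1)) -mulmxA.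
split.
  case: (fitting hP (casimir_hom P)) => // hu; exfalso; move/eqP: f0; apply.
  have e b : iter b (mulmx (casimir M)) 1%:M *m f = f *m iter b (mulmx (casimir P)) 1%:M.
    by elim: b => [|b IH] /=; rewrite ?mul1mx ?mulmx1 // -mulmxA IH mulmxA hcf -mulmxA.
  have := e a; rewrite ha mul0mx => /esym h.
  have u : iter a (mulmx (casimir P)) 1%:M \in unitmx.
    by elim: a {ha e h} => [|b IH] /=; rewrite ?unitmx1 // unitmx_mul hu IH.
  by rewrite -[f](mulmxK u) h mul0mx.
case: (rho_m1 hP) => // h; exfalso; move/eqP: f0; apply.
have n1 : -1 != 0 :> k by rewrite oppr_eq0 oner_neq0.
have : rho M (-1) *m f = f *m rho P (-1).
  have := hf kk (tor charp (unitVr n1)); rewrite !act_rho sc_id.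
  by [].
rewrite hr h mul1mx mulmxN mulmx1 => /eqP; rewrite -addr_eq0 -mulr2n -scaler_nat scaler_eq0.
by rewrite (negbTE two_neq0) => /eqP.
Qed.

Lemma iter_tr n (f : 'M[k]_n) a : iter a (mulmx f^T) 1%:M = (iter a (mulmx f) 1%:M)^T.
Proof.
elim: a => [|a IH] /=; first by rewrite trmx1.
rewrite IH -trmx_mul; congr (_^T).
by elim: a {IH} => [|a IH] /=; rewrite ?mulmx1 ?mul1mx // -mulmxA IH.
Qed.

Lemma in_block_tau M : in_block M <-> in_block (tau_dual M).
Proof.
have n1 : -1 != 0 :> k by rewrite oppr_eq0 oner_neq0.
split=> -[[a ha] hr]; split.
- by exists a; rewrite casimir_tau iter_tr ha trmx0.
- by rewrite rho_tau // hr trmx1.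
- by exists a; apply: trmx_inj; rewrite -iter_tr -casimir_tau ha trmx0.
- by apply: trmx_inj; rewrite -rho_tau // hr trmx1.
Qed.

Lemma in_block_to P M (f : 'M[k]_(mdim P, mdim M)) : idem_trivial P -> in_block M ->
  is_hom f -> f != 0 -> in_block P.
Proof.
move=> hP hM hf f0; apply/in_block_tau.
apply: (in_block_from (idem_trivial_tau hP) (proj1 (in_block_tau M) hM) (hom_tr hf)).
by rewrite -trmx0 (inj_eq trmx_inj).
Qed.

Lemma wproj_eq M n : (forall c, c != 0 -> rho M c = (c ^ n)%:M) -> wproj M n = 1%:M.
Proof.
move=> h; rewrite -[LHS]mulmx1 (@wt_projE _ _ _ M n _ 1%:M) ?eqxx ?scale1r // => c hc.
by rewrite h // mulmx1 scalemx1.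
Qed.

Lemma triv_block : in_block (triv charp).
Proof.
have hr c : c != 0 -> rho (triv charp) c = 1%:M.
  by move=> hc; rewrite -(act_rho _ hc).
have n1 : -1 != 0 :> k by rewrite oppr_eq0 oner_neq0.
split; last exact: hr.
exists 1%N; rewrite /= mulmx1.
have w0 : wproj (triv charp) 0 *m 1%:M = 1%:M.
  by rewrite mulmx1; apply: wproj_eq => c hc; rewrite hr // expr0z.
have e1 : opE (triv charp) 1 = 0.
  apply/matrixP => i j; rewrite !mxE /=.
  have := tr_mono (trunc2 charp) 0 0 (N_gt1 charp) N0; rewrite !expr0 mulr1 => h.
  by case: (_ == _); rewrite ?linear0.
by rewrite -[casimir _]mulmx1 (casimir_wt w0) e1 mul0mx !mulmx0 scaler0 mul0r scale0r addr0.
Qed.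

Lemma principal_spec P : principal P -> [/\ projective P, indecomposable P & in_block P].
Proof.
have it Q : indecomposable Q -> idem_trivial Q by move=> h e; apply: indecomposable_idem.
elim=> [Q f hQ iQ hf f0|Q1 Q f _ [_ _ hb] hQ iQ hf f0|Q1 Q f _ [_ _ hb] hQ iQ hf f0]; split=> //.
- exact: (in_block_from (it _ iQ) triv_block hf f0).
- exact: (in_block_to (it _ iQ) hb hf f0).
- exact: (in_block_from (it _ iQ) hb hf f0).
Qed.

Lemma highest_weight_exists M : (0 < mdim M)%N -> exists m, highest_weight M m.
Proof.
move=> M0.
have [i0 hi0] : exists i : 'I_(wK M), wproj M (wt M i) != 0.
  apply: contrapT => hno.
  have : (1%:M : 'M[k]_(mdim M)) = 0.
    rewrite -wproj_sum big1 // => i _; apply/eqP; apply/negPn/negP => h; apply: hno.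
    by exists i.
  by move=> /matrixP/(_ (Ordinal M0) (Ordinal M0)); rewrite !mxE eqxx => /eqP; rewrite oner_eq0.
case: (@arg_maxnP _ i0 (fun i => wproj M (wt M i) != 0) (fun i => i : nat) hi0) => i hi hmax.
exists (wt M i); split; first exact: wproj_is_weight.
move=> n /is_weight_wproj0 hn.
case: (boolP ((n < - (wbound M)%:Z) || ((wbound M)%:Z < n))) => h.
  by rewrite wproj_out ?eqxx in hn.
have hj : (absz (n + (wbound M)%:Z)%R < wK M)%N by lia.
have e : (absz (n + (wbound M)%:Z))%:Z - (wbound M)%:Z = n by lia.
have := hmax (Ordinal hj); rewrite /= e => /(_ hn); lia.
Qed.

(** On a highest weight vector the Casimir element acts by m (m + 2), so p divides m or m + 2; the
    central element -1 makes m even. As p is odd, these are the values of [lam]. *)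
Lemma block_weight M m : in_block M -> highest_weight M m -> exists j, m = lam p j.
Proof.
move=> [[a ha] hr] hm.
have [v v0 hv] := is_weight_wproj hm.1.
have n1 : -1 != 0 :> k by rewrite oppr_eq0 oner_neq0.
have E0 : opE M 1 *m v = 0.
  rewrite -(opE_wtv 1 hv).
  have [->|/(highest_weight_top hm)] := eqVneq (wproj M (m + (1.*2)%:Z)) 0; first by rewrite mul0mx.
  by lia.
have hc : casimir M *m v = (m * (m + 2))%:~R *: v.
  by rewrite (casimir_wt hv) E0 mulmx0 scaler0 add0r.
have c0 : (m * (m + 2))%:~R = 0 :> k.
  apply/eqP; apply: contraT => c0.
  have e b : iter b (mulmx (casimir M)) 1%:M *m v = (m * (m + 2))%:~R ^+ b *: v.
    elim: b => [|b IH] /=; first by rewrite mul1mx expr0 scale1r.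
    by rewrite -mulmxA IH -scalemxAr hc scalerA -exprSr.
  have /eqP := e a; rewrite ha mul0mx eq_sym scaler_eq0 expf_eq0 (negbTE c0) andbF /=.
  by rewrite (negbTE v0).
have m2 : (2%:Z %| m)%Z.
  have := rho_wt n1 hv; rewrite hr mul1mx => hm1.
  have : ((-1) ^ m - 1) *: v = 0 by rewrite scalerBl scale1r -hm1 subrr.
  move/eqP; rewrite scaler_eq0 (negbTE v0) orbF subr_eq0 => h.
  have [q [r [em hr2]]] : exists q r : int, m = q * 2 + r /\ (r = 0 \/ r = 1).
    exists (m %/ 2)%Z, (m %% 2)%Z; split; first exact: divz_eq.
    have := modz_ge0 m (isT : 2%:Z != 0); have := ltz_pmod m (isT : 0 < 2%:Z); lia.
  case: hr2 => r0; first by rewrite em r0 addr0 dvdz_mull.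
  move: h; rewrite em r0 expfzDr // [q * 2]mulrC -exprz_exp expr1z.
  have -> : (-1) ^ (2 : int) = 1 :> k by rewrite -exprnP sqrrN expr1n.
  rewrite exp1rz mul1r eq_sym -addr_eq0 => /eqP h; exfalso; move/eqP: two_neq0; apply.
  by rewrite -[RHS]h -mulr2n.
have [j0 hj0] : exists h : int, p%:Z = 2 * h + 1.
  have po : odd p by apply/negPn/negP => /(prime_oddPn (p_pr charp)) e; move: hp; rewrite e.
  by exists (p./2)%:Z; have := odd_double_half p; rewrite po; lia.
have dv x : (p%:Z %| x)%Z -> (2%:Z %| x)%Z -> exists j, x = j * p%:Z /\ (2%:Z %| j)%Z.
  move=> /dvdzP[c ->] /dvdzP[b hb]; exists c; split=> //; apply/dvdzP.
  by exists (b - j0 * c); rewrite hj0 in hb; lia.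
move/eqP: c0; rewrite intrM mulf_eq0 -!(dvdz_pcharf charp) => /orP[h|h].
  have [j [-> hj]] := dv _ h m2; exists j; rewrite /lam hj.
  by [].
have m2' : (2%:Z %| m + 2)%Z by apply: rpredD.
have [j [ej hj]] := dv _ h m2'; exists (j - 1).
rewrite /lam ifF ?subrK -?ej ?addrK //; apply/negP => h1.
have : (2%:Z %| j - (j - 1))%Z by apply: rpredB.
by rewrite opprB addrC subrK.
Qed.
End Classification.

(** * Decomposition of objects of the block into the P_i *)

Section Decomposition.
Variables (k : closedFieldType) (p : nat) (charp : p \in [pchar k]).
Hypothesis hp : (2 < p)%N.
Local Notation N := (p ^ 2)%N.
Local Notation mod := (G2Tmod charp).
Implicit Types M L Q S : mod.

(** [is_summand] without the complement, which [retract_summand] recovers from the idempotent 1 - b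
    c. In this form transitivity is immediate. *)
Definition retract S M := exists (b : 'M[k]_(mdim M, mdim S)) (c : 'M[k]_(mdim S, mdim M)),
  [/\ is_hom b, is_hom c & c *m b = 1%:M].

Lemma retract_trans S M L : retract S M -> retract M L -> retract S L.
Proof.
case=> b [c [hb hc cb]] [b' [c' [hb' hc' cb']]]; exists (b' *m b), (c *m c'); split.
- exact: hom_comp.
- exact: hom_comp.
- by rewrite -mulmxA [c' *m _]mulmxA cb' mul1mx.
Qed.

Lemma iso_dsum_retract n M (D : 'I_n -> mod) i : isomorphic M (dsum D) -> retract (D i) M.
Proof. by move=> /iso_dsum_split[b [c [hb hc cb _ _]]]; exists (b i), (c i). Qed.

Lemma summand_retract S M : is_summand S M -> retract S M.
Proof. by case=> L /(iso_dsum_retract ord0). Qed.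

Lemma idem_split M (e : 'M[k]_(mdim M)) : @is_hom _ _ charp M M e -> e *m e = e ->
  exists (L : mod) (b : 'M[k]_(mdim M, mdim L)) (c : 'M[k]_(mdim L, mdim M)),
  [/\ is_hom b, is_hom c, c *m b = 1%:M & b *m c = e].
Proof.
move=> he ee.
have [d [b [c [cb bc]]]] : exists d (b : 'M[k]_(mdim M, d)) (c : 'M[k]_(d, mdim M)),
    c *m b = 1%:M /\ b *m c = e.
  exists (\rank e), (col_base e), (row_base e); split; last exact: mulmx_base.
  exact: (idem_base (e := fun _ : 'I_1 => e) (fun=> ee) ord0).
have eb : e *m b = b by rewrite -bc -mulmxA cb mulmx1.
have ce : c *m e = c by rewrite -bc mulmxA cb mul1mx.
have hst o : exists Z, op M o *m b = b *m Z.
  by exists (c *m op M o *m b); rewrite !mulmxA bc -(is_hom_op he) -mulmxA eb.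
exists (sub_mod cb hst), b, c; split=> //; first exact: sub_hom.
apply/hom_op => o; rewrite op_sub -[LHS](mulmxA (c *m op M o) b c) bc.
by rewrite -mulmxA (is_hom_op he) mulmxA ce.
Qed.

Lemma retract_summand S M : retract S M -> is_summand S M.
Proof.
case=> b [c [hb hc cb]].
have hbc : @is_hom _ _ charp M M (b *m c) by apply: hom_comp.
have ee0 : (b *m c) *m (b *m c) = b *m c by rewrite mulmxA -[b *m c *m b]mulmxA cb mulmx1.
have [||L [b1 [c1 [hb1 hc1 cb1 bc1]]]] := @idem_split M (1%:M - b *m c).
- by apply: hom_sub => //; apply: hom_id.
- by rewrite mulmxBl mul1mx mulmxBr mulmx1 ee0 subrr subr0.
exists L.
pose b' (i : 'I_2) : 'M[k]_(mdim M, mdim (if i == 0 then S else L)) :=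
  match i == 0 as t return 'M[k]_(mdim M, mdim (if t then S else L)) with
  | true => b | false => b1 end.
pose c' (i : 'I_2) : 'M[k]_(mdim (if i == 0 then S else L), mdim M) :=
  match i == 0 as t return 'M[k]_(mdim (if t then S else L), mdim M) with
  | true => c | false => c1 end.
have z1 : c *m b1 = 0.
  have -> : b1 = (1%:M - b *m c) *m b1 by rewrite -bc1 -mulmxA cb1 mulmx1.
  by rewrite mulmxA mulmxBr mulmx1 mulmxA cb mul1mx subrr mul0mx.
have z2 : c1 *m b = 0.
  have -> : c1 = c1 *m (1%:M - b *m c) by rewrite -bc1 mulmxA cb1 mul1mx.
  by rewrite -mulmxA mulmxBl mul1mx -mulmxA cb mulmx1 subrr mulmx0.
apply: (@split_iso k p charp _ M (fun i : 'I_2 => if i == 0 then S else L) b' c').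
- by rewrite /b' => i; case: (i == 0).
- by rewrite /c' => i; case: (i == 0).
- by rewrite /b' /c' => i; case: (i == 0).
- rewrite /b' /c'; case=> -[|[|//]] hi [[|[|//]] hj] //=.
- rewrite !big_ord_recl big_ord0 addr0 /b' /c' /=.
  by rewrite bc1 addrC subrK.
Qed.

Lemma projective_retract S M : retract S M -> projective M -> projective S.
Proof.
case=> b [c [hb hc cb]] hM X Y q f hq hs hf.
have [h [hh e]] := hM X Y q (f *m c) hq hs (hom_comp hc hf).
exists (h *m b); split; first exact: hom_comp.
by rewrite mulmxA e -mulmxA cb mulmx1.
Qed.

Lemma tau_iso M L : isomorphic (tau_dual M) (tau_dual L) -> isomorphic L M.
Proof.
have tr X Y (f : 'M[k]_(mdim Y, mdim X)) : @is_hom _ _ charp (tau_dual X) (tau_dual Y) f ->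
    @is_hom _ _ charp Y X f^T.
  move=> hf; apply/hom_op => o; have := is_hom_op hf (oswap o).
  by rewrite !op_tau oswapK => h; apply: trmx_inj; rewrite !trmx_mul trmxK -h.
case=> f [hf [g [hg e1 e2]]]; exists f^T; split; first exact: tr.
exists g^T; split; first exact: tr.
  by rewrite -trmx_mul e2 trmx1.
by rewrite -trmx_mul e1 trmx1.
Qed.

Variable P : int -> mod.
Hypothesis hP : forall i, is_T2 (lam p i) (P i).

Lemma idem_trivial_indec M : indecomposable M -> idem_trivial M.
Proof. by move=> h e; apply: indecomposable_idem. Qed.

(** The tau-duals of Q and P j are hulls with the same highest weight, hence isomorphic. *)
Lemma T2_iso Q : projective Q -> indecomposable Q -> in_block Q -> exists j, isomorphic Q (P j).
Proof.
move=> hQ iQ bQ; have [m hm] := highest_weight_exists hp iQ.1.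
have [j ej] := block_weight hp bQ hm; rewrite ej in hm; exists j.
have [hPj iPj hmj] := hP j.
have [v hv] := tau_hull hQ (idem_trivial_indec iQ) hm.
have [v' hv'] := tau_hull hPj (idem_trivial_indec iPj) hmj.
exact: tau_iso (hull_unique hv' hv).
Qed.

Lemma retract_P20 S Q : retract S Q -> in_P20 Q -> in_P20 S.
Proof.
move=> hS [hQ hs]; split; first exact: projective_retract hS hQ.
move=> S' iS' /summand_retract h; apply: hs => //.
by apply: retract_summand; apply: retract_trans hS.
Qed.

Lemma decomposition Q : in_P20 Q -> exists M, is_sumP P M /\ isomorphic Q M.
Proof.
move: {2}(mdim Q).+1 (ltnSn (mdim Q)) => n; elim: n Q => // n IH Q hn hQ.
(* The zero module, which is not indecomposable, is the empty direct sum. *)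
have [Q0|Q0] := posnP (mdim Q).
  pose D (i : 'I_0) := Q.
  exists (dsum D); split; first by apply: is_sumP_dsum; case.
  apply: (@split_iso _ _ _ _ Q D (fun=> 1%:M) (fun=> 1%:M)); try by case.
  by rewrite big_ord0; apply/matrixP => i; have := ltn_ord i; rewrite [X in (_ < X)%N]Q0.
have [iQ|niQ] := pselect (indecomposable Q).
  have : principal Q.
    apply: hQ.2 => //; apply: retract_summand; exists 1%:M, 1%:M.
    by split; [exact: hom_id|exact: hom_id|rewrite mulmx1].
  move=> /(principal_spec hp)[_ _ hb].
  have [j hj] := T2_iso hQ.1 iQ hb.
  by exists (P j); split=> //; apply: is_sumP_base.
have [D hD hpos] : exists2 D : 'I_2 -> mod, isomorphic Q (dsum D) & forall i, mdim (D i) != 0%N.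
  apply: contrapT => hno; apply: niQ; split=> // D hD; apply: contrapT => hno'.
  apply: hno; exists D => // i; apply/negP => /eqP e; apply: hno'; by exists i.
have hdim : mdim Q = (mdim (D ord0) + mdim (D ord_max))%N.
  rewrite (isomorphic_dim hD) /= !big_ord_recl big_ord0 addn0; congr (_ + mdim (D _))%N.
  exact/val_inj.
have hsm i : (mdim (D i) < n)%N.
  have h0 := hpos ord0; have h1 := hpos ord_max.
  case: i => -[|[|//]] hi.
    have -> : Ordinal hi = ord0 by apply/val_inj.
    by move: hn; rewrite hdim; lia.
  have -> : Ordinal hi = ord_max by apply/val_inj.
  by move: hn; rewrite hdim; lia.
have /choice[M hM] i : exists M, is_sumP P M /\ isomorphic (D i) M.
  by apply: IH => //; apply: retract_P20 hQ; apply: iso_dsum_retract.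
exists (dsum M); split; first by apply: is_sumP_dsum => a; case: (hM a).
have [b [c [hb hc cb cb0 bc]]] := iso_dsum_split hD.
have hf i : exists f : 'M[k]_(mdim (M i), mdim (D i)) * 'M[k]_(mdim (D i), mdim (M i)),
   [/\ is_hom f.1, is_hom f.2, f.2 *m f.1 = 1%:M & f.1 *m f.2 = 1%:M].
  by have [_ [f [h [g [h' e1 e2]]]]] := hM i; exists (f, g).
pose f i := projT1 (cid (hf i)).
have hf' i : [/\ is_hom (f i).1, is_hom (f i).2, (f i).2 *m (f i).1 = 1%:M &
    (f i).1 *m (f i).2 = 1%:M] by exact: (projT2 (cid (hf i))).
apply: (@split_iso k p charp _ Q M (fun i => b i *m (f i).2) (fun i => (f i).1 *m c i)).
- by move=> i; have [h1 h2 _ _] := hf' i; apply: hom_comp.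
- by move=> i; have [h1 h2 _ _] := hf' i; apply: hom_comp.
- move=> i; have [_ _ _ h4] := hf' i.
  by rewrite mulmxA -[_ *m c i *m b i]mulmxA cb mulmx1 h4.
- by move=> i j ij; rewrite mulmxA -[_ *m c i *m b j]mulmxA cb0 // mulmx0 mul0mx.
- rewrite -bc; apply: eq_bigr => i _; have [_ _ h3 _] := hf' i.
  by rewrite mulmxA -[b i *m _ *m _]mulmxA h3 mulmx1.
Qed.
End Decomposition.

(** * The modules Delta_2 *)

Section Induced.
Variables (k : closedFieldType) (p : nat) (charp : p \in [pchar k]).
Local Notation N := (p ^ 2)%N.
Local Notation mod := (G2Tmod charp).
Local Notation R2 := (trunc2 charp).
Local Notation X := (trX (trunc2 charp)).
Implicit Types M L Q D : mod.
Let N0 : (0 < N)%N := N_gt0 charp.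

Lemma G2T_inv_map (A B : comAlgType k) (f : {lrmorphism A -> B}) (g : G2T p A) :
  G2T_inv charp (G2T_map f g) = G2T_map f (G2T_inv charp g).
Proof. by apply: G2T_ext; rewrite /= map_mx_adj. Qed.

Lemma G2T_invM (A : comAlgType k) (g h : G2T p A) :
  G2T_inv charp (G2T_mul charp (G2T_inv charp g) h) = G2T_mul charp (G2T_inv charp h) g.
Proof.
apply: G2T_ext => /=; rewrite {1}(mx2_eta g) {1}(mx2_eta h) [in RHS](mx2_eta g).
rewrite [in RHS](mx2_eta h) !adj_mx2 !mx2M adj_mx2; apply: mx2P; ring.
Qed.

Lemma G2T_invM2 (A : comAlgType k) (g h : G2T p A) :
  G2T_inv charp (G2T_mul charp g h) = G2T_mul charp (G2T_inv charp h) (G2T_inv charp g).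
Proof.
apply: G2T_ext => /=; rewrite {1}(mx2_eta g) {1}(mx2_eta h) [in RHS](mx2_eta g).
rewrite [in RHS](mx2_eta h) !adj_mx2 !mx2M adj_mx2; apply: mx2P; ring.
Qed.

Lemma act_tor_wtl M (A : comAlgType k) (a b : A) (hab : a * b = 1) n m
  (th : 'M[k]_(m, mdim M)) : th *m wproj M n = th ->
  th%:sc[A] *m act M (tor charp hab) = tch n a b *: th%:sc[A].
Proof.
move=> h; have := @act_tor_wt _ _ charp (tau_dual M) A a b hab n m th^T.
rewrite wproj_tau -trmx_mul h => /(_ erefl) /=; rewrite G2T_tr_tor -map_trmx => e.
by apply: trmx_inj; rewrite trmx_mul e linearZ.
Qed.

Lemma act_upl M (A : comAlgType k) (a : A) (ha : a ^+ N = 0) m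
  (th : 'M[k]_(m, mdim M)) : (forall r, (0 < r)%N -> th *m opE M r = 0) ->
  th%:sc[A] *m act M (up charp ha) = th%:sc[A].
Proof.
move=> h; rewrite act_up mulmx_sumr (bigD1 (Ordinal N0)) //= big1 ?addr0.
  by rewrite expr0 scale1r opE0 map_mx1 mulmx1.
move=> r; rewrite -val_eqE /= => hr.
by rewrite -scalemxAr -map_mxM h ?lt0n // map_mx0 scaler0.
Qed.

Lemma B2T_tor_up (A : comAlgType k) (b : G2T p A) : in_B2T p b ->
  exists x y z (hxy : x * y = 1) (hz : z ^+ N = 0),
    b = G2T_mul charp (tor charp hxy) (up charp hz).
Proof.
move=> [t [u [/andP[ht _] /andP[/eqP hu _] _ eb]]].
have ex (g : 'M[A]_2) : exists a b c d, g = mx2 a b c d.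
  by exists (g 0 0), (g 0 1), (g 1 0), (g 1 1); apply: mx2_eta.
have [x [z [y e]]] : exists x z y, (b : 'M[A]_2) = mx2 x z 0 y.
  have [[t1 [t2 [t3 [t4 et]]]] [u1 [u2 [u3 [u4 eu]]]]] := (ex t, ex u).
  move: ht hu eb; rewrite et eu diag_mx2 mxE /= mx2M => /andP[_ /eqP ->] -> ->.
  exists (t1 * u1 + t2 * 0), (t1 * u2 + t2 * u4), (0 * u2 + t4 * u4).
  by apply: mx2P => //; rewrite mul0r mulr0 addr0.
have := g2mxP b; rewrite e (in_G2T_mx2 charp) mulr0 subr0 => /and3P[/eqP h1 /eqP h2 _].
have hz : (y * z) ^+ N = 0 by rewrite exprMn h2 mulr0.
exists x, y, (y * z), h1, hz; apply: G2T_ext.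
rewrite e /= !mx2M; apply: mx2P; rewrite ?mulr0 ?mul0r ?addr0 ?add0r ?mulr1 //.
by rewrite mulrA h1 mul1r.
Qed.

Lemma tor_up_B2T (A : comAlgType k) (x y z : A) (hxy : x * y = 1) (hz : z ^+ N = 0) :
  in_B2T p (G2T_mul charp (tor charp hxy) (up charp hz)).
Proof.
exists (mx2 x 0 0 y), (mx2 1 z 0 1); split=> //.
- by rewrite /is_torus diag_mx2 !eqxx det_mx2 mulr0 subr0 hxy eqxx.
- by rewrite /is_borel det_mx2 mulr0 subr0 mulr1 mxE /= !eqxx.
- by rewrite /frob !map_mx2 -!exprM mulnn hz -mx2_1 expr0n gtn_eqF // expr1n.
Qed.

Section Coefficient.
Variables (M : mod) (th : 'rV[k]_(mdim M)) (v : 'cV[k]_(mdim M)) (l : int).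
Hypothesis hE : forall r, (0 < r)%N -> th *m opE M r = 0.
Hypothesis hW : th *m wproj M l = th.

(** Frobenius reciprocity: for a functional th of weight l that vanishes on E_r M for all r > 0, the
    map v |-> (x |-> th (x^-1 v)) goes from M to Ind(l). *)
Definition matcoef (A : comAlgType k) (x : G2T p A) : A :=
  (th%:sc[A] *m act M (G2T_inv charp x) *m v%:sc[A]) 0 0.

Lemma matcoef_map (A B : comAlgType k) (f : {lrmorphism A -> B}) (x : G2T p A) :
  matcoef (G2T_map f x) = f (matcoef x).
Proof.
rewrite /matcoef G2T_inv_map act_map -(map_mx_sc f) -[v%:sc[B]](map_mx_sc f).
by rewrite -!map_mxM mxE.
Qed.

Definition matcoef_fun : regfun k p := MkRegfun matcoef_map.

Lemma matcoef_ind : in_Ind charp l matcoef_fun.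
Proof.
move=> A g b hb /=.
rewrite /matcoef G2T_invM2 actM mulmxA.
have [x [y [z [hxy [hz ->]]]]] := B2T_tor_up hb.
have hyx : y * x = 1 by rewrite mulrC.
have hz' : (- (x * x) * z) ^+ N = 0 by rewrite exprMn hz mulr0.
have -> : G2T_inv charp (G2T_mul charp (tor charp hxy) (up charp hz)) =
    G2T_mul charp (tor charp hyx) (up charp hz').
  apply: G2T_ext; rewrite /= !mx2M adj_mx2; apply: mx2P; rewrite ?mulr0 ?mul0r ?addr0 ?add0r ?mulr1 ?oppr0 //.
  have -> : y * (- (x * x) * z) = - (y * x * (x * z)) by ring.
  by rewrite hyx mul1r.
rewrite actM !mulmxA (act_tor_wtl hyx hW) -!scalemxAl (act_upl hz' hE) mxE.
rewrite tch_tchar /= mx2M tchN; congr (tch l _ _ * _).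
  by rewrite mxE /= mul0r add0r mulr1.
by rewrite mxE /= mulr1 mulr0 addr0.
Qed.

Section Coordinates.
Variables (D : mod) (e : 'I_(mdim D) -> regfun k p) (m : int).
Hypothesis hex : forall f : regfun k p, in_Ind charp l f ->
  exists! c : 'cV[k]_(mdim D), forall (A : comAlgType k) (x : G2T p A),
    f A x = \sum_j c j 0 *: e j A x.
Hypothesis hact : forall (A : comAlgType k) (g x : G2T p A) j,
  e j A (G2T_mul charp (G2T_inv charp g) x) = \sum_i act D g i j * e i A x.
Hypothesis hv : wproj M m *m v = v.

Lemma matcoef_shift (A : comAlgType k) (c : k) (hc : c != 0) (x : G2T p A) :
  matcoef (G2T_mul charp (G2T_inv charp (tor charp (alg_inv A hc))) x) = c ^ m *: matcoef x.
Proof.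
rewrite /matcoef G2T_invM actM -!mulmxA (act_tor_wt _ hv) tch_alg -!scalemxAr mxE.
by rewrite mulr_algl.
Qed.

(** Translation by a torus element multiplies the function by c^m; by uniqueness of coordinates it
    does the same to c0, which is therefore a weight vector. *)
Lemma coordinates : exists c0 : 'cV[k]_(mdim D), wproj D m *m c0 = c0 /\
  forall (A : comAlgType k) (x : G2T p A), matcoef x = \sum_j c0 j 0 *: e j A x.
Proof.
have [c0 [/= h0 huniq]] := hex matcoef_ind; exists c0; split=> //.
rewrite (@wt_projE _ _ _ D m 1 c0) ?eqxx ?scale1r // => c hc.
have -> : c ^ m *: c0 = c ^ m *: (c ^ (- m) *: (rho D c *m c0)).
  congr (_ *: _); apply: huniq => A x /=.
  have : matcoef x = c ^ (- m) *: matcoef (G2T_mul charp (G2T_inv charp (tor charp (alg_inv A hc))) x).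
    by rewrite matcoef_shift scalerA -expfzDr // addNr expr0z scale1r.
  move=> ->; rewrite h0 scaler_sumr.
  rewrite (eq_bigr (fun j => \sum_i c ^ (- m) *: (c0 j 0 *: ((rho D c)%:sc[A] i j * e i A x)))); last first.
    by move=> j _; rewrite hact act_rho_alg !scaler_sumr.
  rewrite exchange_big /=; apply: eq_bigr => i _.
  rewrite !mxE -scalerA scaler_suml scaler_sumr; apply: eq_bigr => j _.
  by rewrite mxE /= mulr_algl !scalerA; congr (_ *: _); ring.
by rewrite scalerA -expfzDr // subrr expr0z scale1r.
Qed.
End Coordinates.
End Coefficient.

Section Dimension.
Variables (l : int) (D : mod) (e : 'I_(mdim D) -> regfun k p).
Hypothesis he : forall j, in_Ind charp l (e j).
Hypothesis hex : forall f : regfun k p, in_Ind charp l f ->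
  exists! c : 'cV[k]_(mdim D), forall (A : comAlgType k) (x : G2T p A),
    f A x = \sum_j c j 0 *: e j A x.

(** By the big cell, an element of Ind(l) is determined by its restriction to the lower root
    subgroup, a polynomial of degree less than N in one variable. *)
Lemma Ind_dim : (mdim D <= N)%N.
Proof.
pose K : 'M[k]_(N, mdim D) :=
  \matrix_(r, j) tr_coef R2 r 0 (e j R2 (lo charp (trXN R2))).
have elo (A : comAlgType k) (a : A) (ha : a ^+ N = 0) j :
    e j A (lo charp ha) = \sum_(r < N) a ^+ r * (K r j)%:A.
  have -> : lo charp ha = G2T_map (tr_lift R2 ha (expN0 charp A)) (lo charp (trXN R2)).
    by apply: G2T_ext; rewrite /= map_mx2 rmorph0 rmorph1 tr_liftX.
  rewrite regval_map; have := trunc_expand ha (const_mx (e j R2 (lo charp (trXN R2))) : 'M_1).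
  move=> /matrixP/(_ 0 0); rewrite !mxE summxE => ->; apply: eq_bigr => r _.
  by rewrite !mxE.
have inj (y : 'cV_(mdim D)) : K *m y = 0 -> y = 0.
  move=> Ky.
  have z (A : comAlgType k) (x : G2T p A) : \sum_j y j 0 *: e j A x = 0.
    have [c [t [t' [b [hc [htt [hb ->]]]]]]] := big_cell charp x.
    under eq_bigr => j _.
      rewrite (he j (lo charp hc) (tor_up_B2T htt hb)) elo mulrC scalerAl. over.
    rewrite -mulr_suml; under eq_bigr => j _ do rewrite scaler_sumr.
    rewrite exchange_big big1 ?mul0r //= => r _.
    have /matrixP/(_ r 0) := Ky; rewrite mxE [RHS]mxE => h.
    transitivity (c ^+ r * (\sum_j K r j * y j 0)%:A); last by rewrite h scale0r mulr0.
    rewrite scaler_suml mulr_sumr; apply: eq_bigr => j _.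
    by rewrite scalerAr scalerA mulrC [X in _ = _ * (X *: _)]mulrC mulrC.
  pose zf : regfun k p := @MkRegfun k p (fun A _ => 0) (fun A B f g => esym (rmorph0 f)).
  have hz : in_Ind charp l zf by move=> A g b _ /=; rewrite mulr0.
  have [c [_ hc]] := hex hz.
  have -> : y = c by apply/esym/hc => A x; rewrite z.
  by apply: hc => A x; rewrite big1 // => j _; rewrite mxE scale0r.
have [C hC] := linv_of_inj inj; exact: mulmx1_min hC.
Qed.
End Dimension.

(** On the span of the F_s v in Q, take as functional the coefficient of F_{N-1} v. It has weight m
    - 2(p^2 - 1), so reciprocity gives a map to D. The image of v is nonzero, because the
    corresponding function takes the value (-X)^(N-1) at lo(X). *)
Lemma Delta2_top Q m v D : @hull _ _ charp Q m v -> is_Delta2 m D ->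
  (mdim D <= N)%N /\ exists2 c0 : 'cV[k]_(mdim D), c0 != 0 & wproj D m *m c0 = c0.
Proof.
move=> hQ [e [he hex hact]]; split; first exact: Ind_dim he hex.
have [C hC] := linv_of_inj (Fmx_inj hQ).
have hs := top_singular hQ (hull_wt hQ).
pose M := sub_mod hC (sing_stable hs).
have opM o : op M o = singZ k p m o :> 'M_N.
  by rewrite op_sub -mulmxA (sing_op hs) mulmxA hC mul1mx.
have hn : (N.-1 < N)%N by rewrite prednK.
pose last := Ordinal hn; pose first := Ordinal N0.
pose th : 'rV[k]_(mdim M) := delta_mx 0 last.
pose v0 : 'cV[k]_(mdim M) := delta_mx first 0.
have hE r : (0 < r)%N -> th *m opE M r = 0.
  move=> r0; have -> : opE M r = singZ k p m (OE r) := opM (OE r).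
  rewrite -rowE; apply/rowP => j; rewrite !mxE; case: ifP => // /andP[h1 /eqP h2].
  by have := ltn_ord j; move: h2 => /=; have := N0; lia.
have hl : m - 2 * (p%:Z ^+ 2 - 1) = m - (N.-1.*2)%:Z.
  by have := N0; rewrite -natz -natrX natz; lia.
have hW : th *m wproj M (m - 2 * (p%:Z ^+ 2 - 1)) = th.
  have -> : wproj M (m - 2 * (p%:Z ^+ 2 - 1)) = singZ k p m (OW (m - 2 * (p%:Z ^+ 2 - 1))) := opM (OW _).
  rewrite -rowE; apply/rowP => j; rewrite !mxE eqxx /= eq_sym.
  by case: eqP => // ->; rewrite hl eqxx.
have hv : wproj M m *m v0 = v0.
  have -> : wproj M m = singZ k p m (OW m) := opM (OW _).
  rewrite -colE; apply/colP => j; rewrite !mxE andbT /=.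
  by case: eqP => // _; rewrite subr0 eqxx.
have [c0 [hc0 e0]] := coordinates hE hW hex hact hv.
exists c0 => //; apply/negP => /eqP c00.
have {e0} : matcoef th v0 (lo charp (trXN R2)) = 0.
  by rewrite e0 c00 big1 // => j _; rewrite mxE scale0r.
have hX : (- X) ^+ N = 0 by rewrite exprNn trXN mulr0.
have -> : matcoef th v0 (lo charp (trXN R2)) = (- X) ^+ N.-1.
  rewrite /matcoef (_ : G2T_inv _ _ = lo charp hX); last first.
    by apply: G2T_ext; rewrite /= adj_mx2 oppr0.
  rewrite act_lo mulmx_sumr mulmx_suml summxE (bigD1 last) //= big1 ?addr0.
    rewrite -scalemxAr -scalemxAl -!map_mxM mxE.
    have -> : opF M N.-1 = singZ k p m (OF N.-1) := opM (OF _).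
    by rewrite -rowE -colE !mxE addn0 eqxx binn /= scale1r mulr1.
  move=> r hr; rewrite -scalemxAr -scalemxAl -!map_mxM mxE.
  have -> : opF M r = singZ k p m (OF r) := opM (OF _).
  have hne : (N.-1 == r)%N = false by apply/negP => /eqP h; case/eqP: hr; apply/val_inj.
  by rewrite -rowE -colE !mxE addn0 /= hne scale0r mulr0.
move=> h; have /eqP := oner_neq0 k; apply.
have X0 : X ^+ N.-1 = 0.
  have := h; rewrite exprNn => /(congr1 ( *%R ((-1) ^+ N.-1))).
  by rewrite mulrA -exprMn mulrNN mulr1 expr1n mul1r mulr0.
have e1 := @tr_mono _ _ R2 N.-1 0 N.-1 0 hn N0.
by rewrite X0 mul0r linear0 !eqxx in e1; rewrite -[LHS]e1.
Qed.

(** The vector c0 of weight m in D goes to a nonzero multiple of v, so the F_s c0 are N independent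
    vectors and span D, whose dimension is at most N. If f v = 0, then f would vanish on all of
    D. *)
Lemma gbar_top Q m v D L (f : 'M[k]_(mdim L, mdim Q)) : @hull _ _ charp Q m v ->
  is_Delta2 m D -> @is_gbar _ _ charp D Q L f -> f *m v != 0.
Proof.
move=> hQ hD [hf [iota [h [hiota inj_iota hh h0 fi]]]].
have [dimD [c0 c00 hc0]] := Delta2_top hQ hD.
have hw : wproj Q m *m (iota *m c0) = iota *m c0.
  by have := is_hom_op hiota (OW m) => /= e; rewrite mulmxA e -mulmxA hc0.
have v0 : v != 0.
  by apply: contra (hull_low hQ) => /eqP ->; rewrite mulmx0.
have [a ha] := hull_sing_uniq hQ (top_singular hQ (hull_wt hQ)) v0 (top_singular hQ hw).
have a0 : a != 0.
  apply: contra c00 => /eqP a0; apply/eqP/inj_iota.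
  by rewrite mulmx0 ha a0 scale0r.
have [C hC] := linv_of_inj (Fmx_inj hQ).
have eF : Fmx v = iota *m (a^-1 *: Fmx c0).
  apply: trmx_inj; apply/row_matrixP => s; rewrite -!tr_col; congr (_^T).
  rewrite col_Fmx [RHS]colE -[RHS]mulmxA -scalemxAl -colE col_Fmx -scalemxAr mulmxA.
  rewrite -(is_hom_op hiota (OF s)) /= -mulmxA ha -scalemxAr scalerA mulVf // scale1r.
  by [].
apply/negP => /eqP fv; case/eqP: h0.
have fF : f *m Fmx v = 0.
  apply: trmx_inj; apply/row_matrixP => s; rewrite -!tr_col; congr (_^T).
  rewrite colE -mulmxA -colE col_Fmx mulmxA -(is_hom_op hf (OF s)) -mulmxA fv mulmx0.
  by apply/colP => i; rewrite !mxE.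
set Y := a^-1 *: Fmx c0 in eF.
have hY : row_free Y.
  have : (N <= \rank Y)%N.
    have e : (C *m iota) *m Y = 1%:M by rewrite -mulmxA -eF hC.
    by rewrite -[X in (X <= _)%N](mxrank1 k) -e mxrankM_maxr.
  by move=> hN; rewrite /row_free eqn_leq rank_leq_row (leq_trans dimD hN).
apply/eqP; rewrite -fi -(mulmx_free_eq0 _ hY) -mulmxA -eF fF.
by [].
Qed.

End Induced.

(** * Weights of singular vectors *)

Section Weights.
Variable p : nat.
Local Notation N := (p ^ 2)%N.

Lemma lam_even (a : int) : lam p (2 * a) = 2 * a * p%:Z.
Proof. by rewrite /lam dvdz_mulr. Qed.

Lemma lam_odd (a : int) : lam p (2 * a + 1) = (2 * a + 2) * p%:Z - 2.
Proof.
rewrite /lam ifF; first by congr (_ * _ - _); ring.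
by apply/negP => /dvdzP[b]; lia.
Qed.

Lemma int_parity (j : int) : exists a : int, j = 2 * a \/ j = 2 * a + 1.
Proof. by exists (j %/ 2)%Z; lia. Qed.

Hypothesis p1 : (1 < p)%N.
Let p0 : (0 < p)%N := ltnW p1.

(** [zres N x %/ p] is the second base p digit of x, that is, a modulo p; being less than p, it is
    divisible by p only if it is 0. *)
Lemma zres_dvd (x a b : int) : x = a * p%:Z + b -> 0 <= b < p%:Z ->
  (p %| zres N x %/ p)%N -> (p%:Z %| a)%Z.
Proof.
move=> -> hb; have pz : p%:Z != 0 by lia.
have h1 := divz_eq a p%:Z; have h2 := modz_ge0 a pz.
have h3 : (a %% p)%Z < p%:Z by rewrite ltz_mod.
move: (a %/ p)%Z (a %% p)%Z h1 h2 h3 => c d -> h2 h3.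
have -> : (c * p%:Z + d) * p%:Z + b = c * N%:Z + (d * p%:Z + b).
  by rewrite -mulnn PoszM; ring.
have hd : 0 <= d * p%:Z + b < N%:Z.
  rewrite -mulnn PoszM; nia.
rewrite /zres modzMDl modz_small //.
have -> : d * p%:Z + b = (`|d| * p + `|b|)%N%:Z by rewrite PoszD PoszM; lia.
rewrite /= divnMDl // divn_small ?addn0; last by lia.
have [->|d0] := eqVneq d 0; first by rewrite addr0 dvdz_mull.
by move=> /dvdn_leq; lia.
Qed.

(** The number t is p - 1 minus the higher base p digit of s. If s = -1 modulo p, then j - l is
    even, which is the first alternative; if n = s modulo p, then l can be chosen with j - l odd,
    which is the second. The last hypothesis then says that t = 0 or that j is obtained by
    reflection in a multiple of p. *)
Lemma sing_weight (j n : int) (s : nat) : (s < N)%N ->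
  n - (s.*2)%:Z = lam p j - (N.-1.*2)%:Z ->
  (p %| s.+1)%N || (p%:Z %| n - s%:Z)%Z ->
  (p %| (s %/ p).+1)%N || (p %| zres N (n - s%:Z) %/ p)%N ->
  exists (l : int) (t : nat), [/\ n = lam p l, (t < p)%N &
    (j = l + (t.*2)%:Z /\ (t = 0%N \/ (p%:Z %| l + t%:Z)%Z)) \/
    (j = l + 1 + (t.*2)%:Z /\ (t = 0%N \/ (p%:Z %| l + 1 + t%:Z)%Z))].
Proof.
have eN : N = (p * p)%N by rewrite mulnn.
have hN : (N.-1.*2)%:Z = 2 * (p%:Z * p%:Z) - 2 by rewrite -PoszM -eN; have : (0 < N)%N; [rewrite expn_gt0 p0|lia].
rewrite hN => hs hn; have [a ja] := int_parity j.
have {hn} en : n = lam p j - (2 * (p%:Z * p%:Z) - 2) + 2 * s%:Z by move: hn; lia.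
have e0 (q : int) : 2 * a + 2 * q - 2 * p%:Z = 2 * (a + q - p%:Z) by ring.
have e1 (q : int) : 2 * a + 1 + 2 * q - 2 * p%:Z = 2 * (a + q - p%:Z) + 1 by ring.
case/orP => [/dvdnP[q hq]|/dvdzP[q hq]].
  have q1 : (0 < q)%N by case: (q) hq.
  have qp : (q <= p)%N by rewrite -(leq_pmul2r p0) -hq -eN.
  have sz : s%:Z = q%:Z * p%:Z - 1 by rewrite -PoszM -hq; lia.
  have -> : ((s %/ p).+1 = q)%N.
    have -> : (s = q.-1 * p + p.-1)%N by move: hq; case: (q) q1 => // q' _; rewrite mulSn /=; lia.
    by rewrite divnMDl // divn_small ?addn0 ?prednK // prednK.
  move=> hc; exists (j + 2 * q%:Z - 2 * p%:Z), (p - q)%N.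
  have tz : (p - q)%N%:Z = p%:Z - q%:Z by rewrite subzn.
  split; [|by lia|].
    rewrite en sz; case: ja => ->; rewrite ?e0 ?e1 ?lam_even ?lam_odd; ring.
  left; split; first by rewrite -mul2n PoszM tz; ring.
  case/orP: hc => [/(dvdn_leq q1) h|hc].
    by left; apply/eqP; rewrite subn_eq0.
  right; rewrite tz.
  have -> : j + 2 * q%:Z - 2 * p%:Z + (p%:Z - q%:Z) = (j + q%:Z - 2 * p%:Z) + p%:Z by ring.
  apply: rpredD; last exact: dvdzz.
  case: ja => ja.
    apply: (zres_dvd (x := n - s%:Z) (b := 1)) => //.
    by rewrite en sz ja lam_even; ring.
  apply: (zres_dvd (x := n - s%:Z) (b := p%:Z - 1)) => //.
    by rewrite en sz ja lam_odd; ring.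
  by lia.
case: ja => ja.
  have [q' hq'] : exists q' : nat, q'%:Z * p%:Z = s%:Z + 2.
    have : s%:Z + 2 = (q - 2 * a + 2 * p%:Z) * p%:Z.
      by rewrite !mulrDl mulNr -hq en ja lam_even; ring.
    move: (q - 2 * a + 2 * p%:Z) => r hr; exists `|r|%N; rewrite gez0_abs //.
    by rewrite -(@pmulr_lge0 _ p%:Z) -?hr.
  move=> hc; have hq1 : (q' * p = s + 2)%N by move: hq'; rewrite -PoszM; lia.
  have q1 : (0 < q')%N by case: (q') hq1 => //; rewrite mul0n addn2.
  have qp : (q' <= p)%N.
    rewrite leqNgt; apply/negP => h.
    have : (p.+1 * p <= q' * p)%N by rewrite leq_pmul2r.
    by rewrite hq1 mulSn -eN; move: hs p1; lia.
  have sz : s%:Z = q'%:Z * p%:Z - 2 by rewrite hq' addrK.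
  have es : ((s %/ p).+1 = q')%N.
    have -> : (s = q'.-1 * p + (p - 2))%N.
      by move: hq1; case: (q') q1 => // q2 _; rewrite mulSn /=; move: p1; lia.
    by rewrite divnMDl // divn_small ?addn0 ?prednK //; move: p1; lia.
  have tz : (p - q')%N%:Z = p%:Z - q'%:Z by rewrite subzn.
  exists (j + 2 * q'%:Z - 2 * p%:Z - 1), (p - q')%N; split; [|by lia|].
    have -> : j + 2 * q'%:Z - 2 * p%:Z - 1 = 2 * (a + q'%:Z - p%:Z - 1) + 1 by rewrite ja; ring.
    by rewrite en sz ja lam_even lam_odd; ring.
  right; split; first by rewrite -mul2n PoszM tz; ring.
  move: hc; rewrite es; case/orP => [/(dvdn_leq q1) h|hc].
    by left; apply/eqP; rewrite subn_eq0.
  right; rewrite tz.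
  have -> : j + 2 * q'%:Z - 2 * p%:Z - 1 + 1 + (p%:Z - q'%:Z) = (j + q'%:Z - 2 * p%:Z) + p%:Z by ring.
  apply: rpredD; last exact: dvdzz.
  apply: (zres_dvd (x := n - s%:Z) (b := 0)) => //.
  by rewrite en sz ja lam_even; ring.
have [q' hq'] : exists q' : nat, q'%:Z * p%:Z = s%:Z.
  have : s%:Z = (q - (2 * a + 2) + 2 * p%:Z) * p%:Z.
    by rewrite !mulrDl mulNr -hq en ja lam_odd; ring.
  move: (q - _ + 2 * p%:Z) => r hr; exists `|r|%N; rewrite gez0_abs //.
  by rewrite -(@pmulr_lge0 _ p%:Z) -?hr.
move=> hc; have hq1 : (q' * p = s)%N by move: hq'; rewrite -PoszM; lia.
have qp : (q' < p)%N by rewrite -(ltn_pmul2r p0) hq1 -eN.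
have es : (s %/ p = q')%N by rewrite -hq1 mulnK.
have tz : (p - q'.+1)%N%:Z = p%:Z - q'%:Z - 1 by lia.
exists (j + 1 + 2 * q'%:Z - 2 * p%:Z), (p - q'.+1)%N; split; [|by lia|].
  have -> : j + 1 + 2 * q'%:Z - 2 * p%:Z = 2 * (a + 1 + q'%:Z - p%:Z) by rewrite ja; ring.
  by rewrite en -hq' ja lam_even lam_odd; ring.
right; split; first by rewrite -mul2n PoszM tz; ring.
move: hc; rewrite es; case/orP => [/(dvdn_leq (ltn0Sn _)) h|hc].
  by left; apply/eqP; rewrite subn_eq0.
right; rewrite tz.
have -> : j + 1 + 2 * q'%:Z - 2 * p%:Z + 1 + (p%:Z - q'%:Z - 1) = (j + 1 + q'%:Z - 2 * p%:Z) + p%:Z by ring.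
apply: rpredD; last exact: dvdzz.
apply: (zres_dvd (x := n - s%:Z) (b := 0)) => //.
by rewrite en -hq' ja lam_odd; ring.
Qed.
End Weights.

(** * Transport of hulls, twists, and a criterion for singular vectors *)

Section Twists.
Variables (k : closedFieldType) (p : nat) (charp : p \in [pchar k]).
Local Notation N := (p ^ 2)%N.
Local Notation mod := (G2Tmod charp).
Implicit Types M L Q : mod.
Let N0 : (0 < N)%N := N_gt0 charp.

Lemma hull_iso Q Q' m v : isomorphic Q Q' -> @hull _ _ charp Q m v ->
  exists v', @hull _ _ charp Q' m v'.
Proof.
move=> hQQ' hQ; have [g [hg [g' [hg' e1 e2]]]] := hQQ'; exists (g *m v); split.
- exact: injective_iso hQQ' (hull_inj hQ).
- move=> e he ee; pose e' := g' *m e *m g.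
  have he' : @is_hom _ _ charp Q Q e' by apply: hom_comp => //; apply: hom_comp.
  have ee' : e' *m e' = e'.
    transitivity (g' *m (e *m (g *m g') *m e) *m g); first by rewrite /e' !mulmxA.
    by rewrite e2 mulmx1 ee.
  have eE : e = g *m e' *m g'.
    by rewrite /e' !mulmxA e2 mul1mx -mulmxA e2 mulmx1.
  case: (hull_ind hQ he' ee') => h; rewrite eE h.
    by left; rewrite mulmx0 mul0mx.
  by right; rewrite mulmx1.
- by have := is_hom_op hg (OW m) => /= e; rewrite mulmxA e -mulmxA (hull_wt hQ).
- move=> n h; apply: (hull_top hQ); apply: contra h => /eqP h.
  rewrite -[wproj Q' n]mulmx1 -e2 mulmxA.
  by have := is_hom_op hg (OW n) => /= ->; rewrite h mulmx0 mul0mx.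
- have := is_hom_op hg (OF N.-1) => /= e; rewrite mulmxA e -mulmxA.
  apply: contra (hull_low hQ) => /eqP h.
  by rewrite -[opF _ _ *m _]mul1mx -e1 -mulmxA h mulmx0.
Qed.

Lemma rho_twist M a c : c != 0 -> rho (twist M a) c = c ^ (a * N%:Z) *: rho M c.
Proof.
move=> hc; rewrite -!(act_rho _ hc) /= tch_tchar; congr (_ *: _).
rewrite /frob !map_mx2 !mxE /= -!exprM mulnn.
case: a => a; rewrite ?NegzE /=.
  by rewrite -exprM mulnC -PoszM.
by rewrite mulNr -PoszM -exprnN -exprM exprVn mulnC.
Qed.

Lemma wproj_twist M a n m (x : 'M[k]_(mdim M, m)) : wproj M n *m x = x ->
  wproj (twist M a) (n + a * N%:Z) *m x = x.
Proof.
move=> hx; rewrite (@wt_projE _ _ _ (twist M a) (n + a * N%:Z) m x) ?eqxx ?scale1r // => c hc.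
by rewrite rho_twist // -scalemxAl (rho_wt hc hx) scalerA expfzDr // mulrC.
Qed.

Lemma hom_twist M L a (f : 'M[k]_(mdim L, mdim M)) : is_hom f ->
  @is_hom _ _ charp (twist M a) (twist L a) f.
Proof. by move=> h A g; rewrite /= -scalemxAl h scalemxAr. Qed.

(* Dist(U^+_2) is generated by E_1 and E_p. *)
Lemma singular_E1p Q n z : wproj Q n *m z = z -> opE Q 1 *m z = 0 -> opE Q p *m z = 0 ->
  @singular _ _ charp Q n z.
Proof.
move=> hz h1 hp; split=> // r; have p0 := p_gt0 charp.
elim/ltn_ind: r => r IH r0.
case: (ltnP r N) => hr; last by rewrite opE_ge // mul0mx.
have main s : (0 < s <= r)%N -> 'C(r, s)%:R != 0 :> k -> opE Q s *m z = 0 -> opE Q r *m z = 0.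
  move=> /andP[s0 sr] hc hs.
  have := opEM Q (r - s) s; rewrite subnK // bin_sub // => /(congr1 (mulmx^~ z)).
  rewrite -mulmxA hs mulmx0 -scalemxAl => /esym/eqP.
  by rewrite scaler_eq0 (negbTE hc) => /eqP.
have [/dvdnP[a ra]|hpr] := boolP (p %| r)%N.
  apply: (main p) => //.
    by rewrite p0 ra leq_pmull //; case: (a) ra r0 => [->|].
  rewrite (binp charp) (nat_eq0 charp) ra mulnK //; apply/negP => /dvdn_leq h.
  have a0 : (0 < a)%N by case: (a) ra r0 => [->|].
  have := h a0; rewrite leqNgt => /negP; apply.
  by rewrite -(ltn_pmul2r p0) -ra mulnn.
by apply: (main 1%N) => //; rewrite bin1 (nat_eq0 charp).
Qed.
End Twists.

(** * Computations between neighbouring highest weights *)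

Section Gaps.
Variables (k : closedFieldType) (p : nat) (charp : p \in [pchar k]).
Local Notation N := (p ^ 2)%N.
Local Notation mod := (G2Tmod charp).
Implicit Types M L Q : mod.
Let N0 : (0 < N)%N := N_gt0 charp.
Let p0 : (0 < p)%N := p_gt0 charp.
Hypothesis hp : (2 < p)%N.

Lemma leqpN : (p < N)%N.
Proof. by rewrite -mulnn -[X in (X < _)%N]muln1 ltn_pmul2l // ltnW. Qed.

Lemma pchar_eq0 : p%:R = 0 :> k. Proof. by apply/eqP; rewrite (nat_eq0 charp). Qed.

Lemma pcharz (c : int) : (c * p%:Z)%:~R = 0 :> k.
Proof. by rewrite rmorphM /= -pmulrn pchar_eq0 mulr0. Qed.

(** By Lucas, only the lowest base p digit of n matters when r < p. *)
Lemma bin_zres (n a : int) (b r : nat) : n = a * p%:Z + b%:Z -> (b < p)%N -> (r < p)%N ->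
  'C(zres N n, r)%:R = 'C(b, r)%:R :> k.
Proof.
move=> en hb hr.
have e : (zres N n = p * (zres N n %/ p) + b)%N.
  rewrite {1}(divn_eq (zres N n) p) mulnC; congr (_ + _)%N.
  have h1 := divz_eq n N%:Z.
  have h2 : (zres N n)%:Z = (n %% N%:Z)%Z by rewrite /zres gez0_abs ?modz_ge0 //; lia.
  have : (zres N n)%:Z = (a - (n %/ N%:Z)%Z * p%:Z) * p%:Z + b%:Z.
    by rewrite h2; apply: (addrI ((n %/ N%:Z)%Z * N%:Z)); rewrite -h1 en -mulnn PoszM; ring.
  move: (zres N n) (a - _) => z q e.
  apply/eqP; rewrite -eqz_nat -modz_nat e modzMDl modz_small //; lia.
rewrite e; have := lucas charp (zres N n %/ p) 0 hb hr.
by rewrite muln0 add0n bin0 mul1r.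
Qed.

(** Half of lam(l+1) - lam(l): the index of the divided power that leads from weight lam(l+1) down
    to lam(l). *)
Definition sgap (l : int) : nat := if (2 %| l)%Z then p.-1 else 1.

Lemma sgap_lt l : (sgap l < p)%N. Proof. by rewrite /sgap; case: ifP => _; lia. Qed.

Lemma lam_next l : lam p (l + 1) = lam p l + ((sgap l).*2)%:Z.
Proof.
have [a [->|->]] := int_parity l.
  by rewrite lam_odd lam_even /sgap dvdz_mulr //; lia.
have -> : 2 * a + 1 + 1 = 2 * (a + 1) by ring.
rewrite lam_odd lam_even /sgap ifF; last by apply/negP => /dvdzP[b]; lia.
by lia.
Qed.

(** The coefficient of E_r F_s v, with s = [sgap p l], is a binomial coefficient whose upper entry
    has lowest digit r - 1, hence zero modulo p for 0 < r <= s. *)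
Lemma gap_singular Q l v : @hull _ _ charp Q (lam p (l + 1)) v ->
  @singular _ _ charp Q (lam p l) (opF Q (sgap l) *m v) /\ opF Q (sgap l) *m v != 0.
Proof.
move=> hv; have hs := top_singular hv (hull_wt hv).
have sN : (sgap l < N)%N by apply: ltn_trans (sgap_lt l) leqpN.
split; last first.
  apply: contra (hull_low hv) => /eqP h.
  have := opFM Q (N.-1 - sgap l) (sgap l); rewrite subnK; last by rewrite -ltnS prednK.
  move=> /(congr1 (mulmx^~ v)); rewrite -mulmxA h mulmx0 -scalemxAl => /esym/eqP.
  rewrite scaler_eq0 (negbTE (binN1_neq0 charp _)) //=; lia.
split.
  by have := opF_wtv (sgap l) hs.1; rewrite lam_next addrK.
move=> r r0; rewrite (sing_EF r hs sN); case: ifP => // hr.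
have rp : (r < p)%N := leq_ltn_trans hr (sgap_lt l).
have rp1 : (r.-1 < p)%N by lia.
suff [a ea] : exists a, lam p (l + 1) + r%:Z - (sgap l)%:Z = a * p%:Z + r.-1%:Z.
  by rewrite (bin_zres ea) // bin_small ?scale0r // prednK.
have er : r.-1%:Z = r%:Z - 1 by lia.
rewrite er; move: hr; have [a [->|->]] := int_parity l.
  rewrite lam_odd /sgap dvdz_mulr // => _; exists (2 * a + 1).
  have -> : p.-1%:Z = p%:Z - 1 by lia.
  by ring.
have -> : 2 * a + 1 + 1 = 2 * (a + 1) by ring.
rewrite lam_even /sgap ifF; last by apply/negP => /dvdzP[b]; lia.
by move=> hr; exists (2 * (a + 1)); ring.
Qed.

Lemma kostant1 M r n m (q : 'M[k]_(mdim M, m)) : (0 < r)%N -> (r < N)%N -> wproj M n *m q = q ->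
  opE M r *m (opF M 1 *m q) = opF M 1 *m (opE M r *m q) + (n + r%:Z - 1)%:~R *: (opE M r.-1 *m q).
Proof.
move=> r0 hr hq; rewrite (kostant hr (N_gt1 charp) hq) big_mkcond /=.
rewrite (bigD1 (Ordinal N0)) //= (bigD1 (Ordinal (N_gt1 charp))) //= big1 ?addr0; last first.
  move=> j /andP[]; rewrite -!val_eqE /= => h1 h2.
  by rewrite [(j <= 1)%N](_ : _ = false) ?andbF //; lia.
by rewrite bin0 scale1r !subn0 r0 /= opF0 mul1mx bin1 (natr_zres charp) subn1.
Qed.

Section Special.
Variables (Q : mod) (c : int) (v q : 'cV[k]_(mdim Q)) (d : k) (lm : int).
Hypothesis hv : @hull _ _ charp Q lm v.
Hypothesis hq : wproj Q (lm - (p.-1.*2)%:Z) *m q = q.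
Local Notation y := (opF Q 1 *m q + d *: (opF Q p *m v)).
Hypothesis hy : opE Q p *m y = 0.
Let hs := top_singular hv (hull_wt hv).

Lemma above_top r n m (x : 'M_(_, m)) : wproj Q n *m x = x -> lm < n + (r.*2)%:Z -> opE Q r *m x = 0.
Proof.
move=> hx h; rewrite -(opE_wtv r hx).
have [->|/(hull_top hv)] := eqVneq (wproj Q (n + (r.*2)%:Z)) 0; first by rewrite mul0mx.
by rewrite leNgt h.
Qed.

(** This and [special_even] contain the computation for p dividing l + 1, with lm = lam(l+2). Here
    E_p y = 0 gives E_{p-1} q = - d v, and then the two terms of E_{p-1} y are opposite multiples of
    F_1 v. *)
Lemma special_odd : lm = c * N%:Z + p%:Z -> opE Q p.-1 *m y = 0.
Proof.
move=> el; have eN : N%:Z = p%:Z * p%:Z by rewrite -mulnn PoszM.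
have ep : p.-1%:Z = p%:Z - 1 by lia.
have ep2 : (p.-1.*2)%:Z = 2 * p%:Z - 2 by lia.
have pN := leqpN.
have E1 : opE Q p.-1 *m q = - (d *: v).
  have := hy; rewrite mulmxDr (kostant1 _ pN hq) // -scalemxAr (sing_EF p hs pN) leqnn subnn opF0 mul1mx.
  rewrite [opE Q p *m q](above_top hq) ?mulmx0 ?add0r; last by lia.
  have -> : lm - (p.-1.*2)%:Z + p%:Z - 1 = (c * p%:Z) * p%:Z + 1 by rewrite el ep2 eN; ring.
  rewrite rmorphD /= pcharz add0r rmorph1 scale1r.
  rewrite addrK (binp charp) el (_ : zres N _ = p) ?divnn ?p0 ?scale1r.
    by move/eqP; rewrite addr_eq0 => /eqP.
  by rewrite /zres modzMDl modz_small //; lia.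
have pN1 : (p.-1 < N)%N by lia.
rewrite mulmxDr (kostant1 _ pN1 hq); last by lia.
rewrite -scalemxAr (sing_EF _ hs pN) leq_pred E1.
have -> : lm - (p.-1.*2)%:Z + p.-1%:Z - 1 = (c * p%:Z) * p%:Z by rewrite el ep2 ep eN; ring.
rewrite pcharz scale0r addr0.
have e1 : lm + p.-1%:Z - p%:Z = (c * p%:Z) * p%:Z + p.-1%:Z by rewrite el ep eN; ring.
rewrite (bin_zres e1) ?prednK // binn scale1r.
have -> : (p - p.-1 = 1)%N by lia.
by rewrite mulmxN -scalemxAr addNr.
Qed.

(** E_p y = 0 gives E_{p-1} q = d v. Applying E_{p-2} to E_1 q = b F_{p-2} v gives b = - d, and the
    two terms of E_1 y cancel as multiples of F_{p-1} v. *)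
Lemma special_even b : lm = c * N%:Z + (p%:Z * 2 - 2) -> opE Q 1 *m q = b *: (opF Q (p - 2) *m v) ->
  opE Q 1 *m y = 0.
Proof.
move=> el hb; have eN : N%:Z = p%:Z * p%:Z by rewrite -mulnn PoszM.
have ep : p.-1%:Z = p%:Z - 1 by lia.
have ep2 : (p.-1.*2)%:Z = 2 * p%:Z - 2 by lia.
have pN := leqpN.
have p2N : (p - 2 < N)%N by lia.
have v0 : v != 0 by apply: contra (hull_low hv) => /eqP ->; rewrite mulmx0.
have m1 : p.-1%:R = -1 :> k.
  by apply/eqP; rewrite -addr_eq0 natr1 prednK // pchar_eq0.
have E1 : opE Q p.-1 *m q = d *: v.
  have := hy; rewrite mulmxDr (kostant1 _ pN hq) // -scalemxAr (sing_EF p hs pN) leqnn subnn opF0 mul1mx.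
  rewrite [opE Q p *m q](above_top hq) ?mulmx0 ?add0r; last by lia.
  have -> : lm - (p.-1.*2)%:Z + p%:Z - 1 = (c * p%:Z + 1) * p%:Z + -1 by rewrite el ep2 eN; ring.
  rewrite rmorphD /= pcharz add0r rmorphN rmorph1 scaleN1r.
  rewrite addrK (binp charp) el (_ : zres N _ = p + (p - 2))%N.
    rewrite divnDl // divnn p0 divn_small ?addn0 ?scale1r; last by lia.
    by move/eqP; rewrite addrC subr_eq0 => /eqP.
  by rewrite /zres modzMDl modz_small; nia.
have eb : b = - d.
  have := opEM Q (p - 2) 1 => /(congr1 (mulmx^~ q)); rewrite -mulmxA hb -scalemxAr.
  rewrite (sing_EF _ hs p2N) leqnn subnn opF0 mul1mx addrK.
  have e1 : lm = (c * p%:Z + 1) * p%:Z + (p - 2)%N%:Z.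
    have -> : (p - 2)%N%:Z = p%:Z - 2 by lia.
    by rewrite el eN; ring.
  rewrite (bin_zres e1) ?binn ?scale1r; try lia.
  have -> : (p - 2 + 1 = p.-1)%N by lia.
  have -> : 'C(p.-1, p - 2) = p.-1.
    have -> : (p - 2 = p.-1 - 1)%N by lia.
    by rewrite bin_sub ?bin1 //; lia.
  rewrite m1 -scalemxAl E1 scaleN1r => /eqP.
  rewrite -subr_eq0 opprK -scalerDl scaler_eq0 (negbTE v0) orbF addr_eq0.
  by move/eqP.
rewrite mulmxDr (kostant1 _ (N_gt1 charp) hq) // hb -!scalemxAr (sing_EF _ hs pN) p0 mulmxA opFM.
have -> : lm - (p.-1.*2)%:Z + 1 - 1 = (c * p%:Z) * p%:Z by rewrite el ep2 eN; ring.
rewrite pcharz scale0r addr0 !bin1 (natr_zres charp).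
have -> : lm + 1 - p%:Z = (c * p%:Z + 1) * p%:Z + -1 by rewrite el eN; ring.
rewrite rmorphD /= pcharz add0r rmorphN rmorph1 scaleN1r.
have -> : (1 + (p - 2) = p.-1)%N by lia.
by rewrite subn1 m1 eb scaleN1r mulNmx scalerN scaleNr opprK scalerN subrr.
Qed.
End Special.

(** Subtract a multiple of F_{p-2} v so that E_{p-2} kills the rest x'. If x' <> 0, the last nonzero
    E_r x' is singular with r < p - 2, and [hull_sing_cond] would make p divide r + 1 or r + 2. *)
Lemma below_top Q (a : int) v (x : 'cV[k]_(mdim Q)) : @hull _ _ charp Q (lam p (2 * a + 1)) v ->
  wproj Q (lam p (2 * a + 1) - ((p - 2).*2)%:Z) *m x = x ->
  exists b, x = b *: (opF Q (p - 2) *m v).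
Proof.
move=> hv hx; have hs := top_singular hv (hull_wt hv).
have v0 : v != 0 by apply: contra (hull_low hv) => /eqP ->; rewrite mulmx0.
have p2N : (p - 2 < N)%N by have := leqpN; lia.
have htop := opE_wtv (p - 2) hx; rewrite subrK in htop.
have [b hb] := hull_sing_uniq hv hs v0 (top_singular hv htop).
exists b; apply/eqP; rewrite -subr_eq0; set x' := x - _; apply/negPn/negP => x'0.
have hx' : wproj Q (lam p (2 * a + 1) - ((p - 2).*2)%:Z) *m x' = x'.
  by rewrite /x' mulmxBr hx -scalemxAr (opF_wtv _ hs.1).
have Ex' r : (p - 2 <= r)%N -> opE Q r *m x' = 0.
  rewrite leq_eqVlt => /orP[/eqP <-|hr]; last by apply: (above_top hv hx'); lia.
  rewrite /x' mulmxBr hb -scalemxAr (sing_EF _ hs p2N) leqnn subnn opF0 mul1mx addrK.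
  have e1 : lam p (2 * a + 1) = (2 * a + 1) * p%:Z + (p - 2)%N%:Z.
    have -> : (p - 2)%N%:Z = p%:Z - 2 by lia.
    by rewrite lam_odd; ring.
  by rewrite (bin_zres e1) ?binn ?scale1r ?subrr //; lia.
have [r hr hmax] : exists2 r, opE Q r *m x' != 0 & forall r', (r < r')%N -> opE Q r' *m x' = 0.
  have h0 : exists r, opE Q r *m x' != 0 by exists 0%N; rewrite opE0 mul1mx.
  have hb' r : opE Q r *m x' != 0 -> (r <= p - 2)%N.
    by apply: contraR; rewrite -ltnNge => h; rewrite Ex' // ltnW.
  case: (ex_maxnP h0 hb') => r hr hmax; exists r => // r' hr'.
  by apply/eqP/negPn/negP => /hmax; rewrite leqNgt hr'.
have rp : (r < p - 2)%N by rewrite ltnNge; apply: contra hr => /Ex' ->.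
have hz : @singular _ _ charp Q (lam p (2 * a + 1) - ((p - 2).*2)%:Z + (r.*2)%:Z) (opE Q r *m x').
  split; first exact: opE_wtv.
  by move=> t t0; rewrite mulmxA opEM -scalemxAl hmax ?scaler0 // -[X in (X < _)%N]add0n ltn_add2r.
have [s [hs1 hs2 _ hs3 _]] := hull_sing_cond hv hz hr.
rewrite lam_odd in hs2 hs3.
have sz : s%:Z = N%:Z - 1 - (p%:Z - 2 - r%:Z) by lia.
have eN : N%:Z = p%:Z * p%:Z by rewrite -mulnn PoszM.
have small (x0 : int) : (p%:Z %| x0)%Z -> 0 < x0 -> x0 < p%:Z -> False.
  have pz : 0 < p%:Z by lia.
  by move=> /dvdzP[q0 ->]; rewrite pmulr_lgt0 // gtr_pMl //; lia.
case/orP: hs3 => h.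
  apply: (small (r%:Z + 2)); [|lia|lia].
  have -> : r%:Z + 2 = s.+1%:Z - (p%:Z - 1) * p%:Z by rewrite intS sz eN; ring.
  by apply: rpredB => //; apply: dvdz_mull.
apply: (small (r%:Z + 1)); [|lia|lia].
have -> : r%:Z + 1 = ((2 * a + 2) * p%:Z - 2 - ((p - 2).*2)%:Z + (r.*2)%:Z - s%:Z) - (2 * a + 1 - p%:Z) * p%:Z.
  have -> : ((p - 2).*2)%:Z = 2 * p%:Z - 4 by lia.
  by rewrite -mul2n PoszM sz eN; ring.
by apply: rpredB => //; apply: dvdz_mull.
Qed.
End Gaps.

(** Equal values at an even and an odd index would make 2 a multiple of p. *)
Lemma lam_inj (p : nat) l l' : (2 < p)%N -> lam p l = lam p l' -> l = l'.
Proof.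
move=> hp; have pz : p%:Z != 0 by lia.
have np (q : int) : q * p%:Z = 2 -> False.
  move=> h; have : (p%:Z %| 2)%Z by apply/dvdzP; exists q.
  by rewrite dvdzE /= => /dvdn_leq; lia.
have [a [->|->]] := int_parity l; have [b [->|->]] := int_parity l'.
- by rewrite !lam_even => /(mulIf pz).
- by rewrite lam_even lam_odd => h; case: (np (2 * b + 2 - 2 * a)); rewrite mulrBl h; ring.
- by rewrite lam_even lam_odd => h; case: (np (2 * a + 2 - 2 * b)); rewrite mulrBl -h; ring.
- by rewrite !lam_odd => /addIr/(mulIf pz); lia.
Qed.

(** * Rank-one matrices and direct sums with one term *)

Section Sums.
Variables (k : closedFieldType) (p : nat) (charp : p \in [pchar k]).
Local Notation mod := (G2Tmod charp).

Lemma cV_linv n (z : 'cV[k]_n) : z != 0 -> exists w : 'rV_n, w *m z = 1%:M.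
Proof.
move=> z0; apply: linv_of_inj => y; rewrite [y]mx11_scalar mul_mx_scalar => /eqP.
by rewrite scaler_eq0 (negbTE z0) orbF => /eqP ->; rewrite raddf0.
Qed.

Lemma rank1_mx m n (T : 'M[k]_(m, n)) z : (forall c, exists a, col c T = a *: z) ->
  exists xi : 'rV_n, T = z *m xi.
Proof.
move=> /choice[a ha]; exists (\row_c a c); apply/matrixP => i c.
have /colP/(_ i) := ha c; rewrite mxE mxE [a c * _]mulrC => ->.
by rewrite mxE big_ord1 mxE.
Qed.

Lemma mod_eq (M L : mod) (e : mdim M = mdim L) :
  (forall (A : comAlgType k) (g : G2T p A), castmx (e, e) (act M g) = act L g) -> M = L.
Proof.
case: M L e => d a h1 hM hm [d' a' h1' hM' hm'] /= e; case: _ / e a' h1' hM' hm' => a' h1' hM' hm' h.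
have ea : a = a'.
  apply: functional_extensionality_dep => A; apply: functional_extensionality_dep => g.
  by rewrite -h castmx_id.
case: _ / ea h1' hM' hm' {h} => h1' hM' hm'.
by congr MkG2Tmod; apply: Prop_irrelevance.
Qed.

(** An equality and not just an isomorphism: [gen_dsum] only produces morphisms between direct sums,
    so P i has to be literally a sum with one term. *)
Lemma dsum1 (M : mod) : dsum (fun _ : 'I_1 => M) = M.
Proof.
apply: (@mod_eq (dsum (fun _ : 'I_1 => M)) M (big_ord1 _ _)) => A g.
apply/matrixP => i j; rewrite castmxE /= mxE.
have val2 (c : 'I_(\sum_(i < 1) mdim M)) : tagnat.sig2 c = c :> nat.
  by rewrite [RHS]tagnat.rect big1 // => a; rewrite (ord1 (tagnat.sig1 c)).
set x := cast_ord _ i; set y := cast_ord _ j.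
have ex : nat_of_ord (tagnat.sig2 x) = i by rewrite val2.
have ey : nat_of_ord (tagnat.sig2 y) = j by rewrite val2.
move: (tagnat.sig1 x) (tagnat.sig2 x) (tagnat.sig1 y) (tagnat.sig2 y) ex ey.
move=> s1 s2 t1 t2 ex ey.
rewrite (ord1 s1) (ord1 t1) eqxx conform_mx_id.
by congr (act M g _ _); apply/val_inj.
Qed.
End Sums.

(** * Generation *)

Section Generators.
Variables (k : closedFieldType) (p : nat) (charp : p \in [pchar k]).
Local Notation N := (p ^ 2)%N.
Local Notation mod := (G2Tmod charp).
Hypothesis hp : (2 < p)%N.
Variables (Delta P : int -> mod).
Hypothesis hDelta : forall n, is_Delta2 n (Delta n).
Hypothesis hP : forall i, is_T2 (lam p i) (P i).
Hypothesis hPtwist : forall i a : int, P (i + 2 * a * p%:Z) = twist (P i) (2 * a).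
Variable phi : forall i, 'M[k]_(mdim (P i)).
Hypothesis hphi : forall i, is_symform (phi i).
Variables (u : forall i : int, 'M[k]_(mdim (P (i + 1)), mdim (P i)))
  (u' : forall i : int, 'M[k]_(mdim (P (u'_target p i)), mdim (P i))).
Hypothesis hu : forall i : int, u_range p i ->
     @is_gbar k p charp (Delta (lam p i)) (P i) (P (i + 1)) (u i).
Hypothesis hu' : forall i : int, u'_range p i ->
     @is_gbar k p charp (Delta (lam p i)) (P i) (P (u'_target p i)) (u' i).
Implicit Types M L Q : mod.
Let N0 : (0 < N)%N := N_gt0 charp.
Let p0 : (0 < p)%N := p_gt0 charp.
Let p1 : (1 < p)%N := ltnW hp.

Lemma phi_unit i : phi i \in unitmx.
Proof. by have [[_ [g [_ _ h]]] _] := hphi i; have [] := mulmx1_unit h. Qed.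

Lemma phi_sym i : (phi i)^T = phi i. Proof. by have [] := hphi i. Qed.

Lemma phi_op i o : (op (P i) (oswap o))^T *m phi i = phi i *m op (P i) o.
Proof. by have [[h _] _] := hphi i; rewrite -(is_hom_op h) op_tau. Qed.

(** [tau_hull] concerns the tau-dual; the form phi i carries the hull structure back to P i, which
    is thus injective as well as projective. *)
Lemma P_hull i : exists v, @hull _ _ charp (P i) (lam p i) v.
Proof.
have [hPi iPi hmi] := hP i.
have [v hv] := tau_hull hPi (idem_trivial_indec iPi) hmi.
have [h _] := hphi i; apply: hull_iso hv.
by apply: isomorphic_sym; exists (phi i).
Qed.

Definition dag i j (f : 'M[k]_(mdim (P j), mdim (P i))) : 'M[k]_(mdim (P i), mdim (P j)) :=
  invmx (phi i) *m f^T *m phi j.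

Lemma dag_hom i j (f : 'M[k]_(mdim (P j), mdim (P i))) : is_hom f ->
  @is_hom _ _ charp (P j) (P i) (dag f).
Proof.
move=> hf; apply/hom_op => o; rewrite /dag.
apply: (can_inj (mulKmx (phi_unit i))).
rewrite !mulmxA -phi_op mulmxV ?phi_unit // mul1mx.
rewrite -[_^T *m phi i *m _]mulmxA mulmxV ?phi_unit // mulmx1.
rewrite -[RHS]mulmxA -phi_op !mulmxA -!trmx_mul.
by rewrite (is_hom_op hf).
Qed.

(** * Generated maps that do not kill a highest weight vector *)

Definition nonzero_at M L n : Prop := exists f : 'M[k]_(mdim L, mdim M),
  [/\ @generated _ _ charp P phi u u' M L f, is_hom f & exists2 x : 'cV_(mdim M), wproj M n *m x = x & f *m x != 0].

Lemma nonzero_at_twist M L n a : a = 2 \/ a = -2 -> nonzero_at M L n ->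
  nonzero_at (twist M a) (twist L a) (n + a * N%:Z).
Proof.
move=> ha [f [gf hf [x hx fx]]]; exists f; split.
- exact: gen_twist.
- exact: hom_twist.
- by exists x => //; apply: wproj_twist.
Qed.

Lemma lam_shift l a : lam p (l + 2 * a * p%:Z) = lam p l + 2 * a * N%:Z.
Proof.
have [b [->|->]] := int_parity l.
  have -> : 2 * b + 2 * a * p%:Z = 2 * (b + a * p%:Z) by ring.
  by rewrite !lam_even -mulnn PoszM; ring.
have -> : 2 * b + 1 + 2 * a * p%:Z = 2 * (b + a * p%:Z) + 1 by ring.
by rewrite !lam_odd -mulnn PoszM; ring.
Qed.

Definition linked l j := nonzero_at (P l) (P j) (lam p l).

Lemma linked_shift1 l j a : a = 1 \/ a = -1 -> linked l j ->
  linked (l + 2 * a * p%:Z) (j + 2 * a * p%:Z).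
Proof.
move=> ha h; rewrite /linked !hPtwist lam_shift; apply: nonzero_at_twist => //.
by case: ha => ->; [left|right].
Qed.

(** Twists by 2 and -2 move both indices by 2p in one direction or the other; iterating them allows
    l to be moved into one period. *)
Lemma linked_shift l j a : linked (l + 2 * a * p%:Z) (j + 2 * a * p%:Z) -> linked l j.
Proof.
case: a => n.
  elim: n => [|n IH]; first by rewrite mulr0 mul0r !addr0.
  move=> /(@linked_shift1 _ _ (-1) (or_intror erefl)) h; apply: IH; move: h.
  have e i : i + 2 * n.+1%:Z * p%:Z + 2 * -1 * p%:Z = i + 2 * n%:Z * p%:Z.
    by rewrite intS; ring.
  by rewrite !e.
rewrite NegzE; elim: n.+1 => {n} [|n IH]; first by rewrite oppr0 mulr0 mul0r !addr0.
move=> /(@linked_shift1 _ _ 1 (or_introl erefl)) h; apply: IH; move: h.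
have e i : i + 2 * - n.+1%:Z * p%:Z + 2 * 1 * p%:Z = i + 2 * - n%:Z * p%:Z.
  by rewrite intS; ring.
by rewrite !e.
Qed.

(** The top weight space is a line, so being nonzero on it means being nonzero on v. *)
Lemma linked_v l j v : linked l j -> @hull _ _ charp (P l) (lam p l) v ->
  exists f : 'M[k]_(mdim (P j), mdim (P l)),
  [/\ @generated _ _ charp P phi u u' (P l) (P j) f, is_hom f & f *m v != 0].
Proof.
move=> [f [gf hf [x hx fx]]] hv; exists f; split=> //.
have v0 : v != 0 by apply: contra (hull_low hv) => /eqP ->; rewrite mulmx0.
have [c hc] := hull_sing_uniq hv (top_singular hv (hull_wt hv)) v0 (top_singular hv hx).
by apply: contra fx => /eqP fv; rewrite hc -scalemxAr fv scaler0.
Qed.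

Lemma linked_u l : u_range p l -> linked l (l + 1).
Proof.
move=> hl; have [v hv] := P_hull l; have h := hu hl.
exists (u l); split; [exact: gen_u|by case: h|exists v; first exact: hull_wt hv].
exact: gbar_top hv (hDelta _) h.
Qed.

Lemma linked_u' l : u'_range p l -> linked l (u'_target p l).
Proof.
move=> hl; have [v hv] := P_hull l; have h := hu' hl.
exists (u' l); split; [exact: gen_u'|by case: h|exists v; first exact: hull_wt hv].
exact: gbar_top hv (hDelta _) h.
Qed.

Lemma linked_id l : linked l l.
Proof.
have [v hv] := P_hull l; exists 1%:M; split; [exact/gen_id/is_sumP_base|exact: hom_id|].
exists v; first exact: hull_wt hv.
by rewrite mul1mx; apply: contra (hull_low hv) => /eqP ->; rewrite mulmx0.
Qed.

Lemma period (l : int) : exists a : int, - p%:Z <= l + 2 * a * p%:Z <= p%:Z - 1.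
Proof.
have h := divz_eq (l + p%:Z) (2 * p%:Z).
have pz : 2 * p%:Z != 0 :> int by lia.
have h2 := modz_ge0 (l + p%:Z) pz.
have h3 : ((l + p%:Z) %% (2 * p%:Z))%Z < 2 * p%:Z by rewrite ltz_mod.
move: (_ %/ _)%Z (_ %% _)%Z h h2 h3 => q r h h2 h3.
exists (- q); have -> : l = q * (2 * p%:Z) + r - p%:Z by rewrite -h; ring.
have -> : q * (2 * p%:Z) + r - p%:Z + 2 * - q * p%:Z = r - p%:Z by ring.
by lia.
Qed.

Lemma dvdz_shift l a : (p%:Z %| l + 2 * a * p%:Z)%Z = (p%:Z %| l)%Z.
Proof. by rewrite rpredDr // dvdz_mull. Qed.

(* Reflection of l in the next multiple of p above it. *)
Lemma linked_refl l t : (0 < t < p)%N -> (p%:Z %| l + t%:Z)%Z -> linked l (l + (t.*2)%:Z).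
Proof.
move=> ht hd; have [a ha] := period l; apply: (@linked_shift _ _ a).
have hd' : (p%:Z %| l + 2 * a * p%:Z + t%:Z)%Z.
  have -> : l + 2 * a * p%:Z + t%:Z = l + t%:Z + 2 * a * p%:Z by ring.
  by rewrite dvdz_shift.
have -> : l + (t.*2)%:Z + 2 * a * p%:Z = l + 2 * a * p%:Z + (t.*2)%:Z by ring.
move: (l + 2 * a * p%:Z) ha hd' => {l hd} l hl hd.
have hz : l + t%:Z = 0 \/ l + t%:Z = p%:Z.
  have /dvdzP[q hq] := hd.
  have : q = 0 \/ q = 1 by nia.
  by rewrite hq; case=> ->; [left|right]; ring.
have hr : u'_range p l by rewrite /u'_range; lia.
have -> : l + (t.*2)%:Z = u'_target p l by rewrite /u'_target; case: ifP; lia.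
exact: linked_u'.
Qed.

(** Within the period from -p to p - 1, p divides l + 1 exactly for l = -1 and l = p - 1, the two
    indices for which no u_l is given. *)
Lemma linked_next l : ~~ (p%:Z %| l + 1)%Z -> linked l (l + 1).
Proof.
move=> hd; have [a ha] := period l; apply: (@linked_shift _ _ a).
have hd' : ~~ (p%:Z %| l + 2 * a * p%:Z + 1)%Z.
  have -> : l + 2 * a * p%:Z + 1 = l + 1 + 2 * a * p%:Z by ring.
  by rewrite dvdz_shift.
have -> : l + 1 + 2 * a * p%:Z = l + 2 * a * p%:Z + 1 by ring.
move: (l + 2 * a * p%:Z) ha hd' => {l hd} l hl hd.
apply: linked_u; apply/and3P; split; [lia| |].
  have : l != p%:Z - 1 by apply: contra hd => /eqP ->; rewrite subrK dvdzz.
  by lia.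
by apply: contra hd => /eqP ->; rewrite addNr dvdz0.
Qed.

Lemma lam_add2 (l : int) (t : nat) : lam p (l + (t.*2)%:Z) = lam p l + ((t * p).*2)%:Z.
Proof.
rewrite -!mul2n !PoszM; have [a [->|->]] := int_parity l.
  have -> : 2 * a + 2%N%:Z * t%:Z = 2 * (a + t%:Z) by ring.
  by rewrite !lam_even; ring.
have -> : 2 * a + 1 + 2%N%:Z * t%:Z = 2 * (a + t%:Z) + 1 by ring.
by rewrite !lam_odd; ring.
Qed.

Lemma hom_singular i j (f : 'M[k]_(mdim (P j), mdim (P i))) n x : is_hom f ->
  @singular _ _ charp (P i) n x -> @singular _ _ charp (P j) n (f *m x).
Proof.
move=> hf [hx hs]; split.
  by rewrite mulmxA [_ *m f](is_hom_op hf (OW n)) /= -mulmxA hx.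
by move=> r r0; rewrite mulmxA [_ *m f](is_hom_op hf (OE r)) /= -mulmxA hs // mulmx0.
Qed.

(** The composite g f, with f : P_l -> P_{l+1} and g the reflection of l + 1. By uniqueness f v is a
    nonzero multiple of F_a v1 with a = [sgap p l], so F_a (g v1) <> 0 is needed. This vector
    divides F_s (g v1) <> 0 with factor binom(s, a), nonzero since the lowest base p digit of s is p
    - 1. *)
Lemma linked_next_refl l t : (0 < t < p)%N -> (p%:Z %| l + 1 + t%:Z)%Z ->
  linked l (l + 1 + (t.*2)%:Z).
Proof.
move=> ht hd; have nd : ~~ (p%:Z %| l + 1)%Z.
  apply/negP => h; have : (p%:Z %| t%:Z)%Z by rewrite -[t%:Z](addKr (l + 1)) rpredD ?rpredN.
  by rewrite dvdzE /= => /dvdn_leq; lia.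
have [v hv] := P_hull l; have [v1 hv1] := P_hull (l + 1).
have [v2 hv2] := P_hull (l + 1 + (t.*2)%:Z).
have [f [gf hf fv]] := linked_v (linked_next nd) hv.
have [g [gg hg gv]] := linked_v (linked_refl ht hd) hv1.
exists (g *m f); split; [exact: gen_comp gf gg|exact: hom_comp|exists v; first exact: hull_wt hv].
have [s1 s10] := gap_singular hp hv1.
have [c hc] := hull_sing_uniq hv1 s1 s10 (hom_singular hf (top_singular hv (hull_wt hv))).
have c0 : c != 0 by apply: contra fv => /eqP c0; rewrite hc c0 scale0r.
rewrite -mulmxA hc -scalemxAr scaler_eq0 (negbTE c0) /= mulmxA -[g *m _](is_hom_op hg (OF _)) /= -mulmxA.
have hz := hom_singular hg (top_singular hv1 (hull_wt hv1)).
have [s [sN es [c' c'0 hs]]] := hull_sing hv2 hz gv.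
rewrite lam_add2 in es.
have sE : (s = p * (p.-1 - t) + p.-1)%N.
  have : (s + t * p = N.-1)%N by lia.
  have -> : (N.-1 = p * p.-1 + p.-1)%N.
    by rewrite -mulnn; case: (p) p0 => // p' _ /=; rewrite mulnS; lia.
  rewrite mulnBr [(t * p)%N]mulnC => h1.
  have h2 : (p * t <= p * p.-1)%N by rewrite leq_mul2l; lia.
  by lia.
have sl := sgap_lt charp hp l.
have sls : (sgap p l <= s)%N by rewrite sE; apply: leq_trans (leq_addl _ _); rewrite -ltnS prednK.
apply/negP => /eqP h0.
have /eqP : 'C(s, sgap p l)%:R *: (opF _ s *m (g *m v1)) = 0.
  have := opFM (P (l + 1 + (t.*2)%:Z)) (s - sgap p l) (sgap p l).
  rewrite subnK // bin_sub // => /(congr1 (mulmx^~ (g *m v1))).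
  by rewrite -mulmxA h0 mulmx0 -scalemxAl.
have hb : 'C(s, sgap p l)%:R != 0 :> k.
  rewrite sE -[X in 'C(_, X)]add0n -(muln0 p) (lucas charp) ?prednK // bin0 mul1r.
  by apply: (bin_lt_neq0 charp); [rewrite prednK|rewrite -ltnS prednK].
by rewrite scaler_eq0 (negbTE hb) hs scaler_eq0 (negbTE c'0) (negbTE (hull_low hv2)).
Qed.

(** * The contravariant form and the case where p divides l + 1 *)

Lemma phi_E i r : (opE (P i) r)^T *m phi i = phi i *m opF (P i) r.
Proof. exact: (phi_op i (OF r)). Qed.
Lemma phi_F i r : (opF (P i) r)^T *m phi i = phi i *m opE (P i) r.
Proof. exact: (phi_op i (OE r)). Qed.
Lemma phi_W i n : (wproj (P i) n)^T *m phi i = phi i *m wproj (P i) n.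
Proof. exact: (phi_op i (OW n)). Qed.

(* Under the contravariant form, the orthogonal of the image of F_1 and F_p is
   the space of vectors killed by E_1 and E_p. *)
Lemma orth_singular i n z (y : 'cV[k]_(mdim (P i))) : @singular _ _ charp (P i) n z -> z != 0 ->
  wproj (P i) n *m y = y -> y^T *m phi i *m z = 0 ->
  exists q q', [/\ wproj (P i) (n + 2) *m q = q, wproj (P i) (n + (p.*2)%:Z) *m q' = q' &
     y = opF (P i) 1 *m q + opF (P i) p *m q'].
Proof.
move=> hz z0 hy yz; have [v hv] := P_hull i.
pose A := row_mx (opF (P i) 1) (opF (P i) p).
have [hsub|hns] := boolP (y^T <= A^T)%MS.
  have /submxP[D hD] := hsub.
  have yE : y = A *m D^T by apply: trmx_inj; rewrite trmx_mul trmxK.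
  exists (wproj (P i) (n + 2) *m usubmx D^T), (wproj (P i) (n + (p.*2)%:Z) *m dsubmx D^T).
  split; rewrite ?mulmxA ?wprojM ?eqxx ?scale1r //.
  have e1 : n + 2 - (1.*2)%:Z = n by rewrite addrK.
  rewrite -!opF_wt e1 addrK -!mulmxA -mulmxDr -[LHS]hy; congr (_ *m _).
  by rewrite {1}yE -{1}[D^T]vsubmxK mul_row_col.
have [j hj] : exists j, y^T *m col j (cokermx A^T) != 0.
  apply: contrapT => hno; move: hns; rewrite submxE => /negP; apply.
  apply/eqP/matrixP => a j; rewrite (ord1 a) [RHS]mxE.
  have /matrixP/(_ 0 0) : y^T *m col j (cokermx A^T) = 0.
    by apply/eqP/negPn/negP => h; apply: hno; exists j.
  by rewrite [RHS]mxE => <-; rewrite !mxE; apply: eq_bigr => b _; rewrite [col _ _ _ _]mxE.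
set xi := col j _ in hj.
have hA : A^T *m xi = 0 by rewrite /xi colE mulmxA mulmx_coker mul0mx.
move: hA; rewrite tr_row_mx mul_col_mx -[0]col_mx0 => /eq_col_mx[h1 h2].
pose z' := invmx (phi i) *m xi.
have xiE : xi = phi i *m z' by rewrite mulKVmx ?phi_unit.
have kill r : (opF (P i) r)^T *m xi = 0 -> opE (P i) r *m z' = 0.
  by rewrite xiE mulmxA phi_F -mulmxA => /(congr1 (mulmx (invmx (phi i)))); rewrite mulKmx ?phi_unit // mulmx0.
have hz' : @singular _ _ charp (P i) n (wproj (P i) n *m z').
  apply: singular_E1p; first by rewrite mulmxA wprojM eqxx scale1r.
    by rewrite mulmxA -opE_wt -mulmxA kill ?mulmx0.
  by rewrite mulmxA -opE_wt -mulmxA kill ?mulmx0.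
have [c hc] := hull_sing_uniq hv hz z0 hz'.
case/eqP: hj; rewrite xiE -hy trmx_mul -mulmxA [_ *m (phi i *m _)]mulmxA phi_W -mulmxA hc.
by rewrite -!scalemxAr mulmxA yz scaler0.
Qed.

(** The adjoint of [gap_singular]: under the form, E_s from weight lam(l) to lam(l+1) is dual to F_s
    in the opposite direction, which is nonzero. *)
Lemma exists_raise l v : @hull _ _ charp (P (l + 1)) (lam p (l + 1)) v ->
  exists2 x : 'cV_(mdim (P (l + 1))), wproj (P (l + 1)) (lam p l) *m x = x & opE (P (l + 1)) (sgap p l) *m x = v.
Proof.
move=> hv; have [s1 s10] := gap_singular hp hv.
have v0 : v != 0 by apply: contra (hull_low hv) => /eqP ->; rewrite mulmx0.
set T := opE (P (l + 1)) (sgap p l) *m wproj (P (l + 1)) (lam p l).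
have T0 : T != 0.
  apply: contra s10 => /eqP h; rewrite -s1.1 mulmxA.
  have e : phi (l + 1) *m (wproj (P (l + 1)) (lam p l) *m opF (P (l + 1)) (sgap p l)) = 0.
    by rewrite mulmxA -phi_W -mulmxA -phi_E mulmxA -trmx_mul -/T h trmx0 mul0mx.
  by rewrite -[wproj _ _ *m _](mulKmx (phi_unit (l + 1))) e mulmx0 mul0mx.
have [j hj] := col_neq0 T0.
pose x := col j (wproj (P (l + 1)) (lam p l)).
have hx : wproj (P (l + 1)) (lam p l) *m x = x by rewrite /x colE mulmxA wprojM eqxx scale1r.
have hE : opE (P (l + 1)) (sgap p l) *m x = col j T by rewrite /x !colE mulmxA.
have hw : wproj (P (l + 1)) (lam p (l + 1)) *m col j T = col j T.
  by rewrite -hE (lam_next charp hp) opE_wtv.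
have [c hc] := hull_sing_uniq hv (top_singular hv (hull_wt hv)) v0 (top_singular hv hw).
have c0 : c != 0 by apply: contra hj => /eqP c0; rewrite hc c0 scale0r.
exists (c^-1 *: x); first by rewrite -scalemxAr hx.
by rewrite -scalemxAr hE hc scalerA mulVf // scale1r.
Qed.

(** With h : P_l -> P_{l+2} and g : P_{l+1} -> P_{l+2}, suppose g^dagger h v = 0. Then y = g x is
    orthogonal to z = h v for every x of weight lam(l). Choosing x with E_s x = v1, s = [sgap p l],
    makes E_s y = g v1 nonzero, while [orth_singular] and the special computations give E_s y =
    0. *)
Lemma linked_next0 l : (p%:Z %| l + 1)%Z -> linked l (l + 1).
Proof.
move=> hd.
have nd : ~~ (p%:Z %| l + 1 + 1)%Z.
  apply/negP => h; have : (p%:Z %| 1%:Z)%Z by rewrite -[1%:Z](addKr (l + 1)) rpredD ?rpredN.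
  by rewrite dvdzE /= dvdn1; lia.
have e2 : l + (1.*2)%:Z = l + 1 + 1 by rewrite -addrA.
have h2 : linked l (l + 1 + 1) by rewrite -e2; apply: linked_refl => //; apply: ltnW.
have elam : lam p (l + 1 + 1) = lam p l + (p.*2)%:Z by rewrite -e2 lam_add2 mul1n.
have [v hv] := P_hull l; have [v1 hv1] := P_hull (l + 1); have [v2 hv2] := P_hull (l + 1 + 1).
have [h [gh hh hhv]] := linked_v h2 hv.
have [g [gg hg gv]] := linked_v (linked_next nd) hv1.
exists (dag g *m h); split.
- apply: (gen_comp gh); exact: gen_dual gg (phi_ext_base _ _) (phi_ext_base _ _).
- by apply: hom_comp => //; apply: dag_hom.
exists v; first exact: hull_wt hv.
rewrite -mulmxA; set z := h *m v in hhv *; apply/negP => /eqP.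
rewrite /dag -!mulmxA => /(congr1 (mulmx (phi (l + 1)))).
rewrite mulKVmx ?phi_unit // mulmx0 => gz.
have hz : @singular _ _ charp (P (l + 1 + 1)) (lam p l) z.
  exact: hom_singular hh (top_singular hv (hull_wt hv)).
have [x hx ex] := exists_raise hv1.
pose y := g *m x.
have hyw : wproj (P (l + 1 + 1)) (lam p l) *m y = y.
  by rewrite mulmxA [_ *m g](is_hom_op hg (OW _)) /= -mulmxA hx.
have yz : y^T *m phi (l + 1 + 1) *m z = 0 by rewrite trmx_mul -!mulmxA gz mulmx0.
have Ey : opE (P (l + 1 + 1)) (sgap p l) *m y = g *m v1.
  by rewrite mulmxA [_ *m g](is_hom_op hg (OE _)) /= -mulmxA ex.
(* The weight lam(l) + 2p lies above the highest weight of P_{l+1}, because [sgap p l] < p. *)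
have Epy : opE (P (l + 1 + 1)) p *m y = 0.
  rewrite mulmxA [_ *m g](is_hom_op hg (OE _)) /= -mulmxA (above_top hv1 hx) ?mulmx0 //.
  by rewrite (lam_next charp hp); have := sgap_lt charp hp l; lia.
have [q [q' [hq hq' ey]]] := orth_singular hz hhv hyw yz.
rewrite -elam in hq'.
have v20 : v2 != 0 by apply: contra (hull_low hv2) => /eqP ->; rewrite mulmx0.
have [d hd'] := hull_sing_uniq hv2 (top_singular hv2 (hull_wt hv2)) v20 (top_singular hv2 hq').
rewrite hd' -scalemxAr in ey.
have hqw : wproj (P (l + 1 + 1)) (lam p (l + 1 + 1) - (p.-1.*2)%:Z) *m q = q.
  by rewrite elam (_ : _ - _ = lam p l + 2) //; lia.
have hy0 : opE (P (l + 1 + 1)) p *m (opF _ 1 *m q + d *: (opF _ p *m v2)) = 0 by rewrite -ey.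
have eN : N%:Z = p%:Z * p%:Z by rewrite -mulnn PoszM.
case/negP: gv; rewrite -Ey ey; apply/eqP.
have [b hb] := dvdzP hd; have [a [la|la]] := int_parity l.
  have -> : sgap p l = p.-1 by rewrite /sgap la dvdz_mulr.
  apply: (special_odd (c := b) hp hv2 hqw hy0).
  by rewrite la (_ : 2 * a + 1 + 1 = 2 * (a + 1)) ?lam_even ?eN; [move: hb; rewrite la|]; lia.
have -> : sgap p l = 1%N by rewrite /sgap la ifF //; apply/negP => /dvdzP[]; lia.
have e3 : l + 1 + 1 = 2 * (a + 1) + 1 by rewrite la; ring.
have elm : lam p (l + 1 + 1) = lam p (2 * (a + 1) + 1) by rewrite e3.
have hE1 : wproj (P (l + 1 + 1)) (lam p (2 * (a + 1) + 1) - ((p - 2).*2)%:Z) *m (opE _ 1 *m q) = opE _ 1 *m q.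
  have -> : lam p (2 * (a + 1) + 1) - ((p - 2).*2)%:Z = lam p (l + 1 + 1) - (p.-1.*2)%:Z + (1.*2)%:Z.
    by rewrite elm; lia.
  exact: opE_wtv.
have hv2' : @hull _ _ charp (P (l + 1 + 1)) (lam p (2 * (a + 1) + 1)) v2 by rewrite -elm.
have [b' hb'] := below_top hp hv2' hE1.
apply: (special_even (c := b) hp hv2 hqw hy0 _ hb').
by rewrite elm lam_odd eN; move: hb; rewrite la; lia.
Qed.

(** Each solution of the congruences in [sing_weight] is realised by one of the generated maps
    constructed above. *)
Lemma singular_linked j n z : @singular _ _ charp (P j) n z -> z != 0 ->
  exists l, n = lam p l /\ linked l j.
Proof.
move=> hz z0; have [v hv] := P_hull j.
have [s [sN es _ c1 c2]] := hull_sing_cond hv hz z0.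
have [l [t [hn ht hj]]] := sing_weight p1 sN es c1 c2.
exists l; split=> //; case: hj => -[-> ht'].
  have [->|t0] := posnP t; first by rewrite addr0; apply: linked_id.
  case: ht' => h; first by rewrite h in t0.
  by apply: linked_refl => //; rewrite t0.
have [->|t0] := posnP t.
  rewrite addr0; case: (boolP (p%:Z %| l + 1)%Z) => h; [exact: linked_next0|exact: linked_next].
case: ht' => h; first by rewrite h in t0.
by apply: linked_next_refl => //; rewrite t0.
Qed.

Lemma hom_wproj i j (f : 'M[k]_(mdim (P j), mdim (P i))) n : is_hom f ->
  wproj (P j) n *m f = f *m wproj (P i) n.
Proof. by move=> hf; exact: (is_hom_op hf (OW n)). Qed.

(* Restricted to its highest weight n, f is x |-> c (x, z') z for singular vectors
   z of P j and z' of P i; when n = lam l these are the images of the highest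
   weight vector of P l under generated maps g_j and g_i, so that f is there a
   multiple of g_j g_i^dagger. *)
Lemma top_component i j (f : 'M[k]_(mdim (P j), mdim (P i))) n : is_hom f ->
  (forall n', n < n' -> f *m wproj (P i) n' = 0) -> f *m wproj (P i) n != 0 ->
  exists D : 'M[k]_(mdim (P j), mdim (P i)),
    [/\ @generated _ _ charp P phi u u' (P i) (P j) D, is_hom D,
        forall n', n < n' -> D *m wproj (P i) n' = 0 &
        f *m wproj (P i) n = D *m wproj (P i) n].
Proof.
move=> hf habove T0; set T := f *m wproj (P i) n in T0 *.
have [b hb] := col_neq0 T0.
have hE r : (0 < r)%N -> opE (P j) r *m T = 0.
  move=> r0; rewrite /T mulmxA [_ *m f](is_hom_op hf (OE r)) /= -mulmxA -opE_wt mulmxA.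
  by rewrite habove ?mul0mx //; lia.
have hF r : (0 < r)%N -> T *m opF (P i) r = 0.
  move=> r0; have := opF_wt (P i) r (n + (r.*2)%:Z); rewrite addrK => e.
  rewrite /T -mulmxA e mulmxA -[f *m _](is_hom_op hf (OF r)) /= -mulmxA.
  by rewrite habove ?mulmx0 //; lia.
have hsing c : @singular _ _ charp (P j) n (col c T).
  split; first by rewrite colE mulmxA /T mulmxA (hom_wproj _ hf) -[_ *m _ *m wproj _ n]mulmxA wprojM eqxx scale1r.
  by move=> r r0; rewrite colE mulmxA hE // mul0mx.
set z := col b T in hb; have hz : singular n z := hsing b.
have [v1 hv1] := P_hull i; have [v2 hv2] := P_hull j.
have [xi eT] : exists xi : 'rV_(mdim (P i)), T = z *m xi.
  apply: rank1_mx => c; have h := hull_sing_uniq hv2 hz hb (hsing c). exact: h.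
have [w hw] := cV_linv hb.
have exi : xi = w *m T by rewrite eT mulmxA hw mul1mx.
have xi0 : xi != 0 by apply: contra T0 => /eqP h; rewrite eT h mulmx0.
(* z' represents the functional xi by the form: xi = z'^T phi. It is singular because T kills the
   images of the F_r with r > 0. *)
pose z' := invmx (phi i) *m xi^T.
have z'E : phi i *m z' = xi^T by rewrite mulKVmx ?phi_unit.
have z'0 : z' != 0.
  apply: contra xi0 => /eqP h; rewrite -[xi]trmxK -z'E h mulmx0 trmx0.
  by [].
have hz' : @singular _ _ charp (P i) n z'.
  split.
    rewrite -[LHS](mulKmx (phi_unit i)) [phi i *m _]mulmxA -phi_W -mulmxA z'E -trmx_mul.
    by rewrite (_ : xi *m _ = xi) // exi /T -!mulmxA wprojM eqxx scale1r.
  move=> r r0; rewrite -[LHS](mulKmx (phi_unit i)) [phi i *m _]mulmxA -phi_F -mulmxA z'E -trmx_mul.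
  by rewrite exi -mulmxA hF // mulmx0 trmx0 mulmx0.
have [l [en gj]] := singular_linked hz hb.
have [l' [en' gi]] := singular_linked hz' z'0.
have el : l' = l by apply: (lam_inj hp); rewrite -en -en'.
rewrite {}el {en' l'} in gi.
have [v hv] := P_hull l; have v0 : v != 0 by apply: contra (hull_low hv) => /eqP ->; rewrite mulmx0.
have sv := top_singular hv (hull_wt hv).
have [hj [ghj hhj hjv]] := linked_v gj hv.
have [hi [ghi hhi hiv]] := linked_v gi hv.
have [c2 ec2] : exists c, hj *m v = c *: z.
  by apply: (hull_sing_uniq hv2 hz hb); rewrite en; apply: hom_singular hhj sv.
have c20 : c2 != 0 by apply: contra hjv => /eqP h; rewrite ec2 h scale0r.
have [c1 ec1] : exists c, hi *m v = c *: z'.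
  by apply: (hull_sing_uniq hv1 hz' z'0); rewrite en; apply: hom_singular hhi sv.
have c10 : c1 != 0 by apply: contra hiv => /eqP h; rewrite ec1 h scale0r.
have [eta eeta] : exists eta : 'rV_(mdim (P l)), wproj (P l) n = v *m eta.
  apply: rank1_mx => c; apply: (hull_sing_uniq hv sv v0); apply: (top_singular hv).
  by rewrite -en colE mulmxA wprojM eqxx scale1r.
have [wv hwv] := cV_linv v0.
(* The projection v eta is self-adjoint for the form, so v kap is a symmetric matrix of rank one,
   and kap must be a multiple of v^T. *)
pose kap := eta *m invmx (phi l).
have ekap : v *m kap = kap^T *m v^T.
  rewrite /kap trmx_mul -mulmxA -trmx_mul -eeta mulmxA -eeta trmx_inv phi_sym.
  by rewrite -[RHS](mulmxK (phi_unit l)) -[_ *m phi l]mulmxA phi_W mulKmx ?phi_unit.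
have [d ed] : exists d, kap = d *: v^T.
  exists ((wv *m kap^T) 0 0); rewrite -[kap in LHS]mul1mx -hwv -mulmxA ekap mulmxA.
  by rewrite [wv *m _ in LHS]mx11_scalar mul_scalar_mx.
have d0 : d != 0.
  apply: contra v0 => /eqP h; have := hull_wt hv; rewrite -en eeta => <-.
  have -> : eta = 0 by rewrite -[eta](mulmxKV (phi_unit l)) -/kap ed h scale0r mul0mx.
  by rewrite mulmx0 mul0mx.
have hD0 : @is_hom _ _ charp (P i) (P j) (hj *m dag hi).
  by apply: hom_comp => //; apply: dag_hom.
have hdag n' : wproj (P l) n' *m dag hi = dag hi *m wproj (P i) n' := hom_wproj n' (dag_hom hhi).
have eD : hj *m dag hi *m wproj (P i) n = (c2 * (d * c1)) *: T.
  rewrite -mulmxA -hdag eeta -!mulmxA [hj *m _]mulmxA ec2 /dag !mulmxA -[_ *m eta *m _]mulmxA -/kap ed.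
  rewrite -!(scalemxAl, scalemxAr) -[z *m _ *m _]mulmxA -trmx_mul ec1.
  rewrite [(c1 *: z')^T]linearZ /= -!(scalemxAl, scalemxAr) -mulmxA.
  have -> : z'^T *m phi i = xi by rewrite -[phi i]phi_sym -trmx_mul z'E trmxK.
  by rewrite -eT !scalerA; congr (_ *: _); ring.
exists ((c2 * (d * c1))^-1 *: (hj *m dag hi)); split.
- rewrite -[_ *: _]addr0; apply: gen_lin; last by apply: gen_zero; apply: is_sumP_base.
  by apply: gen_comp ghj; apply: gen_dual ghi (phi_ext_base _ _) (phi_ext_base _ _).
- exact: hom_scale.
- move=> n' hn'; rewrite -scalemxAl -mulmxA -hdag.
  have -> : wproj (P l) n' = 0.
    by apply/eqP/negPn/negP => /(hull_top hv); rewrite -en leNgt hn'.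
  by rewrite mul0mx mulmx0 scaler0.
by rewrite -scalemxAl eD scalerA mulVf ?scale1r // !mulf_neq0.
Qed.

Lemma hom_generated i j (f : 'M[k]_(mdim (P j), mdim (P i))) : is_hom f ->
  @generated _ _ charp P phi u u' (P i) (P j) f.
Proof.
(* m counts the weights, upwards from -[wbound (P i)], on which f may be nonzero; subtracting the
   map D of [top_component] removes the highest of them. *)
have step (m : nat) : forall f : 'M[k]_(mdim (P j), mdim (P i)), is_hom f ->
    (forall n, - (wbound (P i))%:Z + m%:Z <= n -> f *m wproj (P i) n = 0) ->
    @generated _ _ charp P phi u u' (P i) (P j) f.
  elim: m => [|m IH] g hg habove.
    have -> : g = 0.
      apply: wproj_ext => n; rewrite mul0mx.
      case: (lerP (- (wbound (P i))%:Z) n) => h; first by apply: habove; rewrite addr0.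
      by rewrite wproj_out ?mulmx0 // h.
    by apply: gen_zero; apply: is_sumP_base.
  set n := - (wbound (P i))%:Z + m%:Z.
  have hab n' : n < n' -> g *m wproj (P i) n' = 0 by move=> h; apply: habove; lia.
  have [T0|T0] := eqVneq (g *m wproj (P i) n) 0.
    apply: IH => // n'; rewrite -/n le_eqVlt => /orP[/eqP <-|] //; exact: hab.
  have [D [gD hD Dabove eD]] := top_component hg hab T0.
  have -> : g = 1 *: D + (g - D) by rewrite scale1r addrC subrK.
  apply: gen_lin => //; apply: IH; first exact: hom_sub.
  move=> n'; rewrite -/n mulmxBl le_eqVlt => /orP[/eqP <-|h]; first by rewrite eD subrr.
  by rewrite hab // Dabove // subrr.
move=> hf; apply: (step ((wbound (P i)).*2.+1)) => // n hn.
by rewrite wproj_out ?mulmx0 //; apply/orP; right; lia.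
Qed.

Lemma block_generated m n (D : 'I_m -> mod) (E : 'I_n -> mod) :
  (forall a, is_sumP P (D a)) -> (forall b, is_sumP P (E b)) ->
  (forall a b (f : 'M[k]_(mdim (E b), mdim (D a))), is_hom f ->
    @generated _ _ charp P phi u u' (D a) (E b) f) ->
  forall f : 'M[k]_(mdim (dsum E), mdim (dsum D)), is_hom f ->
    @generated _ _ charp P phi u u' (dsum D) (dsum E) f.
Proof.
move=> hD hE h f hf; rewrite -[f](submxblockK (p_ := fun b => mdim (E b)) (q_ := fun a => mdim (D a))).
apply: gen_dsum => // a b; apply: h; rewrite submxblockEv.
apply: (@hom_submxrow _ _ charp m D (E b)).
by apply: (@hom_submxcol _ _ charp n E (dsum D)).
Qed.

(** Induction on the construction of both sums as iterated direct sums; when only one of them is a P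
    i, [dsum1] makes it a sum with one term so that blocks can be used. *)
Lemma sumP_generated M L : is_sumP P M -> is_sumP P L ->
  forall f : 'M[k]_(mdim L, mdim M), is_hom f -> @generated _ _ charp P phi u u' M L f.
Proof.
move=> hM; elim: hM L => {M} [i|m D hD IH] L; elim=> {L} [j|n E hE IHL].
- exact: hom_generated.
- have := @block_generated _ _ (fun _ : 'I_1 => P i) E (fun=> is_sumP_base P i) hE (fun=> IHL).
  by rewrite dsum1.
- have := @block_generated _ _ D (fun _ : 'I_1 => P j) hD (fun=> is_sumP_base P j)
    (fun a _ => IH a _ (is_sumP_base P j)).
  by rewrite dsum1.
- by apply: block_generated => // a b; apply: IH.
Qed.
End Generators.

Theorem proposition6p8 (k : closedFieldType) (p : nat)
  (charp : p \in [pchar k]) (hp : (2 < p)%N)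
  (Delta : int -> G2Tmod charp)
  (hDelta : forall n : int, is_Delta2 n (Delta n))
  (P : int -> G2Tmod charp)
  (hP : forall i : int, is_T2 (lam p i) (P i))
  (hPtwist : forall i a : int, P (i + 2 * a * p%:Z) = twist (P i) (2 * a))
  (phi : forall i : int, 'M[k]_(mdim (P i)))
  (hphi : forall i : int, is_symform (phi i))
  (u : forall i : int, 'M[k]_(mdim (P (i + 1)), mdim (P i)))
  (hu : forall i : int, u_range p i ->
     @is_gbar k p charp (Delta (lam p i)) (P i) (P (i + 1)) (u i))
  (u' : forall i : int, 'M[k]_(mdim (P (u'_target p i)), mdim (P i)))
  (hu' : forall i : int, u'_range p i ->
     @is_gbar k p charp (Delta (lam p i)) (P i) (P (u'_target p i)) (u' i)) :
  (forall Q : G2Tmod charp, in_P20 Q ->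
     exists M : G2Tmod charp, is_sumP P M /\ isomorphic Q M) /\
  (forall (M N : G2Tmod charp) (f : 'M[k]_(mdim N, mdim M)),
     is_sumP P M -> is_sumP P N -> is_hom f -> generated phi u u' f).
Proof.
split; first by move=> Q; exact: (decomposition hp hP).
by move=> M L f hM hL; exact: (sumP_generated hp hDelta hP hPtwist hphi hu hu').
Qed.
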